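(* Let Assumption A1 hold and fix $\tau>0$. For each edge $e\in\mathcal E$, let $\widetilde u_e$ be the generalized Whittle–Matérn field with $\alpha=1$ and coefficients $\kappa_e,a_e$ on the metric graph consisting of the single edge $[0,\ell_e]$ (i.e. the solution of $(\kappa_e^2-\frac{d}{dt}(a_e\frac{d}{dt}))^{1/2}(\tau\widetilde u_e)=\mathcal W_e$ with Neumann conditions $\widetilde u_e'(0)=\widetilde u_e'(\ell_e)=0$ for the operator and $\mathcal W_e$ white noise on $L_2(e)$), with $\{\widetilde u_e:e\in\mathcal E\}$ mutually independent. Let $\widehat B^1\widetilde u=(\widetilde u_e(0),\widetilde u_e(\ell_e))_{e\in\mathcal E}\in\mathbb R^{2|\mathcal E|}$, and let $K$ be any matrix with $2|\mathcal E|$ columns such that for every $x=(x_{e,0},x_{e,\ell_e})_{e\in\mathcal E}\in\mathbb R^{2|\mathcal E|}$ one has $Kx=0$ if and only if $x_{e,b}=x_{e',b'}$ whenever the endpoint $b\in\{0,\ell_e\}$ of $e$ and the endpoint $b'$ of $e'$ are the same vertex of $\Gamma$. Define, for $t\in[0,\ell_e]$, $e\in\mathcal E$, $$u(t,e)=\widetilde u_e(t)-\mathbb E\big[\widetilde u_e(t)\,\big|\,\sigma(K\widehat B^1\widetilde u)\big]$$ (i.e. $\widetilde u$ conditioned on $K\widehat B^1\widetilde u=0$). Then $u$ is well defined as a field on $\Gamma$ (its values at a vertex do not depend on the edge) and it has the same law as the generalized Whittle–Matérn field on $\Gamma$ with $\alpha=1$, coefficients $\kappa,a$ and parameter $\tau$,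 i.e. the solution of $(\kappa^2-\nabla(a\nabla))^{1/2}(\tau u)=\mathcal W$ on $\Gamma$ with Kirchhoff vertex conditions.
   Context: $\Gamma$ is a compact connected metric graph (finite vertex set $\mathcal V$, finite edge set $\mathcal E$, each edge $e$ identified with $[0,\ell_e]$); $f_e$ restriction to $e$. $\partial_ef(v)$: derivative of $f_e$ at vertex $v$ pointing into $e$; $\mathcal E_v$: edges at $v$. Assumption A1: $\kappa\in L^\infty(\Gamma)$, $\operatorname{ess\,inf}\kappa\ge\kappa_0>0$; $a:\Gamma\to\mathbb R$ Lipschitz, $a\ge a_0>0$. On a compact metric graph $G$ with coefficients satisfying A1, $L$ is the operator $(Lf)_e=-(a_ef_e')'+\kappa_e^2f_e$ with domain $\{f\in\bigoplus_eH^2(e)\cap C(G):\sum_{e\in\mathcal E_v}\partial_ef(v)=0\ \forall v\}$ (Kirchhoff conditions; for a single edge these are Neumann conditions); it is self-adjoint positive definite with compact inverse and eigenpairs $(\lambda_k,e_k)$. The generalized Whittle–Matérn field with exponent $\alpha>1/2$ and $\tau>0$ is the solution of $L^{\alpha/2}(\tau u)=\mathcal W$ with $\mathcal W$ Gaussian white noise on $L_2(G)$, i.e. $u=\tau^{-1}\sum_k\lambda_k^{-\alpha/2}\xi_ke_k$ with $\xi_k$ i.i.d. $N(0,1)$; here $\nabla(a\nabla)$ denotes the edgewise operator $f\mapsto(a_ef_e')'$. *)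

(* Defs.v *)
From HB Require Import structures.
From mathcomp Require Import all_boot all_order all_algebra.
From mathcomp Require Import all_classical all_reals all_analysis.
Set Implicit Arguments. Unset Strict Implicit. Unset Printing Implicit Defensive.
Import Order.TTheory GRing.Theory Num.Theory.
Import numFieldNormedType.Exports.
Local Open Scope classical_set_scope.
Local Open Scope ring_scope.

(* Compact metric graph: finite vertex type V, finite edge type E, each edge   *)
(* e an interval [0, len e] going from vertex src e (at 0) to tgt e (at       *)
(* len e).  An "edge end" is a pair (e, b) : E * bool, b = false for the      *)
(* endpoint 0 and b = true for the endpoint len e.                            *)

Definition endv {V E : Type} (src tgt : E -> V) (c : E * bool) : V :=
  if c.2 then tgt c.1 else src c.1.

Definition endpos {R : realType} {E : Type} (len : E -> R) (c : E * bool) : R :=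
  if c.2 then len c.1 else 0.

Definition gadj {V E : finType} (src tgt : E -> V) : rel V :=
  fun v w => [exists e, ((src e == v) && (tgt e == w)) || ((src e == w) && (tgt e == v))].

Definition in_edge {R : realType} (l t : R) : Prop := 0 <= t <= l.

(* The edgewise operator  f |-> -(a f')' + k^2 f  on [0,l].                   *)
(* edge_L l k a f g df : f is in H^2(0,l) with derivative df and             *)
(* -(a f')' + k^2 f = g in L_2(0,l).  Written out: f is the integral of df,   *)
(* a*df is absolutely continuous with derivative k^2 f - g (so df is the      *)
(* continuous representative of f', in particular df 0, df l are the         *)
(* one-sided derivatives at the endpoints), and g is square integrable.       *)
Definition edge_L {R : realType} (l : R) (k a f g df : R -> R) : Prop :=
  measurable_fun `[0, l] g /\
  (lebesgue_measure).-integrable `[0, l] (fun x => (g x ^+ 2)%:E) /\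
  (lebesgue_measure).-integrable `[0, l] (fun x => (df x)%:E) /\
  (lebesgue_measure).-integrable `[0, l] (fun x => (k x ^+ 2 * f x - g x)%:E) /\
  (forall x, in_edge l x ->
     f x = f 0 + Rintegral lebesgue_measure `[0, x] df) /\
  (forall x, in_edge l x ->
     a x * df x = a 0 * df 0 +
       Rintegral lebesgue_measure `[0, x] (fun y => k y ^+ 2 * f y - g y)).

Definition neumann_L {R : realType} (l : R) (k a f g : R -> R) : Prop :=
  exists df : R -> R, edge_L l k a f g df /\ df 0 = 0 /\ df l = 0.

(* Metric graph with Kirchhoff vertex conditions: f in D(L), L f = g.
   Continuity at vertices and sum over edge ends at v of the derivative
   pointing into the edge equals 0 (self-loops contribute both ends). *)
Definition graph_L {R : realType} {V E : finType} (src tgt : E -> V) (len : E -> R)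
    (k a f g : E -> R -> R) : Prop :=
  exists df : E -> R -> R,
    (forall e, edge_L (len e) (k e) (a e) (f e) (g e) (df e)) /\
    (forall c c' : E * bool, endv src tgt c = endv src tgt c' ->
        f c.1 (endpos len c) = f c'.1 (endpos len c')) /\
    (forall v : V,
        \sum_(c : E * bool | endv src tgt c == v)
           (if c.2 then - df c.1 (len c.1) else df c.1 0) = 0).

Definition edge_ip {R : realType} (l : R) (f g : R -> R) : R :=
  Rintegral lebesgue_measure `[0, l] (fun t => f t * g t).

Definition edge_L2 {R : realType} (l : R) (f : R -> R) : Prop :=
  measurable_fun `[0, l] f /\
  (lebesgue_measure).-integrable `[0, l] (fun t => (f t ^+ 2)%:E).

Definition graph_ip {R : realType} {E : finType} (len : E -> R) (f g : E -> R -> R) : R :=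
  \sum_(e : E) edge_ip (len e) (f e) (g e).

Definition edge_eigenbasis {R : realType} (l : R) (k a : R -> R)
    (lam : nat -> R) (phi : nat -> R -> R) : Prop :=
  (forall n, neumann_L l k a (phi n) (fun t => lam n * phi n t)) /\
  (forall n m, edge_ip l (phi n) (phi m) = (n == m)%:R) /\
  (forall f, edge_L2 l f -> (forall n, edge_ip l f (phi n) = 0) ->
     {ae lebesgue_measure, forall t, in_edge l t -> f t = 0}).

Definition graph_eigenbasis {R : realType} {V E : finType} (src tgt : E -> V)
    (len : E -> R) (k a : E -> R -> R)
    (lam : nat -> R) (phi : nat -> E -> R -> R) : Prop :=
  (forall n, graph_L src tgt len k a (phi n) (fun e t => lam n * phi n e t)) /\
  (forall n m, graph_ip len (phi n) (phi m) = (n == m)%:R) /\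
  (forall f : E -> R -> R, (forall e, edge_L2 (len e) (f e)) ->
     (forall n, graph_ip len f (phi n) = 0) ->
     forall e, {ae lebesgue_measure, forall t, in_edge (len e) t -> f e t = 0}).

Definition iid_std_normal {R : realType} {d : measure_display} {Omega : measurableType d}
    (P : probability Omega R) {I : eqType} (xi : I -> Omega -> R) : Prop :=
  (forall i, measurable_fun setT (xi i)) /\
  (forall i (B : set R), measurable B -> P (xi i @^-1` B) = normal_prob 0 1 B) /\
  (forall (s : seq I) (B : I -> set R), uniq s -> (forall i, measurable (B i)) ->
     P (\bigcap_(i in [set j | j \in s]) (xi i @^-1` B i)) =
     (\prod_(i <- s) P (xi i @^-1` B i))%E).

Definition is_condexp {R : realType} {d : measure_display} {Omega : measurableType d}
    (P : probability Omega R) (G : set (set Omega)) (X Z : Omega -> R) : Prop :=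
  (forall B : set R, measurable B -> G (Z @^-1` B)) /\
  P.-integrable setT (fun x => (Z x)%:E) /\
  (forall A, G A -> (\int[P]_(x in A) (Z x)%:E = \int[P]_(x in A) (X x)%:E)%E).

Definition kl_partial {R : realType} {Omega : Type} (tau : R) (lam : nat -> R)
    (xi : nat -> Omega -> R) (phik : nat -> R) (n : nat) (x : Omega) : R :=
  \sum_(j < n) tau^-1 * (Num.sqrt (lam j))^-1 * xi j x * phik j.

(* w (a random function on [0,l]) is the generalized Whittle-Matern field with
   alpha = 1 built from the eigenbasis (lam, phi) and the normals xi:
   w t = tau^{-1} sum_k lam_k^{-1/2} xi_k phi_k(t), the series converging in
   L_2(P) for every t. *)
Definition is_KL_field {R : realType} {d : measure_display} {Omega : measurableType d}
    (P : probability Omega R) (tau l : R) (lam : nat -> R) (phi : nat -> R -> R)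
    (xi : nat -> Omega -> R) (w : R -> Omega -> R) : Prop :=
  forall t, in_edge l t ->
    measurable_fun setT (w t) /\
    (\int[P]_x ((kl_partial tau lam xi (fun j => phi j t) n x - w t x) ^+ 2)%:E)%E
        @[n --> \oo] --> 0%E.

Definition same_fdd {R : realType} {E : Type} (len : E -> R)
    {d : measure_display} {Omega : measurableType d} (P : probability Omega R)
    (u : E -> R -> Omega -> R)
    {d' : measure_display} {Omega' : measurableType d'} (Q : probability Omega' R)
    (w : E -> R -> Omega' -> R) : Prop :=
  forall (n : nat) (pts : 'I_n -> E * R) (B : 'I_n -> set R),
    (forall i, in_edge (len (pts i).1) (pts i).2) ->
    (forall i, measurable (B i)) ->
    P (\bigcap_i (u (pts i).1 (pts i).2 @^-1` B i)) =
    Q (\bigcap_i (w (pts i).1 (pts i).2 @^-1` B i)).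

(* Main.v *)
Require Import Defs.
From HB Require Import structures.
From mathcomp Require Import all_boot all_order all_algebra.
From mathcomp Require Import all_classical all_reals all_analysis.
From mathcomp Require Import measurable_realfun ring lra.
Import Order.TTheory GRing.Theory Num.Theory.
Import numFieldNormedType.Exports.
Local Open Scope classical_set_scope.
Local Open Scope ring_scope.

(* Conditioning a Gaussian series on finitely many of its linear functionals subtracts an
   l2-projection of the coefficient sequences, so both fields are Gaussian series, and
   finite-dimensional laws are determined by the values E cos(sum_j t_j X_j + th).  It remains
   to compare the variances of sum_j t_j u(x_j).  On both sides this is tau^-2 times the squared
   norm of the functional f |-> sum_j t_j f(x_j), dual to the energy norm
   int a f'^2 + kappa^2 f^2, on the edgewise H^1 functions that are continuous at the vertices:
   for the Kirchhoff field directly, and for the conditioned field because the projection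
   changes the functional only by combinations of endpoint jumps and its representer has no
   jumps.  As kappa is only almost everywhere bounded, kappa^2 is replaced by a clamped
   version. *)

(** * Bounded measurable functions *)

(** No Hilbert space is completed. The energy form lives on functions with bounded edgewise
    derivatives, which include the eigenfunctions because [a f'] is a primitive of an integrable
    function and [a >= a0]. The Riesz representer of a point functional exists only as its truncated
    eigenfunction expansions [testfun]. For the conditioned field their endpoint jumps vanish only
    in the limit, so each truncation is corrected by finitely many piecewise linear functions whose
    energy tends to 0. Point values of expansions are controlled by square summability of
    [lambda_k^(-1/2) phi_k(x)]. This is read off from the assumed mean-square convergence of the
    fields, through characteristic functions, and not from eigenvalue asymptotics. The Kirchhoff and
    Neumann conditions enter only as natural boundary conditions: they remove the boundary terms of
    the weak form. The Kirchhoff sum carries no weight [a] while the boundary terms do; continuity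
    of [a] at the vertices reconciles the two. *)

Definition bmeas {d} {T : measurableType d} {R : realType} (D : set T) (f : T -> R) :=
  measurable_fun D f /\ exists M : R, forall x, D x -> `|f x| <= M.

Section bounded_measurable.
Context {d : measure_display} {T : measurableType d} {R : realType}.
Implicit Types (D : set T) (f g : T -> R).

Lemma bmeas_cst D c : bmeas D (fun=> c : R).
Proof. by split; [exact: measurable_cst | exists `|c|]. Qed.

Lemma bmeasD D f g : bmeas D f -> bmeas D g -> bmeas D (fun x => f x + g x).
Proof.
move=> [mf [M Mf]] [mg [N Ng]]; split; first exact: measurable_funD.
exists (M + N) => x Dx; apply: le_trans (ler_normD _ _) _.
by apply: lerD; [exact: Mf | exact: Ng].
Qed.

Lemma bmeasM D f g : bmeas D f -> bmeas D g -> bmeas D (fun x => f x * g x).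
Proof.
move=> [mf [M Mf]] [mg [N Ng]]; split; first exact: measurable_funM.
exists (M * N) => x Dx; rewrite normrM.
by apply: ler_pM => //; [exact: Mf | exact: Ng].
Qed.

Lemma bmeasZ D c f : bmeas D f -> bmeas D (fun x => c * f x).
Proof. by move=> bf; apply: bmeasM => //; exact: bmeas_cst. Qed.

Lemma bmeasN D f : bmeas D f -> bmeas D (fun x => - f x).
Proof.
move=> bf; have := bmeasZ _ (-1) _ bf.
by under eq_fun do rewrite mulN1r.
Qed.

Lemma bmeasB D f g : bmeas D f -> bmeas D g -> bmeas D (fun x => f x - g x).
Proof. by move=> bf bg; apply: bmeasD => //; exact: bmeasN. Qed.

Lemma bmeasX D f n : bmeas D f -> bmeas D (fun x => f x ^+ n).
Proof.
move=> bf; elim: n => [|n IH].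
  by under eq_fun do rewrite expr0; exact: bmeas_cst.
by under eq_fun do rewrite exprS; exact: bmeasM.
Qed.

Lemma bmeas_sum D (I : Type) (s : seq I) (F : I -> T -> R) :
  (forall i, bmeas D (F i)) -> bmeas D (fun x => \sum_(i <- s) F i x).
Proof.
move=> bF; elim: s => [|i s IH].
  by under eq_fun do rewrite big_nil; exact: bmeas_cst.
by under eq_fun do rewrite big_cons; exact: bmeasD.
Qed.

Lemma bmeas_indic (B : set T) : measurable B -> bmeas setT (\1_B : T -> R).
Proof.
move=> mB; split; first exact: measurable_indic.
exists 1 => x _; rewrite indicE; case: (x \in B) => /=; by rewrite ?normr1 ?normr0.
Qed.

Lemma bmeas_sub (D D' : set T) f :
  measurable D -> D' `<=` D -> bmeas D f -> bmeas D' f.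
Proof.
move=> mD sD [mf [M Mf]]; split; first exact: measurable_funS mf.
by exists M => x /sD; exact: Mf.
Qed.

Lemma bmeas_comp {d'} {T' : measurableType d'} (h : T' -> T) f :
  measurable_fun setT h -> bmeas setT f -> bmeas setT (f \o h).
Proof.
move=> mh [mf [M Mf]]; split; first exact: measurableT_comp.
by exists M => x _; exact: Mf.
Qed.

Lemma bmeas_integrable (mu : {measure set T -> \bar R}) D f :
  measurable D -> (mu D < +oo)%E -> bmeas D f -> mu.-integrable D (EFin \o f).
Proof.
move=> mD muD [mf [M Mf]]; apply: measurable_bounded_integrable => //.
exists M; split; first exact: num_real.
by move=> N MN x Dx; apply: le_trans (Mf _ Dx) (ltW MN).
Qed.

Lemma Rintegral_norm_le (mu : {measure set T -> \bar R}) D f M :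
  measurable D -> (mu D < +oo)%E -> measurable_fun D f ->
  (forall x, D x -> `|f x| <= M) -> `|Rintegral mu D f| <= M * fine (mu D).
Proof.
move=> mD muD mf Mf.
have bf : bmeas D f by split=> //; exists M.
apply: le_trans.
  by apply: le_normr_Rintegral => //; exact: bmeas_integrable.
rewrite -Rintegral_cst//; apply: le_Rintegral => //.
- apply: (bmeas_integrable mu D (fun x => `|f x|)) => //; split.
    exact: measurableT_comp.
  by exists M => x Dx; rewrite normr_id Mf.
- exact: (bmeas_integrable mu D (fun=> M) mD muD (bmeas_cst _ _)).
Qed.

Lemma integrable_Rintegral_linear (mu : {measure set T -> \bar R}) D (a : R) f g :
  measurable D -> mu.-integrable D (EFin \o f) -> mu.-integrable D (EFin \o g) ->
  Rintegral mu D (fun x => a * f x + g x) = a * Rintegral mu D f + Rintegral mu D g.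
Proof.
move=> mD fi gi.
rewrite RintegralD//; first by rewrite RintegralZl.
have := integrableZl mD a fi.
by apply: eq_integrable.
Qed.

Lemma Rintegral_linear (mu : {measure set T -> \bar R}) D (a : R) f g :
  measurable D -> (mu D < +oo)%E -> bmeas D f -> bmeas D g ->
  Rintegral mu D (fun x => a * f x + g x) = a * Rintegral mu D f + Rintegral mu D g.
Proof.
move=> mD muD bf bg.
by apply: integrable_Rintegral_linear => //; exact: bmeas_integrable.
Qed.

Lemma Rintegral_indicE (mu : {measure set T -> \bar R}) (B : set T) : measurable B ->
  Rintegral mu setT (\1_B : T -> R) = fine (mu B).
Proof. by move=> mB; rewrite /Rintegral integral_indic// setIT. Qed.

(** The sum counts the integers below [z], so it is the ceiling of [z]. The error 1 becomes
    [1 / n.+1] once a function with values in [0, 1] has been scaled by [n.+1]. *)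
Lemma count_lt_bound (n : nat) (z : R) : 0 <= z -> z <= n%:R ->
  z <= \sum_(k < n) (k%:R < z)%R%:R <= z + 1.
Proof.
move=> z0; elim: n => [|n IH] zn.
  by rewrite big_ord0; apply/andP; split; lra.
rewrite big_ord_recr/=; case: (ltP n%:R z) => nz; last first.
  by rewrite addr0; exact: IH.
have -> : \sum_(i < n) ((i : nat)%:R < z)%R%:R = n%:R :> R.
  transitivity (\sum_(i < n) (1 : R)); last by rewrite sumr_const card_ord.
  by apply: eq_bigr => i _; rewrite (lt_trans _ nz)// ltr_nat.
by move: zn; rewrite -natr1 => zn; apply/andP; split => /=; lra.
Qed.

(* Layer-cake sums of indicators approximate a bounded measurable function uniformly. *)
Lemma bounded_functional_eq0 (L : (T -> R) -> R) (C : R) :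
  (forall a f g, bmeas setT f -> bmeas setT g ->
     L (fun x => a * f x + g x) = a * L f + L g) ->
  (forall f M, bmeas setT f -> (forall x, `|f x| <= M) -> `|L f| <= C * M) ->
  (forall B, measurable B -> L (\1_B) = 0) ->
  forall f, bmeas setT f -> L f = 0.
Proof.
move=> Llin Lbnd Lind.
have L0 : L (fun=> 0) = 0.
  by rewrite -[RHS](Lind set0)//; congr L; apply/funext => x; rewrite indic0.
have Lsum n (B : nat -> set T) : (forall k, measurable (B k)) ->
    L (fun x => \sum_(k < n) \1_(B k) x) = 0.
  move=> mB; elim: n => [|n IH].
    by rewrite -[RHS]L0; congr L; apply/funext => x; rewrite big_ord0.
  have -> : (fun x => \sum_(k < n.+1) \1_(B k) x : R) =
      (fun x => 1 * \1_(B n) x + \sum_(k < n) \1_(B k) x).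
    by apply/funext => x; rewrite big_ord_recr/= mul1r addrC.
  rewrite Llin ?Lind ?mulr0 ?add0r//; first exact: bmeas_indic.
  by apply: bmeas_sum => i; exact: bmeas_indic.
have L1 f : bmeas setT f -> (forall x, 0 <= f x <= 1) -> L f = 0.
  move=> bf f01; apply/eqP; rewrite -normr_eq0 eq_le normr_ge0 andbT.
  apply/ler_addgt0Pl => e e0; rewrite addr0.
  have [n ne] : exists n, `|C| / e < n.+1%:R :> R.
    exists (Num.truncn (`|C| / e)); exact: truncnS_gt.
  pose B k := [set x | k%:R < n.+1%:R * f x].
  have mB k : measurable (B k).
    have mnf : measurable_fun setT (fun x => n.+1%:R * f x).
      by apply: measurable_funM => //; case: bf.
    have := mnf measurableT _ (measurable_itv `]k%:R, +oo[).
    rewrite setTI; congr measurable; apply/seteqP; split=> x /=;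
      by rewrite in_itv/= andbT.
  pose g x := \sum_(k < n.+1) \1_(B k) x : R.
  have bg : bmeas setT g by apply: bmeas_sum => k; exact: bmeas_indic.
  have fE : f = fun x => n.+1%:R^-1 * g x + (f x - n.+1%:R^-1 * g x).
    by apply/funext => x; rewrite addrC subrK.
  rewrite fE Llin//; last by apply: bmeasB => //; exact: bmeasZ.
  rewrite Lsum// mulr0 add0r.
  have h x : `|f x - n.+1%:R^-1 * g x| <= n.+1%:R^-1.
    have n0 : (0 : R) < n.+1%:R by [].
    have /andP[f0 f1] := f01 x.
    have := count_lt_bound n.+1 (n.+1%:R * f x) (mulr_ge0 (ltW n0) f0).
    have -> : \sum_(k < n.+1) (k%:R < n.+1%:R * f x)%R%:R = g x.
      apply: eq_bigr => k _; rewrite indicE; congr (nat_of_bool _)%:R.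
      by apply/idP/idP => [kf|]; rewrite ?inE//; apply/mem_set.
    rewrite -{2}[n.+1%:R]mulr1 ler_pM2l// => /(_ f1)/andP[g1 g2].
    have nV : n.+1%:R^-1 * (n.+1%:R * f x) = f x by rewrite mulKf// gt_eqF.
    have i0 : (0 : R) < n.+1%:R^-1 by rewrite invr_gt0.
    rewrite ler_norml; apply/andP; split.
      rewrite lerNl opprB lerBlDr -nV -[X in _ <= X + _]mulr1 -mulrDr.
      by rewrite ler_pM2l// addrC.
    apply: le_trans (_ : 0 <= _); last exact: ltW.
    by rewrite subr_le0 -nV ler_pM2l.
  apply: le_trans (Lbnd _ _ _ h) _; first by apply: bmeasB => //; exact: bmeasZ.
  apply: le_trans (_ : `|C| / n.+1%:R <= _); first by rewrite ler_pM2r ?invr_gt0// ler_norm.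
  rewrite ler_pdivrMr// mulrC; move: ne; rewrite ltr_pdivrMr// => /ltW; exact.
move=> f [mf [M Mf]].
have M0 : 0 < `|M| + 1 by rewrite ltr_wpDl.
(* An affine change moves [f] into [0, 1], where the case already treated applies. The added 1 keeps
   the divisor positive whatever the bound [M] is. *)
pose h x := (2 * (`|M| + 1))^-1 * f x + 2^-1.
have bh : bmeas setT h.
  by apply: bmeasD; [apply: bmeasZ; split=> //; exists M | exact: bmeas_cst].
have Lh : L h = 0.
  apply: L1 => // x; have := Mf x I; rewrite ler_norml => /andP[f1 f2].
  have MM : M <= `|M| + 1 by rewrite (le_trans (ler_norm _))// lerDl.
  have e : (2 * (`|M| + 1))^-1 * f x = 2^-1 * (f x / (`|M| + 1)).
    by rewrite invfM -mulrA (mulrC (f x)).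
  have a1 : f x / (`|M| + 1) <= 1 by rewrite ler_pdivrMr// mul1r; lra.
  have a2 : - 1 <= f x / (`|M| + 1) by rewrite ler_pdivlMr// mulN1r; lra.
  by rewrite /h e; apply/andP; split; lra.
have L2 : L (fun=> 2^-1) = 0.
  by apply: L1; [exact: bmeas_cst | move=> _; apply/andP; split; lra].
have : L h = (2 * (`|M| + 1))^-1 * L f + L (fun=> 2^-1).
  by rewrite Llin//; [split=> //; exists M | exact: bmeas_cst].
rewrite Lh L2 addr0 => /esym/eqP; rewrite mulf_eq0 invr_eq0 mulf_eq0.
by rewrite gt_eqF//= (gt_eqF M0)/= => /eqP.
Qed.

End bounded_measurable.

Lemma Rintegral_dominated_cvg {d} {T : measurableType d} {R : realType}
    (mu : {measure set T -> \bar R}) (D : set T) (h_ : nat -> T -> R) (h g : T -> R) :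
  measurable D -> (forall n, measurable_fun D (h_ n)) ->
  mu.-integrable D (EFin \o g) ->
  (forall x, D x -> h_ n x @[n --> \oo] --> h x) ->
  (forall n x, D x -> `|h_ n x| <= g x) ->
  Rintegral mu D (h_ n) @[n --> \oo] --> Rintegral mu D h.
Proof.
move=> mD mh ig hh hg.
have mh' : measurable_fun D h by apply: measurable_fun_cvg => // n; exact: mh.
have H1 n : measurable_fun D (fun x => (h_ n x)%:E) by exact/measurable_EFinP.
have H2 : measurable_fun D (EFin \o h) by exact/measurable_EFinP.
have H3 : {ae mu, forall x, D x -> (h_ n x)%:E @[n --> \oo] --> (EFin \o h) x}.
  by apply: aeW => x Dx; apply: cvg_EFin; [exact: nearW | exact: hh].
have H4 : {ae mu, forall x n, D x -> (`|(h_ n x)%:E| <= (EFin \o g) x)%E}.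
  by apply: aeW => x n Dx; rewrite lee_fin; exact: hg.
have [i1 _ c1] := dominated_convergence mD H1 H2 H3 ig H4.
by apply: fine_cvg => /=; rewrite fineK//; exact: integrable_fin_num.
Qed.

(** * The characteristic function of the standard normal law *)

Section normal_characteristic_function.
Context {R : realType}.
Implicit Types (c th x : R).
Local Notation mu := (@lebesgue_measure R).
Local Notation N := (@normal_pdf R 0 1).

Lemma normal_pdf01E x : N x = normal_peak 1 * expR (- (x ^+ 2) / 2).
Proof.
rewrite normal_pdfE; last by rewrite oner_eq0.
by rewrite /normal_fun subr0 expr1n.
Qed.

Lemma is_derive_normal_pdf01 x : is_derive x 1 N (- x * N x).
Proof.
have -> : N = fun y => normal_peak 1 * expR (- (y ^+ 2) / 2).
  by apply/funext => y; exact: normal_pdf01E.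
apply: is_derive_eq.
rewrite !scaler0 !add0r/= ?mulr1 ?scaler1 ?addr0.
rewrite /GRing.scale/= ?expr1.
by field.
Qed.

(** The integrand is dominated by a multiple of the normal density of variance 2, because
    [|x| <= 1 + x^2 / 4 <= exp (x^2 / 4)]. The constant [k] is the quotient of the two peaks. *)
Lemma integrable_norm_normal_pdf01 : mu.-integrable setT (fun x => (`|x| * N x)%:E).
Proof.
pose k : R := normal_peak 1 / normal_peak (Num.sqrt 2).
have s2 : Num.sqrt 2 != 0 :> R by rewrite gt_eqF// sqrtr_gt0.
have p1 : (1 : R) != 0 by rewrite oner_eq0.
apply: (@le_integrable _ _ _ mu setT measurableT _
   (fun x => (k * normal_pdf 0 (Num.sqrt 2) x)%:E)).
- apply/measurable_EFinP; apply: measurable_funM; last exact: measurable_normal_pdf.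
  exact: normr_measurable.
- move=> x _ /=; rewrite lee_fin ger0_norm; last first.
    by rewrite mulr_ge0// normal_pdf_ge0.
  rewrite [X in _ <= X]ger0_norm; last first.
    by rewrite mulr_ge0 ?normal_pdf_ge0// divr_ge0 ?normal_peak_ge0.
  rewrite normal_pdf01E normal_pdfE// /normal_fun subr0 sqr_sqrtr//.
  rewrite /k -!mulrA mulKf ?gt_eqF ?normal_peak_gt0//.
  rewrite mulrCA ler_pM2l ?normal_peak_gt0//.
  have -> : - x ^+ 2 / 2 = x ^+ 2 / 4 * - 1 + - (x ^+ 2) / (2 *+ 2) by field.
  rewrite expRD mulrA ler_piMl ?expR_ge0//.
  rewrite mulrN1 expRN ler_pdivrMr ?expR_gt0// mul1r.
  apply: le_trans (expR_ge1Dx _).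
  have := sqr_ge0 (`|x| / 2 - 1).
  rewrite -(real_normK (num_real x)); nra.
- have := integrableZl measurableT k (integrable_normal_pdf 0 (Num.sqrt 2)).
  by apply: eq_integrable.
Qed.

Lemma integrable_bounded_normal_pdf01 (h : R -> R) : bmeas setT h ->
  mu.-integrable setT (fun x => (h x * N x)%:E).
Proof.
move=> [mh [M Mh]].
have ii := integrable_normal_pdf (0 : R) 1.
have bh : [bounded h x | x in setT].
  exists M; split; first exact: num_real.
  by move=> K MK x _; apply: le_trans (Mh _ I) (ltW MK).
by have := @integrableMr _ _ R mu setT measurableT h _ mh bh ii; apply: eq_integrable.
Qed.

Lemma normal_Rintegral_linear a (f g : R -> R) : bmeas setT f -> bmeas setT g ->
  Rintegral mu setT (fun x => (a * f x + g x) * N x) =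
  a * Rintegral mu setT (fun x => f x * N x) + Rintegral mu setT (fun x => g x * N x).
Proof.
move=> bf bg.
rewrite -integrable_Rintegral_linear//; [|exact: integrable_bounded_normal_pdf01..].
by apply: eq_Rintegral => x _; rewrite mulrDl mulrA.
Qed.

Lemma normal_Rintegral_norm_le (f : R -> R) (M : R) : bmeas setT f ->
  (forall x, `|f x| <= M) -> `|Rintegral mu setT (fun x => f x * N x)| <= M.
Proof.
move=> bf fM; have iN := integrable_normal_pdf (0 : R) 1.
have -> : M = Rintegral mu setT (fun x => M * N x).
  by rewrite RintegralZl// /Rintegral integral_normal_pdf/= mulr1.
have iF := integrable_bounded_normal_pdf01 f bf.
apply: (le_trans (le_normr_Rintegral _ iF)) => //.
apply: le_Rintegral => //.
+ exact: integrable_norm.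
+ by have := integrableZl measurableT M iN; apply: eq_integrable.
+ move=> x _; rewrite normrM (ger0_norm (normal_pdf_ge0 _ _ _)).
  by rewrite ler_wpM2r// normal_pdf_ge0.
Qed.

Lemma normal_Rintegral_indic (C : set R) :
  Rintegral mu setT (fun x => \1_C x * N x) = fine (normal_prob 0 1 C).
Proof.
rewrite /normal_prob /Rintegral [in RHS]integral_mkcond; congr fine.
apply: eq_integral => x _; rewrite patchE indicE.
by case: ifP; rewrite ?mul1r ?mul0r.
Qed.

Lemma bmeas_cos c th : bmeas setT (fun x : R => cos (c * x + th)).
Proof.
split; last by exists 1 => x _; exact: cos_max.
have mc : measurable_fun setT (@cos R).
  by apply: continuous_measurable_fun; exact: continuous_cos.
apply: (measurableT_comp mc).
by apply: measurable_funD => //; exact: measurable_funM.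
Qed.

Lemma sin_eq_cos c : sin c = cos (c - pi / 2).
Proof. by rewrite cosBpihalf. Qed.

Lemma cvg_Rintegral_symitv (h : R -> R) : mu.-integrable setT (EFin \o h) ->
  Rintegral mu `[- n%:R, n%:R] h @[n --> \oo] --> Rintegral mu setT h.
Proof.
move=> ih.
have mh : measurable_fun setT h by apply/measurable_EFinP; exact: measurable_int ih.
have E n : Rintegral mu `[- n%:R, n%:R] h = Rintegral mu setT (h \_ `[- n%:R, n%:R]).
  by rewrite Rintegral_mkcond.
under eq_fun do rewrite E.
apply: (Rintegral_dominated_cvg mu setT _ _ (fun x => `|h x|)) => //.
- move=> n; apply/(measurable_restrictT _ _).1 => //.
  exact: measurable_funTS.
- exact: integrable_norm.
- move=> x _; apply: cvg_near_cst; near=> n.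
  rewrite patchE ifT// inE/= in_itv/= -ler_norml.
  by near: n; exact: nbhs_infty_ger.
- move=> n x _; rewrite patchE; case: ifP => // _; by rewrite normr0.
Unshelve. all: by end_near. Qed.

(** Prescribing only [|u n|] covers both ends of the intervals [-n, n] on which the integration by
    parts below is carried out. *)
Lemma cvg_normal_pdf01 (u : nat -> R) :
  (forall n, `|u n| = n%:R) -> N (u n) @[n --> \oo] --> 0.
Proof.
move=> un.
have c2 : normal_peak 1 * (2 * n.+1%:R^-1) @[n --> \oo] --> (0 : R).
  rewrite -[X in _ --> X](mulr0 (normal_peak 1)); apply: cvgMr.
  rewrite -[X in _ --> X](mulr0 2); apply: cvgMr.
  exact: cvg_harmonic.
apply: squeeze_cvgr (cvg_cst 0) c2.
near=> n; rewrite normal_pdf_ge0/= normal_pdf01E ler_pM2l ?normal_peak_gt0 ?oner_eq0//.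
rewrite -(real_normK (num_real (u n))) un mulNr expRN.
rewrite -[X in _ <= X]invrK lef_pV2 ?posrE ?expR_gt0 ?invr_gt0 ?mulr_gt0 ?invr_gt0//.
rewrite invfM invrK; apply: le_trans (expR_ge1Dx _).
have n1 : 1 <= n%:R :> R by rewrite ler1n; near: n; exists 1%N.
rewrite -(natr1 n); move: (n%:R : R) n1 => z z1; have := sqr_ge0 (z - 1); nra.
Unshelve. all: by end_near. Qed.

(** Gaussian integration by parts: the difference of the two integrands is the derivative of
    [sin (c x + th) N(x)], which vanishes at both infinities. *)
Lemma stein_cos c th :
  Rintegral mu setT (fun x => x * sin (c * x + th) * N x) =
  c * Rintegral mu setT (fun x => cos (c * x + th) * N x).
Proof.
pose h x := c * (cos (c * x + th) * N x) - x * sin (c * x + th) * N x.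
have i1 : mu.-integrable setT (EFin \o (fun x => cos (c * x + th) * N x)).
  by apply: integrable_bounded_normal_pdf01; exact: bmeas_cos.
have ms : measurable_fun setT (fun x : R => sin (c * x + th)).
  under eq_fun do rewrite sin_eq_cos -addrA; exact: (bmeas_cos _ _).1.
have i2 : mu.-integrable setT (EFin \o (fun x => x * sin (c * x + th) * N x)).
  apply: le_integrable integrable_norm_normal_pdf01 => //.
    apply/measurable_EFinP; apply: measurable_funM; last exact: measurable_normal_pdf.
    exact: measurable_funM.
  move=> x _ /=; rewrite lee_fin !normrM normr_id ler_wpM2r// ler_piMr// sin_max//.
have ih : mu.-integrable setT (EFin \o h).
  have := integrableB measurableT (integrableZl measurableT c i1) i2.
  by apply: eq_integrable.
have R0 : Rintegral mu setT h = 0.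
  have c1 := cvg_Rintegral_symitv h ih.
  have c2 : Rintegral mu `[- n%:R, n%:R] h @[n --> \oo] --> (0 : R).
    pose F x := sin (c * x + th) * N x.
    have Fh x : is_derive x 1 F (h x).
      have d1 := is_derive_normal_pdf01 x.
      apply: is_derive_eq.
      rewrite /h /GRing.scale/= ?scaler0 ?addr0 ?mulr1 ?add0r.
      by ring.
    have ch : continuous h.
      have cN := @continuous_normal_pdf R 0 1 (oner_neq0 R).
      have ca : continuous (fun x : R => c * x + th).
        move=> x; apply: cvgD; last exact: cvg_cst.
        by apply: cvgM; [exact: cvg_cst | exact: cvg_id].
      move=> x; apply: cvgB.
        apply: cvgM; first exact: cvg_cst.
        apply: cvgM; last exact: cN.
        by apply: continuous_comp; [exact: ca | exact: continuous_cos].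
      apply: cvgM; last exact: cN.
      apply: cvgM; first exact: cvg_id.
      by apply: continuous_comp; [exact: ca | exact: continuous_sin].
    have key n : Rintegral mu `[- n.+1%:R, n.+1%:R] h = F n.+1%:R - F (- n.+1%:R).
      rewrite /Rintegral (@continuous_FTC2 _ h F)//.
      - by rewrite gt0_cp.
      - exact: continuous_subspaceT.
      - have cF x : {for x, continuous F}.
          by apply: differentiable_continuous; apply/derivable1_diffP; apply: ex_derive.
        split.
        + by move=> x _; apply: ex_derive.
        + exact/cvg_at_right_filter/cF.
        + exact/cvg_at_left_filter/cF.
      - by move=> x _; rewrite derive1E; apply: derive_val.
    have c0 (e : R) : `|e| = 1 -> F (e * n.+1%:R) @[n --> \oo] --> (0 : R).
      move=> e1.
      rewrite (cvg_shiftS (fun n => F (e * n%:R))).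
      have cN := cvg_normal_pdf01 (fun n => e * n%:R)
         (fun n => ltac:(by rewrite normrM e1 mul1r normr_nat)).
      apply/cvgr0Pnorm_lt => eps eps0.
      move/cvgr0Pnorm_lt : cN => /(_ _ eps0); apply: filterS => n.
      apply: le_lt_trans; rewrite /F normrM ler_piMl// sin_max//.
    have A1 := c0 1 (normr1 _).
    have A2 : F ((-1) * n.+1%:R) @[n --> \oo] --> (0 : R) by apply: c0; rewrite normrN1.
    have A3 := cvgB A1 A2; rewrite subr0 in A3.
    rewrite -(cvg_shiftS (fun n => Rintegral mu `[- n%:R, n%:R] h)).
    have -> : (fun n => Rintegral mu `[- n.+1%:R, n.+1%:R] h) =
        (fun n => F (1 * n.+1%:R) - F ((-1) * n.+1%:R)).
      by apply/funext => n; rewrite key mul1r mulN1r.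
    exact: A3.
  exact: cvg_unique c1 c2.
have : Rintegral mu setT h = c * Rintegral mu setT (fun x => cos (c * x + th) * N x) -
    Rintegral mu setT (fun x => x * sin (c * x + th) * N x).
  rewrite /h RintegralB//; first by rewrite RintegralZl.
  by have := integrableZl measurableT c i1; apply: eq_integrable.
by rewrite R0 => /esym/eqP; rewrite subr_eq0 => /eqP.
Unshelve. all: by end_near. Qed.

(** Differentiation under the integral produces [- x sin (b x + th)], dominated by [|x|];
    [stein_cos] then turns the derivative back into the function itself. The result is the
    differential equation [F' = - c F]. *)
Lemma is_derive_normal_cos c th :
  is_derive c 1 (fun b => Rintegral mu setT (fun x => cos (b * x + th) * N x))
    (- c * Rintegral mu setT (fun x => cos (c * x + th) * N x)).
Proof.
pose h (b x : R) := cos (b * x + th) * N x.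
have dh (b x : R) : is_derive b (1 : R) (h ^~ x) (- (x * sin (b * x + th) * N x)).
  apply: is_derive_eq.
  rewrite /GRing.scale/= ?scaler0 ?addr0 ?mulr1 ?add0r.
  by ring.
have dE (b x : R) : partial1of2 h b x = - (x * sin (b * x + th) * N x).
  by rewrite partial1of2E; apply: derive_val.
have cI : `](c - 1), (c + 1)[%classic c.
  by rewrite /= in_itv/=; apply/andP; split; lra.
have hi b : `](c - 1), (c + 1)[%classic b -> mu.-integrable setT (EFin \o h b).
  by move=> _; apply: integrable_bounded_normal_pdf01; exact: bmeas_cos.
have hd b x : `](c - 1), (c + 1)[%classic b -> setT x -> derivable (h ^~ x) b 1.
  by move=> _ _; apply: ex_derive.
have G0 y : 0 <= `|y| * N y by rewrite mulr_ge0// normal_pdf_ge0.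
have hb b x : `](c - 1), (c + 1)[%classic b -> setT x ->
   `|partial1of2 h b x| <= `|x| * N x.
  move=> _ _; rewrite dE normrN !normrM (ger0_norm (normal_pdf_ge0 _ _ _)).
  by rewrite ler_wpM2r ?normal_pdf_ge0// ler_piMr// sin_max.
have D1 := derivable_under_integral measurableT cI hi hd G0
  integrable_norm_normal_pdf01 hb.
have D2 := differentiation_under_integral measurableT cI hi hd G0
  integrable_norm_normal_pdf01 hb.
apply: DeriveDef => //.
rewrite -derive1E D2.
under eq_Rintegral do rewrite dE.
rewrite mulNr -stein_cos -mulN1r -RintegralZl//.
  by apply: eq_Rintegral => x _; rewrite mulN1r.
have ms : measurable_fun setT (fun x : R => sin (c * x + th)).
  under eq_fun do rewrite sin_eq_cos -addrA; exact: (bmeas_cos _ _).1.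
apply: le_integrable integrable_norm_normal_pdf01 => //.
  apply/measurable_EFinP; apply: measurable_funM; last exact: measurable_normal_pdf.
  exact: measurable_funM.
by move=> x _ /=; rewrite lee_fin !normrM normr_id ler_wpM2r// ler_piMr// sin_max.
Qed.

(** By the differential equation just obtained, [F(b) exp (b^2 / 2)] is constant, and its value at 0
    is [cos th]. The free phase [th] carries the real and the imaginary part of the characteristic
    function at once. *)
Lemma normal_cosE c th :
  Rintegral mu setT (fun x => cos (c * x + th) * N x) = expR (- c ^+ 2 / 2) * cos th.
Proof.
pose F b := Rintegral mu setT (fun x => cos (b * x + th) * N x).
pose H b := F b * expR (b ^+ 2 / 2).
have dH (b : R) : is_derive b 1 H 0.
  have dF := is_derive_normal_cos b th.
  rewrite -/F in dF.
  apply: is_derive_eq.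
  rewrite /GRing.scale/= ?scaler0 ?addr0 ?mulr1 ?add0r ?expr1.
  rewrite -/(F b); move: (F b) (expR _) => y z; rewrite mulr0 mulr0 add0r.
  by have -> : 2^-1 * (b + b) = b by [lra]; ring.
have Hc : H c = H 0 by exact: (is_derive_0_is_cst c 0 dH).
have F0 : F 0 = cos th.
  rewrite /F; under eq_Rintegral do rewrite mul0r add0r.
  rewrite RintegralZl//; last exact: integrable_normal_pdf.
  by rewrite /Rintegral integral_normal_pdf/= mulr1.
move: Hc; rewrite /H expr0n/= mul0r expR0 mulr1 F0 => <-.
by rewrite mulrCA -expRD mulNr addNr expR0 mulr1.
Qed.

End normal_characteristic_function.

Lemma probability_Rintegral_norm_le {d} {T : measurableType d} {R : realType}
    (P : probability T R) (f : T -> R) (M : R) :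
  bmeas setT f -> (forall x, `|f x| <= M) -> `|Rintegral P setT f| <= M.
Proof.
move=> [mf _] fM; have P1 : fine (P setT) = 1 by rewrite probability_setT.
have PT : (P setT < +oo)%E by rewrite probability_setT ltry.
have := Rintegral_norm_le P setT f M measurableT PT mf (fun x _ => fM x).
by rewrite [X in _ * X](_ : _ = 1) ?mulr1.
Qed.

(** * Cosines of finite sums of independent normals *)

Section iid_normal_sums.
Context {d : measure_display} {T : measurableType d} {R : realType}.
Variables (P : probability T R) (I : choiceType) (xi : I -> T -> R).
Hypothesis xi_iid : iid_std_normal P xi.
Local Notation N := (@normal_pdf R 0 1).
Local Notation mu := (@lebesgue_measure R).

Let evt (s : seq I) (B : I -> set R) := \big[setI/setT]_(i <- s) (xi i @^-1` B i).

Let mxi i : measurable_fun setT (xi i).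
Proof. by case: xi_iid. Qed.

Let mpre i (B : set R) : measurable B -> measurable (xi i @^-1` B).
Proof. by move=> mB; rewrite -[X in measurable X]setTI; exact: mxi. Qed.

Let mevt s B : (forall i, measurable (B i)) -> measurable (evt s B).
Proof. by move=> mB; apply: bigsetI_measurable => i _; exact: mpre. Qed.

Let PT : (P setT < +oo)%E.
Proof. by rewrite probability_setT ltry. Qed.

Let Pevt s B : uniq s -> (forall i, measurable (B i)) ->
  P (evt s B) = (\prod_(i <- s) P (xi i @^-1` B i))%E.
Proof. by move=> us mB; rewrite /evt -bigcap_seq; case: xi_iid => _ [_]; exact. Qed.

Lemma bmeas_cos_comp (X : T -> R) th : measurable_fun setT X ->
  bmeas setT (fun x => cos (X x + th)).
Proof.
move=> mX; have := bmeas_comp _ _ mX (bmeas_cos 1 th).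
by rewrite /comp; under eq_fun do rewrite mul1r.
Qed.

Lemma measurable_fun_lincomb (J : Type) (s : seq J) (c : J -> R) (X : J -> T -> R) :
  (forall i, measurable_fun setT (X i)) ->
  measurable_fun setT (fun x => \sum_(i <- s) c i * X i x).
Proof.
by move=> mX; apply: measurable_sum => i; apply: measurable_funM => //; exact: mX.
Qed.

(** Independence is available only as a product formula for events, so the induction on [s] carries
    an event on the remaining indices [s']. A variable is split off by testing against indicators of
    its values, and such an indicator is absorbed into the event of the induction hypothesis. No
    product measure is formed. *)
Lemma iid_normal_cos_event (s : seq I) : uniq s ->
  forall (s' : seq I) (B : I -> set R) (c : I -> R) th,
  uniq s' -> {in s', forall i, i \notin s} -> (forall i, measurable (B i)) ->
  Rintegral P setT (fun x => \1_(evt s' B) x * cos (\sum_(i <- s) c i * xi i x + th)) =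
  expR (- (\sum_(i <- s) c i ^+ 2) / 2) * cos th * fine (P (evt s' B)).
Proof.
elim: s => [_|i s IH /= /andP[nis us]] s' B c th us' s's mB.
  under eq_Rintegral do rewrite big_nil add0r mulrC.
  rewrite big_nil oppr0 mul0r expR0 mul1r RintegralZl ?Rintegral_indicE//; first exact: mevt.
  by apply: bmeas_integrable => //; apply: bmeas_indic; exact: mevt.
set A := evt s' B; set e := expR (- (\sum_(i <- s) c i ^+ 2) / 2).
have mA : measurable A by exact: mevt.
pose W (phi : R) x : R := \1_A x * cos (\sum_(i <- s) c i * xi i x + phi).
have bW phi : bmeas setT (W phi).
  apply: bmeasM; first exact: bmeas_indic.
  by apply: bmeas_cos_comp; exact: measurable_fun_lincomb.
have W1 phi x : `|W phi x| <= 1.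
  rewrite normrM; apply: mulr_ile1 => //; last exact: cos_max.
  by rewrite indicE; case: (x \in A) => /=; rewrite ?normr1 ?normr0.
(* For any bounded [g], the variable [xi i] may be integrated out against the normal density. Both
   sides are bounded linear functionals of [g], so indicators of Borel sets [C] suffice; there the
   event is enlarged by the condition that [xi i] lies in [C]. *)
have key phi (g : R -> R) : bmeas setT g ->
    Rintegral P setT (fun x => W phi x * g (xi i x)) =
    e * cos phi * fine (P A) * Rintegral mu setT (fun x => g x * N x).
  move=> bg; set k := e * cos phi * fine (P A).
  pose L (h : R -> R) := Rintegral P setT (fun x => W phi x * h (xi i x)) -
    k * Rintegral mu setT (fun x => h x * N x).
  have bWh h : bmeas setT h -> bmeas setT (fun x => W phi x * h (xi i x)).
    move=> bh; apply: bmeasM => //; exact: (bmeas_comp _ _ (mxi i) bh).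
  suff : L g = 0 by rewrite /L => /eqP; rewrite subr_eq0 => /eqP.
  apply: (bounded_functional_eq0 L (1 + `|k|)) bg.
  - move=> a f h bf bh; rewrite /L normal_Rintegral_linear//.
    have -> : (fun x => W phi x * (a * f (xi i x) + h (xi i x))) =
      (fun x => a * (W phi x * f (xi i x)) + W phi x * h (xi i x)).
      by apply/funext => x; rewrite mulrDr mulrCA.
    rewrite Rintegral_linear//; [|exact: bWh|exact: bWh].
    ring.
  - move=> f M bf fM; apply: le_trans (ler_normB _ _) _; rewrite mulrDl mul1r.
    apply: lerD.
      apply: probability_Rintegral_norm_le; first exact: bWh.
      move=> x; rewrite normrM -[M]mul1r; apply: ler_pM => //; exact: W1.
    rewrite normrM ler_wpM2l//.
    exact: normal_Rintegral_norm_le.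
  - move=> C mC; pose B' j := if j == i then C else B j.
    have mB' j : measurable (B' j) by rewrite /B'; case: ifP.
    have is' : i \notin s' by apply/negP => /s's; rewrite mem_head.
    have E1 : evt (i :: s') B' = xi i @^-1` C `&` A.
      rewrite /evt big_cons /B' eqxx; congr (_ `&` _).
      by apply: eq_big_seq => j js'; case: eqP => // ji; rewrite -ji js' in is'.
    have := IH us (i :: s') B' c phi _ _ mB'.
    rewrite E1 /= is' us' => /(_ isT) H.
    have {}H := H (fun j jis => ltac:(move: jis; rewrite inE => /predU1P[->//|/s's];
       by rewrite inE negb_or => /andP[])).
    rewrite /L; apply/eqP; rewrite subr_eq0; apply/eqP.
    transitivity (Rintegral P setT (fun x => \1_(xi i @^-1` C `&` A) x *
       cos (\sum_(i <- s) c i * xi i x + phi))).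
      apply: eq_Rintegral => x _; rewrite /W mulrAC; congr (_ * _).
      by rewrite indicI mulrC; congr (_ * _).
    rewrite H -E1 Pevt//= ?is'// big_cons /B' eqxx.
    have -> : (\prod_(j <- s') P (xi j @^-1` B' j) = P A)%E.
      rewrite Pevt//; apply: eq_big_seq => j js'; rewrite /B'.
      by case: eqP => // ji; rewrite -ji js' in is'.
    case: xi_iid => _ [/(_ i C mC) -> _].
    by rewrite fineM ?fin_num_measure// -/e /k normal_Rintegral_indic; ring.
(* The addition formula, with every sine written as a cosine shifted by [pi / 2], so that [key]
   applies to both terms. The second term has expectation 0 because [cos (pi / 2) = 0]. *)
have cE x : \1_A x * cos (\sum_(j <- i :: s) c j * xi j x + th) =
    W th x * cos (c i * xi i x + 0) - W (th - pi / 2) x * cos (c i * xi i x + - (pi / 2)).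
  rewrite /W big_cons -addrA addr0 cosD cosBpihalf addrA cosBpihalf; ring.
under eq_Rintegral do rewrite cE.
have bc a b : bmeas setT (fun x : R => cos (a * x + b)) by exact: bmeas_cos.
have bWc f a b : bmeas setT (fun x => W f x * cos (a * xi i x + b)).
  by apply: bmeasM => //; exact: (bmeas_comp _ _ (mxi i) (bc a b)).
rewrite RintegralB//; [|exact: bmeas_integrable..].
rewrite (key th (fun y => cos (c i * y + 0)) (bc _ _)).
rewrite (key _ (fun y => cos (c i * y + - (pi / 2))) (bc _ _)).
rewrite !normal_cosE cosN cos_pihalf cos0 !mulr0 subr0 mulr1 big_cons.
rewrite opprD mulrDl expRD -/e -mulrA (mulrC (expR _) e); ring.
Qed.

Lemma iid_normal_cos (s : seq I) (c : I -> R) th : uniq s ->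
  Rintegral P setT (fun x => cos (\sum_(i <- s) c i * xi i x + th)) =
  expR (- (\sum_(i <- s) c i ^+ 2) / 2) * cos th.
Proof.
move=> us; have := iid_normal_cos_event s us [::] (fun=> setT) c th.
rewrite /evt big_nil probability_setT /= mulr1 => <- //.
by apply: eq_Rintegral => x _; rewrite indicT mul1r.
Qed.

(** The hypothesis fixes the law of [xi i] on Borel sets only. The truncations [min |y| n] are
    bounded, so their expectations pass to the normal density and stay below the absolute moment
    [K]; monotone convergence removes the truncation. *)
Lemma iid_normal_integrable i : P.-integrable setT (EFin \o xi i).
Proof.
pose f (n : nat) x : R := Num.min `|xi i x| n%:R.
pose g (n : nat) (y : R) : R := Num.min `|y| n%:R.
have bg n : bmeas setT (g n).
  split; first by apply: measurable_minr.
  exists n%:R => y _; rewrite ger0_norm; last by rewrite le_min normr_ge0 ler0n.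
  by rewrite ge_min lexx orbT.
have iN := @integrable_norm_normal_pdf01 R.
set K := Rintegral mu setT (fun x => `|x| * N x).
have key n : Rintegral P setT (g n \o xi i) = Rintegral mu setT (fun x => g n x * N x).
  pose L (h : R -> R) := Rintegral P setT (h \o xi i) -
    Rintegral mu setT (fun x => h x * N x).
  suff : L (g n) = 0 by rewrite /L => /eqP; rewrite subr_eq0 => /eqP.
  apply: (bounded_functional_eq0 L 2) (bg n).
  - move=> a h k bh bk; rewrite /L.
    rewrite (Rintegral_linear P setT a (h \o xi i) (k \o xi i))//; [|exact: bmeas_comp..].
    rewrite normal_Rintegral_linear//.
    ring.
  - move=> h M bh hM; apply: le_trans (ler_normB _ _) _; rewrite mulrDl mul1r.
    apply: lerD.
      apply: probability_Rintegral_norm_le => [|x]; last exact: hM.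
      exact: bmeas_comp.
    exact: normal_Rintegral_norm_le.
  - move=> C mC; rewrite /L; apply/eqP; rewrite subr_eq0; apply/eqP.
    transitivity (Rintegral P setT (\1_(xi i @^-1` C) : T -> R)).
      by apply: eq_Rintegral => x _.
    rewrite Rintegral_indicE; last exact: mpre.
    transitivity (fine (normal_prob 0 1 C)); last exact/esym/normal_Rintegral_indic.
    by congr fine; case: xi_iid => _ [/(_ i C mC)].
have leK m : (\int[P]_x (f m x)%:E <= K%:E)%E.
  have bf : bmeas setT (f m) by exact: (bmeas_comp _ _ (mxi i) (bg m)).
  rewrite -[leLHS]fineK; last by apply: integrable_fin_num => //; exact: bmeas_integrable.
  rewrite lee_fin -/(Rintegral P setT (f m)) (key m).
  apply: le_Rintegral => //; first exact: integrable_bounded_normal_pdf01.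
  by move=> x _; rewrite ler_wpM2r ?normal_pdf_ge0// /g ge_min lexx.
apply/integrableP; split; first exact/measurable_EFinP.
apply: le_lt_trans (ltry K).
have -> : (\int[P]_x `|(EFin \o xi i) x| = \int[P]_x limn (fun n => (f n x)%:E))%E.
  apply: eq_integral => x _; apply/esym/cvg_lim => //.
  apply: cvg_near_cst; near=> n; rewrite /= /f; congr EFin.
  by apply/min_idPl; near: n; exact: nbhs_infty_ger.
have mf n : measurable_fun setT (fun x => (f n x)%:E).
  by apply/measurable_EFinP; exact: (bmeas_comp _ _ (mxi i) (bg n)).1.
rewrite monotone_convergence//.
- apply: lime_le; last by apply: nearW => n; exact: leK.
  apply: ereal_nondecreasing_is_cvgn => m n mn; apply: ge0_le_integral => //.
  + by move=> x _; rewrite lee_fin le_min normr_ge0 ler0n.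
  + by move=> x _; rewrite lee_fin /f le_min !ge_min lexx ler_nat mn orbT.
- by move=> n x _; rewrite lee_fin le_min normr_ge0 ler0n.
- move=> x _ m n mn; rewrite lee_fin /f le_min !ge_min lexx/=.
  by rewrite ler_nat mn orbT.
Unshelve. all: by end_near. Qed.

End iid_normal_sums.

Lemma eq_cvgn {R : realType} (u v : nat -> R) (l : R) :
  (forall n, u n = v n) -> u n @[n --> \oo] --> l -> v n @[n --> \oo] --> l.
Proof. by move=> uv; have -> : v = u by apply/funext => n; rewrite uv. Qed.

(** * Laws are determined by expectations of cosines *)

Section sign_iteration.
Context {R : realType}.
Implicit Types y : R.

(* The cubic [sgn_step] maps [-1, 1] to itself, and its iterates converge pointwise there
   to the sign function: the indicator of a half-line is thus a bounded pointwise limit of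
   polynomials in a sine. *)
Definition sgn_step y := (3 * y - y ^+ 3) / 2.

Lemma sgn_step_norm_le1 y : `|y| <= 1 -> `|sgn_step y| <= 1.
Proof.
rewrite !ler_norml /sgn_step => /andP[y1 y2]; apply/andP; split.
  have : 0 <= (y + 1) ^+ 2 * (2 - y) by rewrite mulr_ge0 ?sqr_ge0//; lra.
  by nra.
have : 0 <= (y - 1) ^+ 2 * (y + 2) by rewrite mulr_ge0 ?sqr_ge0//; lra.
by nra.
Qed.

Lemma iter_sgn_step_norm_le1 n y : `|y| <= 1 -> `|iter n sgn_step y| <= 1.
Proof. by move=> y1; elim: n => //= n; exact: sgn_step_norm_le1. Qed.

Lemma iter_sgn_stepN n y : iter n sgn_step (- y) = - iter n sgn_step y.
Proof. by elim: n => //= n ->; rewrite /sgn_step; field. Qed.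

(** With the error [e = 1 - z], one step replaces [e] by [e * (e (3 - e) / 2)]. The factor increases
    with [e] on [0, 1], so it never exceeds its initial value [rho], and [rho < 1] because [y > 0].
    The convergence is therefore geometric. *)
Lemma cvg_iter_sgn_step_gt0 y : 0 < y -> y <= 1 -> iter n sgn_step y @[n --> \oo] --> (1 : R).
Proof.
move=> y0 y1; pose e0 := 1 - y; pose rho := e0 * (3 - e0) / 2.
have rho0 : 0 <= rho by rewrite /rho /e0 divr_ge0// mulr_ge0//; lra.
have rho1 : rho < 1 by rewrite /rho /e0; nra.
have key n : 0 <= 1 - iter n sgn_step y <= e0 /\ 1 - iter n sgn_step y <= rho ^+ n.
  elim: n => [|n [/andP[h0 he] hr]] /=.
    by rewrite expr0 /e0; split; [apply/andP; split|]; lra.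
  set z := iter n sgn_step y in h0 he hr *.
  have E : 1 - sgn_step z = (1 - z) * ((1 - z) * (3 - (1 - z)) / 2).
    by rewrite /sgn_step; field.
  have m0 : 0 <= (1 - z) * (3 - (1 - z)) / 2.
    by rewrite divr_ge0// mulr_ge0//; move: he; rewrite /e0; lra.
  have m1 : (1 - z) * (3 - (1 - z)) / 2 <= rho.
    rewrite /rho ler_pM2r ?invr_gt0//.
    have : 0 <= (e0 - (1 - z)) * (3 - e0 - (1 - z)).
      by rewrite mulr_ge0// ?subr_ge0//; move: he; rewrite /e0; lra.
    by nra.
  rewrite E; split.
    rewrite mulr_ge0//=; apply: le_trans he; apply: ler_piMr => //.
    exact: le_trans m1 (ltW rho1).
  rewrite exprSr; apply: ler_pM => //.
apply/cvgrPdist_le => eps eps0.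
have c0 : rho ^+ n @[n --> \oo] --> (0 : R).
  by apply: cvg_expr; rewrite ger0_norm.
move/cvgrPdist_le : c0 => /(_ _ eps0); apply: filterS => n.
rewrite sub0r normrN ger0_norm ?exprn_ge0// => rn.
have [/andP[h0 _] hr] := key n.
by rewrite ger0_norm//; exact: le_trans hr rn.
Qed.

Lemma cvg_iter_sgn_step y : `|y| <= 1 -> iter n sgn_step y @[n --> \oo] --> Num.sg y.
Proof.
rewrite ler_norml => /andP[y1 y2]; case: (ltrgtP y 0) => y0.
- have c1 : iter n sgn_step (- y) @[n --> \oo] --> (1 : R).
    by apply: cvg_iter_sgn_step_gt0; lra.
  rewrite ltr0_sg//; apply: eq_cvgn (cvgN c1) => n.
  by rewrite iter_sgn_stepN opprK.
- by rewrite gtr0_sg//; exact: cvg_iter_sgn_step_gt0.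
- rewrite y0 sgr0; apply: cvg_near_cst; apply: nearW => n.
  by elim: n => //= n ->; rewrite /sgn_step mulr0 expr0n/= subr0 mul0r.
Qed.

(** The quadratic through (-1, 0), (0, 0) and (1, 1): it turns the sign function into the indicator
    of strict positivity. *)
Definition pos_poly y := (y * y + y) / 2.

Lemma pos_poly_norm_le1 y : `|y| <= 1 -> `|pos_poly y| <= 1.
Proof.
rewrite !ler_norml /pos_poly => /andP[y1 y2]; apply/andP; split; nra.
Qed.

Lemma cvg_pos_poly_iter y : `|y| <= 1 ->
  pos_poly (iter n sgn_step y) @[n --> \oo] --> ((0 < y)%R%:R : R).
Proof.
move=> y1.
have -> : (0 < y)%R%:R = pos_poly (Num.sg y).
  rewrite /pos_poly; case: (ltrgtP y 0) => y0.
  - by rewrite ltr0_sg//=; lra.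
  - by rewrite gtr0_sg//=; lra.
  - by rewrite y0 sgr0 mulr0 add0r mul0r.
have c := cvg_iter_sgn_step y y1.
by apply: cvgMl; apply: cvgD => //; exact: cvgM.
Qed.

End sign_iteration.

(** * Trigonometric polynomials in finitely many variables *)

Section trigonometric_polynomials.
Context {R : realType} {J : finType}.

(** Only linear combinations of shifted cosines are generated, so equality of expectations extends
    to this class by linearity. Closure under products is then a consequence of the product-to-sum
    formula and gives access to polynomials in sines. *)
Inductive trigpoly : ((J -> R) -> R) -> Prop :=
| trigpoly_cos t th : trigpoly (fun x => cos (\sum_j t j * x j + th))
| trigpoly_lin a f g : trigpoly f -> trigpoly g -> trigpoly (fun x => a * f x + g x).

Lemma trigpoly_ext f g : (forall x, f x = g x) -> trigpoly f -> trigpoly g.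
Proof. by move=> fg; have -> : g = f by apply/funext => x; rewrite fg. Qed.

Lemma trigpoly_cst c : trigpoly (fun=> c).
Proof.
have t1 : trigpoly (fun=> 1).
  apply: trigpoly_ext (trigpoly_cos (fun=> 0) 0) => x.
  by rewrite addr0 big1 ?cos0// => j _; rewrite mul0r.
by apply: trigpoly_ext (trigpoly_lin (c - 1) _ _ t1 t1) => x; ring.
Qed.

Lemma trigpolyZ a f : trigpoly f -> trigpoly (fun x => a * f x).
Proof.
move=> tf; apply: trigpoly_ext (trigpoly_lin a _ _ tf (trigpoly_cst 0)) => x.
by rewrite addr0.
Qed.

Lemma trigpolyM f g : trigpoly f -> trigpoly g -> trigpoly (fun x => f x * g x).
Proof.
move=> tf tg; elim: tf => {f} [t th|a f1 f2 _ IH1 _ IH2]; last first.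
  apply: trigpoly_ext (trigpoly_lin a _ _ IH1 IH2) => x.
  by rewrite mulrDl mulrA.
elim: tg => {g} [u ph|a g1 g2 _ IH1 _ IH2]; last first.
  apply: trigpoly_ext (trigpoly_lin a _ _ IH1 IH2) => x.
  by rewrite mulrDr mulrCA.
have t1 := trigpoly_cos (fun j => t j + u j) (th + ph).
have t2 := trigpoly_cos (fun j => t j - u j) (th - ph).
apply: trigpoly_ext (trigpoly_lin 2^-1 _ _ t1 (trigpolyZ 2^-1 _ t2)) => x /=.
have -> : \sum_j (t j + u j) * x j + (th + ph) =
    (\sum_j t j * x j + th) + (\sum_j u j * x j + ph).
  by under eq_bigr do rewrite mulrDl; rewrite big_split/=; ring.
have -> : \sum_j (t j - u j) * x j + (th - ph) =
    (\sum_j t j * x j + th) - (\sum_j u j * x j + ph).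
  under eq_bigr do rewrite mulrBl; rewrite sumrB/=; ring.
by rewrite cosD cosB; field.
Qed.

Lemma trigpoly_prod (K : Type) (s : seq K) (f : K -> (J -> R) -> R) :
  (forall j, trigpoly (f j)) -> trigpoly (fun x => \prod_(j <- s) f j x).
Proof.
move=> tf; elim: s => [|j s IH].
  by apply: trigpoly_ext (trigpoly_cst 1) => x; rewrite big_nil.
by apply: trigpoly_ext (trigpolyM _ _ (tf j) IH) => x; rewrite big_cons.
Qed.

Lemma trigpoly_iter n f : trigpoly f -> trigpoly (fun x => iter n sgn_step (f x)).
Proof.
move=> tf; elim: n => //= n IH.
have t3 := trigpolyM _ _ IH (trigpolyM _ _ IH IH).
apply: trigpoly_ext (trigpoly_lin (3 / 2) _ _ IH (trigpolyZ (- 2^-1) _ t3)) => x.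
by rewrite /sgn_step; field.
Qed.

Lemma trigpoly_pos_poly f : trigpoly f -> trigpoly (fun x => pos_poly (f x)).
Proof.
move=> tf; have t2 := trigpolyM _ _ tf tf.
apply: trigpoly_ext (trigpoly_lin 2^-1 _ _ t2 (trigpolyZ 2^-1 _ tf)) => x.
by rewrite /pos_poly; field.
Qed.

Lemma trigpoly_sin (s c : R) (j : J) : trigpoly (fun x => sin (s * (x j - c))).
Proof.
apply: trigpoly_ext (trigpoly_cos (fun k => s *+ (k == j)) (- (s * c) - pi / 2)) => x.
rewrite sin_eq_cos addrA; congr (cos (_ - _)).
rewrite (bigD1 j)//= eqxx mulr1n big1 ?addr0 ?mulrBr// => k /negbTE ->.
by rewrite mulr0n mul0r.
Qed.

Lemma bmeas_trigpoly {d} {T : measurableType d} (X : J -> T -> R) f :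
  (forall j, measurable_fun setT (X j)) -> trigpoly f ->
  bmeas setT (fun w => f (fun j => X j w)).
Proof.
move=> mX; elim => [t th|a {}f g _ IH1 _ IH2].
  by apply: bmeas_cos_comp; exact: measurable_fun_lincomb.
by apply: bmeasD => //; exact: bmeasZ.
Qed.

End trigonometric_polynomials.

Lemma cvg_prod_seq {R : realType} (K : Type) (s : seq K) (u : K -> nat -> R) (l : K -> R) :
  (forall j, u j n @[n --> \oo] --> l j) ->
  \prod_(j <- s) u j n @[n --> \oo] --> \prod_(j <- s) l j.
Proof.
move=> ul; elim: s => [|j s IH].
  by rewrite big_nil; under eq_fun do rewrite big_nil; exact: cvg_cst.
by rewrite big_cons; under eq_fun do rewrite big_cons; exact: cvgM.
Qed.

Lemma prod_norm_le1 {R : realType} (K : Type) (s : seq K) (u : K -> R) :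
  (forall j, `|u j| <= 1) -> `|\prod_(j <- s) u j| <= 1.
Proof.
move=> u1; elim: s => [|j s IH]; first by rewrite big_nil normr1.
by rewrite big_cons normrM; apply: mulr_ile1.
Qed.

Section law_determined_by_cosines.
Context {R : realType} {J : finType}.
Context {d : measure_display} {T : measurableType d} (P : probability T R).
Context {d' : measure_display} {T' : measurableType d'} (Q : probability T' R).
Variables (X : J -> T -> R) (Y : J -> T' -> R).
Hypothesis mX : forall j, measurable_fun setT (X j).
Hypothesis mY : forall j, measurable_fun setT (Y j).
Hypothesis XY_cos : forall (t : J -> R) th,
  Rintegral P setT (fun w => cos (\sum_j t j * X j w + th)) =
  Rintegral Q setT (fun w => cos (\sum_j t j * Y j w + th)).

Let PT : (P setT < +oo)%E. Proof. by rewrite probability_setT ltry. Qed.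
Let QT : (Q setT < +oo)%E. Proof. by rewrite probability_setT ltry. Qed.

Lemma trigpoly_expectation_eq f : trigpoly f ->
  Rintegral P setT (fun w => f (fun j => X j w)) =
  Rintegral Q setT (fun w => f (fun j => Y j w)).
Proof.
elim => [t th|a {}f g tf IH1 tg IH2]; first exact: XY_cos.
rewrite (Rintegral_linear P setT a (fun w => f (fun j => X j w))
  (fun w => g (fun j => X j w)))//; [|exact: bmeas_trigpoly..].
rewrite (Rintegral_linear Q setT a (fun w => f (fun j => Y j w))
  (fun w => g (fun j => Y j w)))//; [|exact: bmeas_trigpoly..].
by rewrite IH1 IH2.
Qed.

Let sinpos (s : R) (l : seq (J * R)) (x : J -> R) : R :=
  \prod_(p <- l) (0 < sin (s * (x p.1 - p.2)))%R%:R.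

Lemma cvg_expectation {dU} {U : measurableType dU} (M : probability U R)
    (h_ : nat -> U -> R) (h : U -> R) :
  (forall n, measurable_fun setT (h_ n)) -> (forall n x, `|h_ n x| <= 1) ->
  (forall x, h_ n x @[n --> \oo] --> h x) ->
  Rintegral M setT (h_ n) @[n --> \oo] --> Rintegral M setT h.
Proof.
move=> mh h1 hh; apply: (Rintegral_dominated_cvg M setT h_ h (fun=> 1)) => //.
have MT : (M setT < +oo)%E by rewrite probability_setT ltry.
exact: (bmeas_integrable M setT (fun=> 1) measurableT MT (bmeas_cst _ _)).
Qed.

Lemma sinpos_approx (s : R) (l : seq (J * R)) : exists f_ : nat -> (J -> R) -> R,
  [/\ forall n, trigpoly (f_ n), forall n x, `|f_ n x| <= 1 &
      forall x, f_ n x @[n --> \oo] --> sinpos s l x].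
Proof.
exists (fun n x => \prod_(p <- l) pos_poly (iter n sgn_step (sin (s * (x p.1 - p.2))))).
split.
- move=> n; apply: trigpoly_prod => j; apply: trigpoly_pos_poly.
  by apply: trigpoly_iter; exact: trigpoly_sin.
- move=> n x; apply: prod_norm_le1 => j; apply: pos_poly_norm_le1.
  by apply: iter_sgn_step_norm_le1; exact: sin_max.
- move=> x; apply: cvg_prod_seq => j; apply: cvg_pos_poly_iter; exact: sin_max.
Qed.

Lemma measurable_sinpos {dU} {U : measurableType dU} (Z : J -> U -> R) s l :
  (forall j, measurable_fun setT (Z j)) ->
  measurable_fun setT (fun w => sinpos s l (fun j => Z j w)).
Proof.
move=> mZ; have [f_ [tf f1 fc]] := sinpos_approx s l.
apply: (measurable_fun_cvg (h := fun n w => f_ n (fun j => Z j w))).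
  by move=> n; exact: (bmeas_trigpoly _ _ mZ (tf n)).1.
by move=> x _; exact: fc.
Qed.

Lemma sinpos_expectation_eq s l :
  Rintegral P setT (fun w => sinpos s l (fun j => X j w)) =
  Rintegral Q setT (fun w => sinpos s l (fun j => Y j w)).
Proof.
have [f_ [tf f1 fc]] := sinpos_approx s l.
have c1 := cvg_expectation P (fun n w => f_ n (fun j => X j w))
  (fun w => sinpos s l (fun j => X j w)) (fun n => (bmeas_trigpoly _ _ mX (tf n)).1)
  (fun n x => f1 n _) (fun x => fc _).
have c2 := cvg_expectation Q (fun n w => f_ n (fun j => Y j w))
  (fun w => sinpos s l (fun j => Y j w)) (fun n => (bmeas_trigpoly _ _ mY (tf n)).1)
  (fun n x => f1 n _) (fun x => fc _).
have c1' : Rintegral Q setT (fun w => f_ n (fun j => Y j w)) @[n --> \oo] -->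
    Rintegral P setT (fun w => sinpos s l (fun j => X j w)).
  apply: eq_cvgn c1 => n.
  by rewrite trigpoly_expectation_eq.
exact: cvg_unique c1' c2.
Qed.

(** For a fixed value [x - c] and a small frequency [1 / n.+1], the argument of the sine lies within
    (-pi, pi), where the sine has the sign of [x - c]. The periodic condition thus becomes a
    half-line, and each factor is eventually constant in [n]. *)
Lemma cvg_sinpos (l : seq (J * R)) (x : J -> R) : sinpos n.+1%:R^-1 l x @[n --> \oo] -->
  (\prod_(p <- l) (p.2 < x p.1)%R%:R : R).
Proof.
apply: cvg_prod_seq => -[j c]; apply: cvg_near_cst; near=> n => /=.
have n0 : (0 : R) < n.+1%:R^-1 by rewrite invr_gt0.
have hp : `|x j - c| < n.+1%:R * pi.
  apply: lt_le_trans (_ : n.+1%:R <= _); last first.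
    by rewrite ler_peMr// (le_trans _ (@pi_ge2 R))// ler1n.
  near: n; exists (Num.truncn `|x j - c|).+1 => // n /= tn.
  apply: lt_le_trans (truncnS_gt _) _; rewrite ler_nat.
  exact: ltnW.
congr (nat_of_bool _)%:R; rewrite -(subr_gt0 c).
have sp (z : R) : 0 < z -> z < n.+1%:R * pi -> 0 < sin (n.+1%:R^-1 * z).
  move=> z0 zp; apply: sin_gt0_pi; rewrite mulr_gt0//=.
  by rewrite mulrC ltr_pdivrMr// mulrC.
case: (ltrgtP (x j - c) 0) => z0.
- rewrite ltr0_norm// in hp; have := sp (- (x j - c)).
  rewrite oppr_gt0 mulrN sinN oppr_gt0 => /(_ z0 hp) h.
  by apply/negbTE; rewrite -leNgt ltW.
- by rewrite gtr0_norm// in hp; rewrite sp.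
- by rewrite z0 mulr0 sin0 ltxx.
Unshelve. all: by end_near. Qed.

Let rays {U : Type} (Z : J -> U -> R) (l : seq (J * R)) : set U :=
  \big[setI/setT]_(p <- l) (Z p.1 @^-1` `]p.2, +oo[).

Let mpre {dU} {U : measurableType dU} (Z : J -> U -> R) :
  (forall j, measurable_fun setT (Z j)) ->
  forall j (B : set R), measurable B -> measurable (Z j @^-1` B).
Proof. by move=> mZ j B mB; rewrite -[X in measurable X]setTI; exact: mZ. Qed.

Let measurable_rays {dU} {U : measurableType dU} (Z : J -> U -> R) l :
  (forall j, measurable_fun setT (Z j)) -> measurable (rays Z l).
Proof. by move=> mZ; apply: bigsetI_measurable => p _; exact: mpre. Qed.

Lemma rays_probability_eq l : P (rays X l) = Q (rays Y l).
Proof.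
have E : forall dU (U : measurableType dU) (M : probability U R) (Z : J -> U -> R),
    (forall j, measurable_fun setT (Z j)) ->
    M (rays Z l) = (Rintegral M setT (fun w => \prod_(p <- l) (p.2 < Z p.1 w)%R%:R))%:E.
  move=> dU U M Z mZ.
  have -> : (fun w => \prod_(p <- l) (p.2 < Z p.1 w)%R%:R) = \1_(rays Z l) :> (U -> R).
    apply/funext => w; rewrite /rays; elim: l => [|p l' IH].
      by rewrite !big_nil indicT.
    rewrite !big_cons IH indicI; congr (_ * _); rewrite indicE.
    by congr (nat_of_bool _)%:R; apply/idP/idP; rewrite inE /= in_itv/= andbT.
  rewrite Rintegral_indicE; last exact: measurable_rays.
  by rewrite fineK// fin_num_measure//; exact: measurable_rays.
rewrite (E _ _ P X mX) (E _ _ Q Y mY); congr EFin.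
have b1 : forall dU (U : measurableType dU) (M : probability U R) (Z : J -> U -> R),
    (forall j, measurable_fun setT (Z j)) ->
    Rintegral M setT (fun w => sinpos n.+1%:R^-1 l (fun j => Z j w)) @[n --> \oo] -->
    Rintegral M setT (fun w => \prod_(p <- l) (p.2 < Z p.1 w)%R%:R).
  move=> dU U M Z mZ; apply: cvg_expectation.
  - by move=> n; exact: measurable_sinpos.
  - move=> n w; apply: prod_norm_le1 => j.
    by case: (0 < _) => /=; rewrite ?normr1 ?normr0.
  - by move=> w; exact: cvg_sinpos.
have c1 := b1 _ _ P X mX; have c2 := b1 _ _ Q Y mY.
apply: cvg_unique c2 => //.
apply: eq_cvgn c1 => n.
by rewrite sinpos_expectation_eq.
Qed.

Let boxes {U : Type} (Z : J -> U -> R) (b : seq (J * set R)) : set U :=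
  \big[setI/setT]_(p <- b) (Z p.1 @^-1` p.2).

(** Half-lines are replaced by Borel sets one coordinate at a time, with a Dynkin induction for
    each. The list [l] has to stay general: in the generating case of that induction a new half-line
    for the current coordinate is pushed onto it. *)
Lemma boxes_rays_probability_eq (b : seq (J * set R)) (l : seq (J * R)) :
  {in b, forall p, measurable p.2} ->
  P (boxes X b `&` rays X l) = Q (boxes Y b `&` rays Y l).
Proof.
elim: b l => [|[j B] b IH] l mb.
  rewrite /(boxes X _) /(boxes Y _) !big_nil !setTI; exact: rays_probability_eq.
have mb' : {in b, forall p, measurable p.2}.
  by move=> p pb; apply: mb; rewrite inE pb orbT.
have mB : measurable B by apply: (mb (j, B)); rewrite mem_head.
have mC : forall dU (U : measurableType dU) (Z : J -> U -> R),
    (forall j, measurable_fun setT (Z j)) -> measurable (boxes Z b `&` rays Z l).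
  move=> dU U Z mZ; apply: measurableI; last exact: measurable_rays.
  rewrite /boxes big_seq; apply: bigsetI_measurable => p pb; apply: mpre => //; exact: mb'.
rewrite /(boxes X _) /(boxes Y _) !big_cons /= -!setIA -/(boxes X b) -/(boxes Y b).
set CX := boxes X b `&` _; set CY := boxes Y b `&` _.
have mCX : measurable CX by exact: mC.
have mCY : measurable CY by exact: mC.
pose G : set (set R) := @RGenOInfty.G R.
pose A (S : set R) := P (X j @^-1` S `&` CX) = Q (Y j @^-1` S `&` CY).
have RG : @measurable _ (measurableTypeR R) = <<s G >> by exact: RGenOInfty.measurableE.
suff : A B by [].
apply: (@dynkin_induction _ (measurableTypeR R) G A RG); last by rewrite -RG.
- move=> _ _ [x ->] [y ->]; exists (Num.max x y).
  apply/seteqP; split=> z /=; rewrite !in_itv/= !andbT gt_max.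
    by move=> [-> ->].
  by move=> /andP[].
- by rewrite /A !preimage_setT !setTI; exact: IH.
- move=> _ [x ->]; rewrite /A /CX /CY (setICA (X j @^-1` _)) (setICA (Y j @^-1` _)).
  have := IH ((j, x) :: l) mb'.
  by rewrite /(rays X _) /(rays Y _) !big_cons.
- move=> S mS AS; rewrite /A.
  have -> : X j @^-1` (~` S) `&` CX = CX `\` (X j @^-1` S) by rewrite setIC setDE.
  have -> : Y j @^-1` (~` S) `&` CY = CY `\` (Y j @^-1` S) by rewrite setIC setDE.
  have := IH l mb'; rewrite -/CX -/CY => EC.
  have mXS := mpre X mX j S mS; have mYS := mpre Y mY j S mS.
  rewrite measureD//; last by rewrite ltey_eq fin_num_measure.
  rewrite measureD//; last by rewrite ltey_eq fin_num_measure.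
  congr (_ - _)%E; first exact: EC.
  rewrite (setIC CX) (setIC CY); exact: AS.
- move=> F mF tF AF; rewrite /A !preimage_bigcup !setI_bigcupl.
  rewrite !measure_semi_bigcup.
  + by apply: eq_eseriesr => n _; exact: AF.
  + by move=> i; apply: measurableI => //; apply: mpre => //; exact: mF.
  + apply/trivIsetP => i k _ _ ik; rewrite setIACA -preimage_setI.
    by move/trivIsetP : tF => /(_ _ _ I I ik) ->; rewrite preimage_set0 set0I.
  + by apply: bigcup_measurable => i _; apply: measurableI => //; apply: mpre => //; exact: mF.
  + by move=> i; apply: measurableI => //; apply: mpre => //; exact: mF.
  + apply/trivIsetP => i k _ _ ik; rewrite setIACA -preimage_setI.
    by move/trivIsetP : tF => /(_ _ _ I I ik) ->; rewrite preimage_set0 set0I.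
  + by apply: bigcup_measurable => i _; apply: measurableI => //; apply: mpre => //; exact: mF.
Qed.

Lemma law_eq_of_cosines (B : J -> set R) : (forall j, measurable (B j)) ->
  P (\bigcap_j (X j @^-1` B j)) = Q (\bigcap_j (Y j @^-1` B j)).
Proof.
move=> mB.
have E : forall (U : Type) (Z : J -> U -> R),
    \bigcap_j (Z j @^-1` B j) = boxes Z [seq (j, B j) | j <- enum J] `&` rays Z [::].
  move=> U Z; rewrite /rays big_nil setIT /boxes big_map -bigcap_seq.
  by congr (\bigcap_(j in _) _); apply/seteqP; split=> j //= _; rewrite mem_enum.
rewrite !E; apply: boxes_rays_probability_eq => p /mapP[j _ ->]; exact: mB.
Qed.

End law_determined_by_cosines.

(** * Conditional expectation of a Gaussian variable *)

Lemma finite_bigcap_measurable {d} {T : measurableType d} {J : finType} (A : J -> set T) :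
  (forall j, measurable (A j)) -> measurable (\bigcap_j A j).
Proof.
move=> mA; rewrite (_ : [set: J] = [set` enum J]); last first.
  by apply/seteqP; split=> j //= _; rewrite mem_enum.
by rewrite bigcap_seq; exact: bigsetI_measurable.
Qed.

Section conditional_expectation.
Context {R : realType} {K : finType}.
Context {d : measure_display} {T : measurableType d} (P : probability T R).
Variables (y : K -> T -> R).
Hypothesis my : forall k, measurable_fun setT (y k).

Let G0 : set (set T) := [set A | exists (k : K) (B : set R), measurable B /\ A = y k @^-1` B].

Let PT : (P setT < +oo)%E. Proof. by rewrite probability_setT ltry. Qed.

Lemma sigma_gen_measurable : <<s G0 >> `<=` (@measurable _ T).
Proof.
apply: smallest_sub; first exact: sigma_algebra_measurable.
by move=> _ [k [B [mB ->]]]; rewrite -[X in measurable X]setTI; exact: my.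
Qed.

Lemma sigma_gen_preimage_measurable (Z : T -> R) :
  (forall B : set R, measurable B -> <<s G0 >> (Z @^-1` B)) ->
  measurable_fun setT Z.
Proof. by move=> GZ _ B mB; rewrite setTI; apply: sigma_gen_measurable; exact: GZ. Qed.

Lemma sigma_gen_sub_lincomb (Z : T -> R) (b : K -> R) :
  (forall B : set R, measurable B -> <<s G0 >> (Z @^-1` B)) ->
  forall B : set R, measurable B ->
  <<s G0 >> ((fun x => Z x - \sum_k b k * y k x) @^-1` B).
Proof.
move=> GZ.
have mZ : measurable_fun (setT : set (g_sigma_algebraType G0)) Z.
  by move=> _ B mB; rewrite setTI; exact: GZ.
have my' k : measurable_fun (setT : set (g_sigma_algebraType G0)) (y k).
  by move=> _ B mB; rewrite setTI; apply: sub_sigma_algebra; exists k, B.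
have mD : measurable_fun (setT : set (g_sigma_algebraType G0))
    (fun x => Z x - \sum_k b k * y k x).
  apply: measurable_funB => //.
  apply: (@measurable_sum _ (g_sigma_algebraType G0) R) => k.
  by apply: measurable_funM.
by move=> B mB; have := mD measurableT B mB; rewrite setTI.
Qed.

(** The events [D > 0] and [D < 0] belong to the generated sigma-algebra. On each of them [D] has
    constant sign and integral 0, hence vanishes almost everywhere. *)
Lemma sigma_gen_integral_eq0_ae (D : T -> R) :
  P.-integrable setT (EFin \o D) ->
  (forall B : set R, measurable B -> <<s G0 >> (D @^-1` B)) ->
  (forall A, <<s G0 >> A -> (\int[P]_(x in A) (D x)%:E = 0)%E) ->
  {ae P, forall x, D x = 0}.
Proof.
move=> iD GD D0.
have mD := sigma_gen_preimage_measurable D GD.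
have step (F : T -> R) (A : set T) : measurable A -> measurable_fun setT F ->
    (forall x, A x -> 0 <= F x) -> (\int[P]_(x in A) (F x)%:E = 0)%E ->
    {ae P, forall x, A x -> F x = 0}.
  move=> mA mF F0 iF.
  have mF' : measurable_fun A (EFin \o F).
    by apply/measurable_EFinP; exact: measurable_funTS.
  have [h _] := ae_eq_integral_abs P mA mF'.
  have : (\int[P]_(x in A) `|(EFin \o F) x| = 0)%E.
    rewrite -[RHS]iF; apply: eq_integral => x; rewrite inE => Ax.
    by rewrite /= ger0_norm// F0.
  by move=> /h; apply: filterS => x hx Ax; have := hx Ax => -[].
pose A1 := D @^-1` `]0, +oo[; pose A2 := D @^-1` `]-oo, 0[.
have G1 : <<s G0 >> A1 by exact: GD.
have G2 : <<s G0 >> A2 by exact: GD.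
have h1 : {ae P, forall x, A1 x -> D x = 0}.
  apply: step => //; [exact: sigma_gen_measurable | | exact: D0].
  by move=> x; rewrite /A1 /= in_itv/= andbT => /ltW.
have h2 : {ae P, forall x, A2 x -> - D x = 0}.
  apply: (step (fun x => - D x)); [exact: sigma_gen_measurable | exact: measurableT_comp | |].
    by move=> x; rewrite /A2 /= in_itv/= oppr_ge0 => /ltW.
  transitivity (\int[P]_(x in A2) ((-1)%:E * (D x)%:E))%E.
    by apply: eq_integral => x _; rewrite -EFinM mulN1r.
  have mA2 : measurable A2 by exact: sigma_gen_measurable.
  rewrite integralZl//; last exact: integrableS iD.
  by rewrite D0// mule0.
apply: filterS2 h1 h2 => x h1 h2.
case: (ltrgtP (D x) 0) => Dx //.
  by have := h2; rewrite /A2 /= in_itv/= => /(_ Dx)/eqP; rewrite oppr_eq0 => /eqP.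
by have := h1; rewrite /A1 /= in_itv/= andbT => /(_ Dx).
Qed.

(* A reflection-symmetric joint law of [(r, y)] forces [r] to integrate to 0 on events of y:
   this replaces the independence of uncorrelated jointly Gaussian variables. *)
Lemma symmetric_integral_eq0 (r : T -> R) :
  measurable_fun setT r -> P.-integrable setT (EFin \o r) ->
  (forall (s : R) (b : K -> R) th,
     Rintegral P setT (fun x => cos (s * r x + \sum_k b k * y k x + th)) =
     Rintegral P setT (fun x => cos (- s * r x + \sum_k b k * y k x + th))) ->
  forall A, <<s G0 >> A -> (\int[P]_(x in A) (r x)%:E = 0)%E.
Proof.
move=> mr ir sym.
(* Intersections of preimages form a class closed under intersection that generates the same
   sigma-algebra, so the claim need only be checked there and extended to a Dynkin system. *)
pose Gpi : set (set T) :=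
  [set A | exists B : K -> set R, (forall k, measurable (B k)) /\ A = \bigcap_k (y k @^-1` B k)].
have mGpi A : Gpi A -> measurable A.
  move=> [B [mB ->]].
  apply: finite_bigcap_measurable => k.
  by rewrite -[X in measurable X]setTI; exact: my.
have sub1 : <<s G0 >> `<=` <<s Gpi >>.
  apply: sub_smallest2r; first exact: smallest_sigma_algebra.
  move=> _ [k [B [mB ->]]]; exists (fun j => if j == k then B else setT); split.
    by move=> j; case: ifP.
  apply/seteqP; split=> x /=.
    by move=> yB j _; case: eqP => // ->.
  by move=> /(_ k I); rewrite eqxx.
have Ipi : setI_closed Gpi.
  move=> _ _ [B [mB ->]] [C [mC ->]]; exists (fun k => B k `&` C k); split.
    by move=> k; exact: measurableI.
  apply/seteqP; split=> x /=.
    by move=> [xB xC] k _; split; [exact: xB | exact: xC].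
  by move=> h; split=> k _; have [] := h k I.
suff D0 : <<d Gpi >> `<=` [set A | measurable A /\ (\int[P]_(x in A) (r x)%:E = 0)%E].
  by move=> A /sub1; rewrite -setI_closed_g_dynkin_g_sigma_algebra// => /D0[].
have irA A : measurable A -> P.-integrable A (EFin \o r).
  by move=> mA; apply: integrableS ir.
have base A : Gpi A -> (\int[P]_(x in A) (r x)%:E = 0)%E.
  move=> GA; have mA := mGpi _ GA.
  have [B [mB AE]] := GA.
  (* The pairs (r, y) and (-r, y) have the same cosine expectations, hence the same law on boxes.
     The index [None] of [option K] carries the component [r] or [- r]. *)
  have law (C : set R) : measurable C -> P (A `&` r @^-1` C) = P (A `&` (fun x => - r x) @^-1` C).
    move=> mC.
    pose X (j : option K) : T -> R := if j is Some k then y k else r.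
    pose Y (j : option K) : T -> R := if j is Some k then y k else fun x => - r x.
    pose D (j : option K) : set R := if j is Some k then B k else C.
    have E (Z : option K -> T -> R) : (forall k, Z (Some k) = y k) ->
        A `&` Z None @^-1` C = \bigcap_j (Z j @^-1` D j).
      move=> Zy; rewrite AE; apply/seteqP; split=> x /=.
        by move=> [h1 h2] [k|] _ //=; rewrite Zy; exact: h1.
      by move=> h; split; [move=> k _; have := h (Some k) I; rewrite /= Zy | exact: (h None I)].
    rewrite (E X)// (E Y)//; apply: law_eq_of_cosines.
    - by case=> [k|] //=; exact: my.
    - by case=> [k|] /=; [exact: my | exact: measurableT_comp].
    - move=> t th.
      have S (Z : option K -> T -> R) x : \sum_j t j * Z j x =
          t None * Z None x + \sum_k t (Some k) * Z (Some k) x.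
        rewrite (bigD1 None)//=; congr (_ + _).
        rewrite (reindex_omap Some id)//=; last by case.
        by apply: eq_bigl => k; rewrite eqxx.
      under eq_Rintegral do rewrite S.
      under [RHS]eq_Rintegral do rewrite S /= mulrN -mulNr.
      exact: sym.
    - by case=> [k|] /=.
  (* Clamping to [-n, n] is bounded and odd. Boundedness lets the equality of laws be applied,
     oddness makes the integral over [A] its own negative, and [|r|] dominates as [n] grows. *)
  pose g (n : nat) (z : R) : R := Num.max (- n%:R) (Num.min z n%:R).
  have bg n : bmeas setT (g n).
    split.
      by apply: measurable_maxr => //; exact: measurable_minr.
    exists n%:R => z _; rewrite ler_norml le_max lexx/= ge_max ge_min lexx orbT andbT.
    by have := ler0n R n; lra.
  have gN n z : g n (- z) = - g n z.
    rewrite /g oppr_max opprK oppr_min.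
    have n0 := ler0n R n.
    rewrite !maxEle !minEle; do !case: ifPn; rewrite -?ltNge; lra.
  have gle n z : `|g n z| <= `|z|.
    have n0 := ler0n R n; have z1 := ler_norm z; have z2 := ler_norm (- z).
    rewrite normrN in z2.
    rewrite /g maxEle minEle ler_norml.
    by do !case: ifPn; rewrite -?ltNge => *; apply/andP; split; lra.
  have b1 (h : R -> R) (s : T -> R) : measurable_fun setT s -> bmeas setT h ->
      bmeas setT (fun x => \1_A x * h (s x)).
    by move=> ms bh; apply: bmeasM; [exact: bmeas_indic | exact: (bmeas_comp _ _ ms bh)].
  have mrN : measurable_fun setT (fun x => - r x) by exact: measurableT_comp.
  have sw (h : R -> R) : bmeas setT h ->
      Rintegral P setT (fun x => \1_A x * h (r x)) =
      Rintegral P setT (fun x => \1_A x * h (- r x)).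
    move=> bh; pose L (h : R -> R) := Rintegral P setT (fun x => \1_A x * h (r x)) -
      Rintegral P setT (fun x => \1_A x * h (- r x)).
    suff Lh : L h = 0 by apply/eqP; rewrite -subr_eq0; apply/eqP.
    apply: (bounded_functional_eq0 L 2) bh.
    - move=> a f k bf bk; rewrite /L.
      have E (s : T -> R) : (fun x => \1_A x * (a * f (s x) + k (s x))) =
          (fun x => a * (\1_A x * f (s x)) + \1_A x * k (s x)).
        by apply/funext => x; ring.
      rewrite (E r) (E (fun x => - r x)).
      have br f' := b1 f' r mr; have bN f' := b1 f' _ mrN.
      rewrite (Rintegral_linear P setT a _ _ measurableT PT (br f bf) (br k bk)).
      rewrite (Rintegral_linear P setT a _ _ measurableT PT (bN f bf) (bN k bk)).
      ring.
    - move=> f M bf fM; apply: le_trans (ler_normB _ _) _; rewrite mulrDl mul1r.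
      have h1 (s : T -> R) x : `|\1_A x * f (s x)| <= M.
        rewrite normrM -[M]mul1r ler_pM// indicE.
        by case: (x \in A) => /=; rewrite ?normr1 ?normr0.
      apply: lerD; apply: probability_Rintegral_norm_le.
      - exact: (b1 f r).
      - exact: (h1 r).
      - exact: (b1 f _ mrN).
      - exact: (h1 (fun x => - r x)).
    - move=> C mC; rewrite /L; apply/eqP; rewrite subr_eq0; apply/eqP.
      have E (s : T -> R) : (fun x => \1_A x * \1_C (s x)) = \1_(A `&` s @^-1` C) :> (T -> R).
        by apply/funext => x; rewrite indicI.
      have mC' (s : T -> R) : measurable_fun setT s -> measurable (A `&` s @^-1` C).
        by move=> ms; apply: measurableI => //; rewrite -[X in measurable X]setTI; exact: ms.
      rewrite (E r) (E (fun x => - r x)) !Rintegral_indicE; [|exact: mC'..].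
      by congr fine; exact: law.
  have z n : Rintegral P setT (fun x => \1_A x * g n (r x)) = 0.
    have h := sw _ (bg n).
    have hN : Rintegral P setT (fun x => \1_A x * g n (- r x)) =
        - Rintegral P setT (fun x => \1_A x * g n (r x)).
      rewrite -mulN1r -RintegralZl//.
        by apply: eq_Rintegral => x _; rewrite gN; ring.
      by apply: bmeas_integrable => //; exact: (b1 (g n) r).
    by rewrite hN in h; lra.
  have c1 : Rintegral P setT (fun x => \1_A x * g n (r x)) @[n --> \oo] -->
      Rintegral P setT (fun x => \1_A x * r x).
    apply: (Rintegral_dominated_cvg P setT _ _ (fun x => `|r x|)) => //.
    - by move=> n; case: (b1 (g n) r mr (bg n)).
    - exact: integrable_norm.
    - move=> x _; apply: cvg_near_cst; near=> n; congr (_ * _).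
      have : `|r x| <= n%:R by near: n; exact: nbhs_infty_ger.
      rewrite ler_norml /g => /andP[h1 h2].
      by rewrite (min_idPl h2); exact/max_idPr.
    - move=> n x _; rewrite normrM -[leRHS]mul1r ler_pM// indicE.
      by case: (x \in A) => /=; rewrite ?normr1 ?normr0.
  have c0 : Rintegral P setT (fun x => \1_A x * g n (r x)) @[n --> \oo] --> (0 : R).
    by apply: eq_cvgn (cvg_cst 0) => n; rewrite z.
  have R0 := cvg_unique _ c1 c0.
  rewrite -[LHS]fineK; last by apply: integrable_fin_num => //; exact: irA.
  congr EFin; rewrite -[RHS]R0 // -/(Rintegral P A r) Rintegral_mkcond.
  apply: eq_Rintegral => x _; rewrite patchE indicE; case: ifP => _; by rewrite ?mul1r ?mul0r.
apply: smallest_sub; last by move=> A GA; split; [exact: mGpi | exact: base].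
have T0 : (\int[P]_x (r x)%:E = 0)%E.
  apply: base; exists (fun=> setT); split=> //.
  by apply/seteqP; split.
split.
- by split.
- move=> A [mA A0]; split; first exact: measurableC.
  have := T0; rewrite -(setvU A) integral_setU_EFin//.
  + by rewrite A0 adde0.
  + exact: measurableC.
  + by rewrite setvU.
  + by apply/disj_setPS; rewrite setICl.
- move=> F tF AF; split; first by apply: bigcup_measurable => k _; case: (AF k).
  rewrite integral_bigcup//.
  + by apply: eseries0 => k _ _; case: (AF k).
  + by move=> k; case: (AF k).
  + by apply: irA; apply: bigcup_measurable => k _; case: (AF k).
Unshelve. all: by end_near. Qed.

(** The residual of [X] integrates to 0 over every event of the sigma-algebra by symmetry. Hence [Z]
    minus the linear combination, which is measurable for that sigma-algebra, also integrates to 0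
    there and must vanish almost surely. *)
Lemma condexp_lincomb (X Z : T -> R) (b : K -> R) :
  is_condexp P <<s G0 >> X Z ->
  measurable_fun setT X -> P.-integrable setT (EFin \o X) ->
  (forall k, P.-integrable setT (EFin \o y k)) ->
  (forall (s : R) (c : K -> R) th,
     Rintegral P setT (fun x => cos (s * (X x - \sum_k b k * y k x) + \sum_k c k * y k x + th)) =
     Rintegral P setT (fun x => cos (- s * (X x - \sum_k b k * y k x) + \sum_k c k * y k x + th))) ->
  {ae P, forall x, Z x = \sum_k b k * y k x}.
Proof.
move=> [GZ [iZ ZX]] mX iX iy sym.
pose L x := \sum_k b k * y k x.
have mL : measurable_fun setT L by exact: measurable_fun_lincomb.
have iL : P.-integrable setT (EFin \o L).
  have : P.-integrable setT (fun x => \sum_(k <- index_enum K) (b k)%:E * (y k x)%:E)%E.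
    by apply: integrable_sum => // k _; exact: (integrableZl measurableT (b k) (iy k)).
  by apply: eq_integrable => // x _; rewrite sumEFin.
have ir : P.-integrable setT (EFin \o (fun x => X x - L x)).
  by have := integrableB measurableT iX iL; apply: eq_integrable.
have r0 := symmetric_integral_eq0 (fun x => X x - L x) (measurable_funB mX mL) ir sym.
have iZL : P.-integrable setT (EFin \o (fun x => Z x - L x)).
  by have := integrableB measurableT iZ iL; apply: eq_integrable.
have := sigma_gen_integral_eq0_ae (fun x => Z x - L x) iZL (sigma_gen_sub_lincomb _ _ GZ).
have h A : <<s G0 >> A -> (\int[P]_(x in A) (Z x - L x)%:E = 0)%E.
  move=> GA; have mA := sigma_gen_measurable _ GA; rewrite -[RHS](r0 A GA).
  under eq_integral do rewrite EFinB.
  under [RHS]eq_integral do rewrite EFinB.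
  have iA f : P.-integrable setT f -> P.-integrable A f by apply: integrableS.
  rewrite integralB//; [|exact: iA..].
  rewrite integralB//; [|exact: iA..].
  by rewrite ZX.
by move=> /(_ h); apply: filterS => x /eqP; rewrite subr_eq0 => /eqP.
Qed.

(** The difference of [X] and [X'] is measurable with respect to the conditioning variables, so it
    is its own conditional expectation and cancels. Applied to two ends at the same vertex, this
    yields the consistency of the conditioned field. *)
Lemma condexp_diff_lincomb (X X' Z Z' : T -> R) (q : K -> R) :
  is_condexp P <<s G0 >> X Z -> is_condexp P <<s G0 >> X' Z' ->
  P.-integrable setT (EFin \o X) -> P.-integrable setT (EFin \o X') ->
  (forall x, X x - X' x = \sum_k q k * y k x) ->
  {ae P, forall x, X x - Z x = X' x - Z' x}.
Proof.
move=> [GZ [iZ ZX]] [GZ' [iZ' ZX']] iX iX' XX'.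
have GD (B : set R) : measurable B -> <<s G0 >> ((fun x => Z x - Z' x) @^-1` B).
  have mZ (W : T -> R) : (forall B : set R, measurable B -> <<s G0 >> (W @^-1` B)) ->
      measurable_fun (setT : set (g_sigma_algebraType G0)) W.
    by move=> GW _ C mC; rewrite setTI; exact: GW.
  have mD : measurable_fun (setT : set (g_sigma_algebraType G0)) (fun x => Z x - Z' x).
    by apply: measurable_funB; exact: mZ.
  by move=> mB; have := mD measurableT B mB; rewrite setTI.
have iD : P.-integrable setT (EFin \o (fun x => X x - X' x)).
  by have := integrableB measurableT iX iX'; apply: eq_integrable.
have iL : P.-integrable setT (EFin \o (fun x => \sum_k q k * y k x)).
  by apply: eq_integrable iD => // x _; rewrite /= XX'.
have h A : <<s G0 >> A -> (\int[P]_(x in A) (Z x - Z' x - \sum_k q k * y k x)%:E = 0)%E.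
  move=> GA; have mA := sigma_gen_measurable _ GA.
  have iA f : P.-integrable setT f -> P.-integrable A f by apply: integrableS.
  under eq_integral do rewrite !EFinB.
  rewrite integralB//; last 2 first.
  - by have := integrableB mA (iA _ iZ) (iA _ iZ'); apply: eq_integrable.
  - exact: iA.
  rewrite integralB//; [|exact: iA..].
  rewrite ZX// ZX'// -integralB//; [|exact: iA..].
  have -> : (\int[P]_(x in A) ((X x)%:E - (X' x)%:E) =
      \int[P]_(x in A) (\sum_k q k * y k x)%:E)%E.
    by apply: eq_integral => x _; rewrite -EFinB XX'.
  by apply: subee; apply: integrable_fin_num => //; exact: iA.
have iZL : P.-integrable setT (EFin \o (fun x => Z x - Z' x - \sum_k q k * y k x)).
  have := integrableB measurableT (integrableB measurableT iZ iZ') iL.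
  by apply: eq_integrable.
have := sigma_gen_integral_eq0_ae _ iZL (sigma_gen_sub_lincomb _ q GD).
move=> /(_ h); apply: filterS => x /eqP; rewrite subr_eq0 -XX' => /eqP e.
by lra.
Qed.

End conditional_expectation.

(** * Gaussian series *)

Section square_summable.
Context {R : realType} {I : eqType}.
Variable s : nat -> seq I.
Hypothesis s_incr : forall n, exists t, s n.+1 = s n ++ t.
Implicit Types c e : I -> R.

(** Summation follows a chain of finite lists because the modes of the decoupled edges are indexed
    by pairs of an edge and a number. The [n]-th list can then hold the first [n] modes of every
    edge, matching the partial sums of each edge field. *)
Definition psum c (n : nat) : R := \sum_(i <- s n) c i.

Lemma nondecreasing_psum c : (forall i, 0 <= c i) ->
  {homo psum c : n m / (n <= m)%N >-> n <= m}.
Proof.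
move=> c0; apply: homo_leq => [x|y x z|n]; [exact: lexx | exact: le_trans |].
have [t st] := s_incr n.
by rewrite /psum st big_cat /= lerDl sumr_ge0.
Qed.

Lemma psum_ge0 c n : (forall i, 0 <= c i) -> 0 <= psum c n.
Proof. by move=> c0; exact: sumr_ge0. Qed.

Lemma cvg_psum_bounded c M : (forall i, 0 <= c i) -> (forall n, psum c n <= M) ->
  cvgn (psum c).
Proof.
move=> c0 cM; apply: nondecreasing_is_cvgn; first exact: nondecreasing_psum.
by exists M => _ [n _ <-].
Qed.

Lemma psum_le_lim c n : (forall i, 0 <= c i) -> cvgn (psum c) -> psum c n <= limn (psum c).
Proof.
move=> c0 cc; apply: nondecreasing_cvgn_le => //; exact: nondecreasing_psum.
Qed.

Lemma psum_linear a c e n : psum (fun i => a * c i + e i) n = a * psum c n + psum e n.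
Proof. by rewrite /psum big_split/= mulr_sumr. Qed.

Definition l2seq c := cvgn (psum (fun i => c i ^+ 2)).
Definition l2ip c e : R := limn (psum (fun i => c i * e i)).

Lemma l2seq_linear a c e : l2seq c -> l2seq e -> l2seq (fun i => a * c i + e i).
Proof.
move=> lc le; pose M := 2 * a ^+ 2 * limn (psum (fun i => c i ^+ 2)) +
  2 * limn (psum (fun i => e i ^+ 2)).
apply: (cvg_psum_bounded _ M) => [i|n]; first exact: sqr_ge0.
apply: le_trans (_ : psum (fun i => 2 * a ^+ 2 * c i ^+ 2 + 2 * e i ^+ 2) n <= _).
  apply: ler_sum => i _; have := sqr_ge0 (a * c i - e i); nra.
rewrite psum_linear; apply: lerD.
  apply: ler_wpM2l; first by rewrite mulr_ge0// sqr_ge0.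
  by apply: psum_le_lim => // i; exact: sqr_ge0.
rewrite /psum -mulr_sumr; apply: ler_wpM2l => //.
by apply: psum_le_lim => // i; exact: sqr_ge0.
Qed.

Lemma l2seq0 : l2seq (fun=> 0).
Proof.
apply: (cvg_psum_bounded _ 0) => [i|n]; first exact: sqr_ge0.
by rewrite /psum big1// => i _; rewrite expr0n.
Qed.

Lemma l2seq_sum (K : Type) (l : seq K) (b : K -> R) (y : K -> I -> R) :
  (forall k, l2seq (y k)) -> l2seq (fun i => \sum_(k <- l) b k * y k i).
Proof.
move=> ly; elim: l => [|k l IH].
  by under eq_fun do rewrite big_nil; exact: l2seq0.
by under eq_fun do rewrite big_cons; exact: l2seq_linear.
Qed.

(** Polarisation: the products are combinations of three squares whose sums converge. This is also
    what gives the limit in [l2ip] its meaning. *)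
Lemma cvg_l2ip c e : l2seq c -> l2seq e ->
  psum (fun i => c i * e i) n @[n --> \oo] --> l2ip c e.
Proof.
move=> lc le; have l1 := l2seq_linear 1 _ _ lc le.
suff : cvgn (psum (fun i => c i * e i)) by [].
have E n : psum (fun i => c i * e i) n =
    2^-1 * (psum (fun i => (1 * c i + e i) ^+ 2) n - psum (fun i => c i ^+ 2) n
     - psum (fun i => e i ^+ 2) n).
  rewrite /psum -!sumrB mulr_sumr; apply: eq_bigr => i _; by field.
rewrite (_ : psum _ = fun n => 2^-1 * (psum (fun i => (1 * c i + e i) ^+ 2) n -
   psum (fun i => c i ^+ 2) n - psum (fun i => e i ^+ 2) n)); last first.
  by apply/funext => n; exact: E.
apply: is_cvgMr; apply: is_cvgB => //; exact: is_cvgB.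
Qed.

Lemma l2ipC c e : l2ip c e = l2ip e c.
Proof. by rewrite /l2ip; congr (limn (psum _)); apply/funext => i; rewrite mulrC. Qed.

Lemma l2ip_linear a c c' e : l2seq c -> l2seq c' -> l2seq e ->
  l2ip (fun i => a * c i + c' i) e = a * l2ip c e + l2ip c' e.
Proof.
move=> lc lc' le; have h1 := cvg_l2ip _ _ (l2seq_linear a _ _ lc lc') le.
have h2 : psum (fun i => (a * c i + c' i) * e i) n @[n --> \oo] -->
    a * l2ip c e + l2ip c' e.
  have ha : a * psum (fun i => c i * e i) n @[n --> \oo] --> a * l2ip c e.
    by apply: cvgMr; exact: cvg_l2ip.
  apply: eq_cvgn (cvgD ha (cvg_l2ip _ _ lc' le)) => n.
  rewrite /= -psum_linear; apply: eq_bigr => i _; ring.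
exact: cvg_unique h1 h2.
Qed.

Lemma l2ip_sum (K : Type) (l : seq K) (b : K -> R) (y : K -> I -> R) e :
  (forall k, l2seq (y k)) -> l2seq e ->
  l2ip (fun i => \sum_(k <- l) b k * y k i) e = \sum_(k <- l) b k * l2ip (y k) e.
Proof.
move=> ly le; elim: l => [|k l IH].
  rewrite big_nil /l2ip; apply: cvg_lim => //; apply: eq_cvgn (cvg_cst 0) => n.
  by rewrite /psum big1// => i _; rewrite big_nil mul0r.
rewrite big_cons -IH -l2ip_linear//; last exact: l2seq_sum.
by congr l2ip; apply/funext => i; rewrite big_cons.
Qed.

Lemma l2ip_ge0 c : l2seq c -> 0 <= l2ip c c.
Proof.
move=> lc; apply: limr_ge; first exact: cvg_l2ip.
by apply: nearW => n; apply: psum_ge0 => i; rewrite -expr2 sqr_ge0.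
Qed.

Lemma l2ip_eq0 c e : l2seq c -> l2seq e -> l2ip e e = 0 -> l2ip c e = 0.
Proof.
move=> lc le e0; apply/eqP/negP => /negP p0.
(* Since [e] has norm 0, the squared norm of [t e + c] is affine in [t]; this value of [t] would
   make it -1. *)
pose t := - (l2ip c c + 1) / (2 * l2ip c e).
have l1 := l2seq_linear t _ _ le lc.
have := l2ip_ge0 _ l1; set z := (fun i => t * e i + c i) in l1 *.
have ez : l2ip e z = l2ip c e.
  by rewrite l2ipC /z l2ip_linear// e0 mulr0 add0r.
have cz : l2ip c z = t * l2ip c e + l2ip c c.
  by rewrite l2ipC /z l2ip_linear// (l2ipC e).
rewrite {1}/z l2ip_linear// ez cz.
have -> : t * l2ip c e + (t * l2ip c e + l2ip c c) = -1 by rewrite /t; field.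
by rewrite lerNr oppr0 ler10.
Qed.

(** Gram-Schmidt by induction on the list: both [x] and the new vector are first projected off the
    tail. The vectors may be linearly dependent, as the rows of an arbitrary matrix are; if the
    remainder [y'] has norm 0, then [l2ip_eq0] shows that [x'] is already orthogonal to it. *)
Lemma l2_projection (K : eqType) (l : seq K) (y : K -> I -> R) : uniq l ->
  (forall k, l2seq (y k)) -> forall x, l2seq x -> exists b : K -> R,
  {in l, forall k, l2ip (fun i => x i - \sum_(j <- l) b j * y j i) (y k) = 0}.
Proof.
move=> + ly; elim: l => [_ x lx|k l IH /= /andP[kl ul] x lx].
  by exists (fun=> 0) => k; rewrite in_nil.
have l2B (z : I -> R) (b : K -> R) : l2seq z ->
    l2seq (fun i => z i - \sum_(j <- l) b j * y j i).
  move=> lz.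
  have -> : (fun i => z i - \sum_(j <- l) b j * y j i) =
      (fun i => -1 * (\sum_(j <- l) b j * y j i) + z i).
    by apply/funext => i; rewrite mulN1r addrC.
  by apply: l2seq_linear => //; exact: l2seq_sum.
have [b xb] := IH ul x lx; have [b' yb] := IH ul (y k) (ly k).
set x' := (fun i => x i - _) in xb; set y' := (fun i => y k i - _) in yb.
have lx' : l2seq x' by exact: l2B.
have ly' : l2seq y' by exact: l2B.
pose t := l2ip x' y' / l2ip y' y'.
pose x'' := fun i => - t * y' i + x' i.
have lx'' : l2seq x'' by exact: l2seq_linear.
have x''y' : l2ip x'' y' = 0.
  rewrite l2ip_linear// /t; have [y0|y0] := eqVneq (l2ip y' y') 0.
    by rewrite y0 (l2ip_eq0 x' y')// mulr0 addr0.
  by rewrite mulNr divfK// addNr.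
exists (fun j => if j == k then t else b j - t * b' j).
have E i : x i - \sum_(j <- k :: l) (if j == k then t else b j - t * b' j) * y j i = x'' i.
  rewrite big_cons eqxx /x'' /x' /y'.
  have -> : \sum_(j <- l) (if j == k then t else b j - t * b' j) * y j i =
      \sum_(j <- l) b j * y j i - t * \sum_(j <- l) b' j * y j i.
    rewrite mulr_sumr -sumrB; apply: eq_big_seq => j jl.
    by case: eqP => [jk|_]; [rewrite -jk jl in kl | ring].
  ring.
have -> : (fun i => x i - \sum_(j <- k :: l) (if j == k then t else b j - t * b' j) * y j i) = x''.
  by apply/funext => i; exact: E.
have x''l : {in l, forall j, l2ip x'' (y j) = 0}.
  by move=> j jl; rewrite l2ip_linear// xb// yb// mulr0 addr0.
move=> j; rewrite inE => /predU1P[->|]; last exact: x''l.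
have -> : y k = fun i => 1 * y' i + \sum_(j <- l) b' j * y j i.
  by apply/funext => i; rewrite mul1r /y' subrK.
rewrite l2ipC l2ip_linear//; last exact: l2seq_sum.
rewrite l2ipC x''y' mulr0 add0r l2ip_sum// big_seq big1// => i il.
by rewrite l2ipC x''l// mulr0.
Qed.

End square_summable.

(** * Mean-square limits of Gaussian sums *)

Section gaussian_series.
Context {d : measure_display} {T : measurableType d} {R : realType}.
Variables (P : probability T R) (I : choiceType) (xi : I -> T -> R).
Hypothesis xi_iid : iid_std_normal P xi.
Variable s : nat -> seq I.
Hypothesis s_incr : forall n, exists t, s n.+1 = s n ++ t.
Hypothesis s_uniq : forall n, uniq (s n).
Implicit Types (c e : I -> R) (X Y : T -> R).

Definition gauss_series c X := measurable_fun setT X /\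
  (\int[P]_x ((\sum_(i <- s n) c i * xi i x - X x) ^+ 2)%:E)%E @[n --> \oo] --> 0%E.

Let PT : (P setT < +oo)%E. Proof. by rewrite probability_setT ltry. Qed.

Let mxi i : measurable_fun setT (xi i). Proof. by case: xi_iid. Qed.

Let mS c n : measurable_fun setT (fun x => \sum_(i <- s n) c i * xi i x).
Proof. exact: measurable_fun_lincomb. Qed.

Let mS2 c X n : measurable_fun setT X ->
  measurable_fun setT (fun x => ((\sum_(i <- s n) c i * xi i x - X x) ^+ 2)%:E).
Proof.
by move=> mX; apply/measurable_EFinP; apply: measurable_funX; exact: measurable_funB.
Qed.

Lemma gauss_series_linear a c e X Y : gauss_series c X -> gauss_series e Y ->
  gauss_series (fun i => a * c i + e i) (fun x => a * X x + Y x).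
Proof.
move=> [mX cX] [mY cY]; split.
  by apply: measurable_funD => //; exact: measurable_funM.
have bnd : (((2 * a ^+ 2)%:E * \int[P]_x ((\sum_(i <- s n) c i * xi i x - X x) ^+ 2)%:E) +
    (2%:E * \int[P]_x ((\sum_(i <- s n) e i * xi i x - Y x) ^+ 2)%:E))%E
    @[n --> \oo] --> 0%E.
  rewrite -[X in _ --> X]adde0 -[X in _ --> (X + _)%E](mule0 (2 * a ^+ 2)%:E).
  rewrite -[X in _ --> (_ + X)%E](mule0 2%:E).
  apply: cvgeD; first by rewrite !mule0.
    exact: cvgeZl.
  exact: cvgeZl.
apply: squeeze_cvge (cvg_cst 0%E) bnd.
apply: nearW => n; rewrite integral_ge0/=; last by move=> x _; rewrite lee_fin sqr_ge0.
have a2 : 0 <= 2 * a ^+ 2 by rewrite mulr_ge0// sqr_ge0.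
have p1 x : setT x -> (0 <= ((\sum_(i <- s n) c i * xi i x - X x) ^+ 2)%:E)%E.
  by move=> _; rewrite lee_fin sqr_ge0.
have p2 x : setT x -> (0 <= ((\sum_(i <- s n) e i * xi i x - Y x) ^+ 2)%:E)%E.
  by move=> _; rewrite lee_fin sqr_ge0.
have m1 := mS2 c X n mX; have m2 := mS2 e Y n mY.
rewrite -ge0_integralZl// -ge0_integralZl// -ge0_integralD//; first last.
- exact: measurable_funeM.
- by move=> x tx; rewrite mule_ge0// p2.
- exact: measurable_funeM.
- by move=> x tx; rewrite mule_ge0// p1.
apply: ge0_le_integral => //.
- by move=> x _; rewrite lee_fin sqr_ge0.
- apply: mS2; apply: measurable_funD => //; exact: measurable_funM.
- by apply: emeasurable_funD; exact: measurable_funeM.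
move=> x _; rewrite -!EFinM -EFinD lee_fin.
have -> : \sum_(i <- s n) (a * c i + e i) * xi i x =
    a * (\sum_(i <- s n) c i * xi i x) + \sum_(i <- s n) e i * xi i x.
  by rewrite mulr_sumr -big_split/=; apply: eq_bigr => i _; ring.
set u := \sum_(i <- s n) c i * xi i x; set v := \sum_(i <- s n) e i * xi i x.
have := sqr_ge0 (a * (u - X x) - (v - Y x)); nra.
Qed.

Lemma gauss_series0 : gauss_series (fun=> 0) (fun=> 0).
Proof.
split=> //; apply: cvg_near_cst; apply: nearW => n.
apply: integral0_eq => x _; rewrite big1 ?subr0 ?expr0n// => i _; by rewrite mul0r.
Qed.

Lemma gauss_series_sum (K : Type) (l : seq K) (b : K -> R) (c : K -> I -> R) (X : K -> T -> R) :
  (forall k, gauss_series (c k) (X k)) ->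
  gauss_series (fun i => \sum_(k <- l) b k * c k i) (fun x => \sum_(k <- l) b k * X k x).
Proof.
move=> gX; elim: l => [|k l IH].
  under eq_fun do rewrite big_nil; under [X in gauss_series _ X]eq_fun do rewrite big_nil.
  exact: gauss_series0.
under eq_fun do rewrite big_cons; under [X in gauss_series _ X]eq_fun do rewrite big_cons.
exact: gauss_series_linear.
Qed.

Lemma cos_lip (x y : R) : `|cos x - cos y| <= `|x - y|.
Proof.
wlog xy : x y / x <= y => [h|].
  by case: (leP x y) => [/h//|/ltW/h]; rewrite distrC (distrC y).
have [c _ cE] := @MVT_segment R cos (fun z => - sin z) x y xy
  (fun z _ => is_derive_cos z) (continuous_subspaceT (@continuous_cos R)).
rewrite distrC cE normrM (distrC x) ler_piMl// normrN; exact: sin_max.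
Qed.

(** Pointwise [|cos u - cos v| <= |u - v| <= e + (u - v)^2 / e], so the mean-square distance
    controls the difference with a free parameter [e]. *)
Lemma cos_expectation_close (U V : T -> R) th (e : R) : 0 < e ->
  measurable_fun setT U -> measurable_fun setT V ->
  P.-integrable setT (EFin \o (fun x => (U x - V x) ^+ 2)) ->
  `|Rintegral P setT (fun x => cos (U x + th)) - Rintegral P setT (fun x => cos (V x + th))|
   <= e + e^-1 * Rintegral P setT (fun x => (U x - V x) ^+ 2).
Proof.
move=> e0 mU mV iUV.
have iU : P.-integrable setT (EFin \o (fun x => cos (U x + th))).
  by apply: bmeas_integrable => //; exact: bmeas_cos_comp.
have iV : P.-integrable setT (EFin \o (fun x => cos (V x + th))).
  by apply: bmeas_integrable => //; exact: bmeas_cos_comp.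
have iD : P.-integrable setT (EFin \o (fun x => cos (U x + th) - cos (V x + th))).
  by have := integrableB measurableT iU iV; apply: eq_integrable.
have ie : P.-integrable setT (EFin \o (fun=> e)).
  by apply: bmeas_integrable => //; exact: bmeas_cst.
have iB : P.-integrable setT (EFin \o (fun x => e^-1 * (U x - V x) ^+ 2 + e)).
  by have := integrableD measurableT (integrableZl measurableT e^-1 iUV) ie; apply: eq_integrable.
rewrite -RintegralB//; apply: (le_trans (le_normr_Rintegral _ iD)) => //.
have -> : e + e^-1 * Rintegral P setT (fun x => (U x - V x) ^+ 2) =
    Rintegral P setT (fun x => e^-1 * (U x - V x) ^+ 2 + e).
  rewrite integrable_Rintegral_linear// addrC; congr (_ + _).
  by rewrite Rintegral_cst//= [X in fine X]probability_setT mulr1.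
apply: le_Rintegral => //; first exact: integrable_norm.
move=> x _; apply: le_trans (cos_lip _ _) _.
rewrite opprD addrACA subrr addr0.
have -> : e^-1 * (U x - V x) ^+ 2 + e = (`|U x - V x| ^+ 2 + e ^+ 2) / e.
  by rewrite real_normK ?num_real//; field; rewrite gt_eqF.
rewrite ler_pdivlMr//; have z0 := normr_ge0 (U x - V x); set z := `|_| in z0 *.
have := sqr_ge0 (z - e); have : 0 <= z * e by rewrite mulr_ge0// ltW.
by nra.
Qed.

(** The errors are extended reals that tend to 0, so they are known to be finite only from some
    index on. One such index is enough to prove the limit integrable. *)
Lemma gauss_series_near_integrable c X : gauss_series c X ->
  \forall n \near \oo, P.-integrable setT
    (EFin \o (fun x => (\sum_(i <- s n) c i * xi i x - X x) ^+ 2)).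
Proof.
move=> [mX cX]; have := cvg_is_fine cX; apply: filterS => n fn.
apply/integrableP; split; first exact: mS2.
under eq_integral do rewrite /= ger0_norm ?sqr_ge0//.
by rewrite ltey_eq fn.
Qed.

Lemma gauss_series_cvg_cos c X th : gauss_series c X ->
  expR (- psum s (fun i => c i ^+ 2) n / 2) * cos th @[n --> \oo] -->
  Rintegral P setT (fun x => cos (X x + th)).
Proof.
move=> gX; have [mX cX] := gX.
have cF : Rintegral P setT (fun x => (\sum_(i <- s n) c i * xi i x - X x) ^+ 2)
    @[n --> \oo] --> (0 : R) by apply: fine_cvg; exact: cX.
have ni := gauss_series_near_integrable _ _ gX.
apply/cvgrPdist_le => e e0; have e2 : 0 < e / 2 by rewrite divr_gt0.
(* With parameter [e / 2] and mean-square error at most [(e / 2)^2], the bound of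
   [cos_expectation_close] is exactly [e]. *)
have e4 : 0 < (e / 2) ^+ 2 by rewrite exprn_gt0.
move/cvgrPdist_le : cF => /(_ _ e4) cF.
apply: filterS2 ni cF => n ni /=.
rewrite sub0r normrN => /ler_normlW cF.
rewrite -(iid_normal_cos P I xi xi_iid (s n) c th)// distrC.
apply: le_trans (cos_expectation_close _ _ th (e / 2) e2 (mS c n) mX ni) _.
apply: le_trans (_ : e / 2 + (e / 2)^-1 * (e / 2) ^+ 2 <= _).
  by rewrite lerD2l ler_pM2l ?invr_gt0.
by rewrite expr2 mulKf ?gt_eqF// -splitr.
Qed.

Lemma gauss_series_integrable c X : gauss_series c X -> P.-integrable setT (EFin \o X).
Proof.
move=> gX; have [mX cX] := gX.
have [n ni] := filter_ex (gauss_series_near_integrable _ _ gX).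
have iS : P.-integrable setT (EFin \o (fun x => \sum_(i <- s n) c i * xi i x)).
  have : P.-integrable setT (fun x => \sum_(i <- s n) (c i)%:E * (xi i x)%:E)%E.
    apply: integrable_sum => // i _.
    exact: (integrableZl measurableT (c i) (iid_normal_integrable P I xi xi_iid i)).
  by apply: eq_integrable => // x _; rewrite sumEFin.
have i1 : P.-integrable setT (EFin \o (fun=> 1 : R)).
  by apply: bmeas_integrable => //; exact: bmeas_cst.
have iB := integrableD measurableT ni i1.
have iD : P.-integrable setT (EFin \o (fun x => \sum_(i <- s n) c i * xi i x - X x)).
  apply: le_integrable iB => //.
    by apply/measurable_EFinP; exact: measurable_funB.
  move=> x _ /=; rewrite lee_fin [leRHS]ger0_norm ?addr_ge0 ?sqr_ge0//.
  set z := _ - X x; rewrite -(real_normK (num_real z)); set w := `|z|.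
  have := sqr_ge0 (w - 2^-1); lra.
have := integrableB measurableT iS iD; apply: eq_integrable => // x _.
by rewrite /= -EFinB opprB addrC subrK.
Qed.

Lemma gauss_seriesZ a c X : gauss_series c X ->
  gauss_series (fun i => a * c i) (fun x => a * X x).
Proof.
move=> gX; have := gauss_series_linear a _ _ _ _ gX gauss_series0.
by under eq_fun do rewrite addr0; under [X in gauss_series _ X]eq_fun do rewrite addr0.
Qed.

(* Square summability of the coefficients follows from the continuity at 0 of the
   characteristic function of the limit. *)
Lemma gauss_series_l2seq c X : gauss_series c X -> l2seq s c.
Proof.
move=> gX; have [mX _] := gX.
have c1 : Rintegral P setT (fun x => cos (n.+1%:R^-1 * X x + 0)) @[n --> \oo] --> (1 : R).
  have E1 : Rintegral P setT (fun=> 1 : R) = 1.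
    by rewrite Rintegral_cst//= [X in fine X]probability_setT mulr1.
  rewrite -[X in _ --> X]E1.
  apply: (Rintegral_dominated_cvg P setT _ _ (fun=> 1)) => //.
  - by move=> n; apply: (bmeas_cos_comp _ _ _).1; exact: measurable_funM.
  - by apply: bmeas_integrable => //; exact: bmeas_cst.
  - move=> x _.
    have h0 : n.+1%:R^-1 * X x @[n --> \oo] --> 0 * X x.
      by apply: cvgMl; exact: cvg_harmonic.
    have h1 : n.+1%:R^-1 * X x + 0 @[n --> \oo] --> (0 : R).
      by rewrite mul0r in h0; apply: eq_cvgn h0 => n; rewrite addr0.
    have hc : cos (n.+1%:R^-1 * X x + 0) @[n --> \oo] --> cos (0 : R).
      by apply: continuous_cvg; [exact: continuous_cos | exact: h1].
    by rewrite cos0 in hc.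
  - by move=> n x _; exact: cos_max.
have [n hn] : exists n, 2^-1 < Rintegral P setT (fun x => cos (n.+1%:R^-1 * X x + 0)).
  have h : (2^-1 : R) < 1 by rewrite invf_lt1// ltr1n.
  by move/cvgr_gt : c1 => /(_ _ h)[N _ hN]; exists N; exact: (hN N (leqnn N)).
have := gauss_series_cvg_cos _ _ 0 (gauss_seriesZ n.+1%:R^-1 _ _ gX).
move=> /cvgr_gt/(_ _ hn)[N _ hN].
have n0 : (0 : R) < n.+1%:R by [].
(* At scale [1 / n.+1] the expectation of the cosine exceeds 1/2, so eventually
   [exp (S / (2 n.+1^2)) < 2] for the partial sum [S] of squares. From [1 + v <= exp v] follows
   [S < 2 n.+1^2]. *)
have bN m : (N <= m)%N -> psum s (fun i => c i ^+ 2) m <= 2 * n.+1%:R ^+ 2.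
  move=> /hN /=; rewrite cos0 mulr1.
  have -> : psum s (fun i => (n.+1%:R^-1 * c i) ^+ 2) m =
      n.+1%:R ^- 2 * psum s (fun i => c i ^+ 2) m.
    by rewrite /psum mulr_sumr; apply: eq_bigr => i _; rewrite exprMn exprVn.
  rewrite mulNr expRN -mulrA; set v := psum _ _ _.
  rewrite ltf_pV2 ?posrE ?expR_gt0// => h.
  have := le_lt_trans (expR_ge1Dx _) h.
  rewrite -ltrBrDl (_ : 2 - 1 = 1); last by lra.
  rewrite mulrC ltr_pdivrMr ?exprn_gt0// mul1r ltr_pdivrMr// => /ltW.
  by rewrite mulrC.
apply: (cvg_psum_bounded _ s_incr _ (2 * n.+1%:R ^+ 2)) => [i|m]; first exact: sqr_ge0.
apply: le_trans (bN (maxn N m) (leq_maxl _ _)).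
by apply: (nondecreasing_psum _ s_incr) => [i|]; [exact: sqr_ge0 | exact: leq_maxr].
Qed.

(** The coefficients enter through [l2ip s c c] alone; for this reason the comparison of the two
    fields reduces to variances. *)
Lemma gauss_series_cos c X th : gauss_series c X ->
  Rintegral P setT (fun x => cos (X x + th)) = expR (- l2ip s c c / 2) * cos th.
Proof.
move=> gX; have h1 := gauss_series_cvg_cos _ _ th gX.
have lc := gauss_series_l2seq _ _ gX.
apply: cvg_unique h1 _ => //.
apply: cvgMl; apply: continuous_cvg; first exact: continuous_expR.
by apply: cvgMl; apply: cvgN; exact: (cvg_l2ip _ s_incr).
Qed.

End gaussian_series.

(** * Energy forms and point evaluations *)

Section edge_calculus.
Context {R : realType}.
Local Notation mu := (@lebesgue_measure R).
Implicit Types (l x y : R) (f g : R -> R).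

(** When [A > 0] the minimum of the quadratic gives the inequality. The cases [A < 0], and [A = 0]
    with [B] nonzero, are excluded by an explicit [t] at which the quadratic would be negative. *)
Lemma cauchy_schwarz_discriminant (A B C : R) :
  (forall t, 0 <= A * t ^+ 2 + 2 * B * t + C) -> B ^+ 2 <= A * C.
Proof.
move=> h; have [A0|A0|A0] := ltrgtP A 0.
- have C0 : 0 <= C by have := h 0; rewrite expr0n/= mulr0 mulr0 !add0r.
  pose t := 1 + (2 * `|B| + C) / (- A).
  have A1 : 0 < - A by rewrite oppr_gt0.
  have t1 : 1 <= t by rewrite lerDl divr_ge0 ?addr_ge0 ?mulr_ge0// ltW.
  have := h t; have tA : - A * t = - A + 2 * `|B| + C.
    by rewrite /t; field; rewrite lt_eqF.
  have := ler_norm B => BB; nra.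
- have := h (- B / A).
  have -> : A * (- B / A) ^+ 2 + 2 * B * (- B / A) + C = (A * C - B ^+ 2) / A.
    by field; rewrite gt_eqF.
  by rewrite pmulr_lge0 ?invr_gt0// subr_ge0.
- have [->|B0] := eqVneq B 0; first by rewrite expr0n/= A0 mul0r.
  have := h (- (C + 1) / (2 * B)).
  have -> : A * (- (C + 1) / (2 * B)) ^+ 2 + 2 * B * (- (C + 1) / (2 * B)) + C = -1.
    by rewrite A0; field.
  by rewrite lerNr oppr0 ler10.
Qed.

Lemma sum_cauchy_schwarz (I : Type) (s : seq I) (u w : I -> R) :
  (\sum_(i <- s) u i * w i) ^+ 2 <= (\sum_(i <- s) u i ^+ 2) * (\sum_(i <- s) w i ^+ 2).
Proof.
apply: cauchy_schwarz_discriminant => t.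
have -> : (\sum_(i <- s) u i ^+ 2) * t ^+ 2 + 2 * (\sum_(i <- s) u i * w i) * t +
    \sum_(i <- s) w i ^+ 2 = \sum_(i <- s) (u i * t + w i) ^+ 2.
  rewrite mulr_suml mulr_sumr mulr_suml -!big_split/=.
  by apply: eq_bigr => i _; ring.
by apply: sumr_ge0 => i _; exact: sqr_ge0.
Qed.

(** Lipschitz functions with a chosen bounded derivative. Being narrower than H^1, this class keeps
    every integrand bounded, and it still contains eigenfunctions, their fluxes [a f'] and linear
    functions. *)
Definition prim l f (df : R -> R) := bmeas `[0, l] df /\
  forall x, in_edge l x -> f x = f 0 + Rintegral mu `[0, x] df.

Lemma lebesgue_itv_lty (a b : R) (ba bb : bool) :
  (mu [set` Interval (BSide ba a) (BSide bb b)] < +oo)%E.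
Proof.
by rewrite lebesgue_measure_itv/=; case: ifP => // _; rewrite -EFinB ltry.
Qed.

Lemma lebesgue_itv_oc x y : x <= y -> fine (mu `]x, y]) = y - x.
Proof.
move=> xy; rewrite lebesgue_measure_itv/= lte_fin; case: ltP => h /=; first by [].
by apply/esym/eqP; rewrite subr_eq0 eq_le h xy.
Qed.

Lemma bmeas_subitv l f (ba bb : bool) x y : 0 <= x -> y <= l -> bmeas `[0, l] f ->
  bmeas [set` Interval (BSide ba x) (BSide bb y)] f.
Proof.
move=> x0 yl; apply: bmeas_sub => // z /=; rewrite !in_itv/= => /andP[h1 h2].
apply/andP; split; apply: le_trans; [exact: x0| | |exact: yl].
- by move: h1; case: ba => //= /ltW.
- by move: h2; case: bb => //= /ltW.
Qed.

Lemma edge_integrable l f (ba bb : bool) x y : 0 <= x -> y <= l -> bmeas `[0, l] f ->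
  mu.-integrable [set` Interval (BSide ba x) (BSide bb y)] (EFin \o f).
Proof.
move=> x0 yl bf; apply: bmeas_integrable => //; first exact: lebesgue_itv_lty.
exact: (bmeas_subitv l).
Qed.

Lemma Rintegral_0x_sub l f x y : 0 <= x -> x <= y -> y <= l -> bmeas `[0, l] f ->
  Rintegral mu `[0, y] f - Rintegral mu `[0, x] f = Rintegral mu `]x, y] f.
Proof.
move=> x0 xy yl bf; apply: Rintegral_itvB; last 2 first.
- by rewrite bnd_simp.
- by rewrite bnd_simp.
- exact: (edge_integrable l).
Qed.

Lemma Rintegral_oc_norm_le l f x y M : 0 <= x -> x <= y -> y <= l -> bmeas `[0, l] f ->
  (forall z, x < z -> z <= y -> `|f z| <= M) -> `|Rintegral mu `]x, y] f| <= M * (y - x).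
Proof.
move=> x0 xy yl bf fM.
have [mf _] : bmeas `]x, y] f by exact: (bmeas_subitv l).
have := Rintegral_norm_le mu `]x, y] f M _ (lebesgue_itv_lty _ _ _ _) mf.
rewrite [X in _ * X](_ : _ = y - x); last exact: lebesgue_itv_oc.
by apply => // z; rewrite /= in_itv/= => /andP[]; exact: fM.
Qed.

Lemma prim_sub l f df x y : prim l f df -> 0 <= x -> x <= y -> y <= l ->
  f y - f x = Rintegral mu `]x, y] df.
Proof.
move=> [bdf fE] x0 xy yl.
rewrite -(Rintegral_0x_sub l)// (fE y) ?(fE x); first by ring.
- by rewrite /in_edge x0 (le_trans xy yl).
- by rewrite /in_edge (le_trans x0 xy) yl.
Qed.

Lemma prim_lip l f df : prim l f df -> exists2 M, 0 <= M &
  forall x y, in_edge l x -> in_edge l y -> `|f x - f y| <= M * `|x - y|.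
Proof.
move=> pf; have [bdf _] := pf; have [_ [M Mdf]] := bdf.
exists `|M| => // x y.
wlog xy : x y / y <= x => [h ex ey|].
  by case: (leP y x) => [|/ltW] xy; [exact: h | rewrite distrC (distrC x); exact: h].
move=> /andP[x0 xl] /andP[y0 yl]; rewrite (ger0_norm (_ : 0 <= x - y)) ?subr_ge0//.
rewrite (prim_sub _ _ _ _ _ pf)//; apply: (Rintegral_oc_norm_le l) => // z yz zx.
apply: le_trans (ler_norm M); apply: Mdf.
by rewrite /= in_itv/= (le_trans y0 (ltW yz)) (le_trans zx xl).
Qed.

(** Composition with the clamp onto [0, l] extends [f] to a continuous function on the whole line,
    from which measurability on the interval follows. *)
Lemma lip_bmeas l f M : 0 <= l ->
  (forall x y, in_edge l x -> in_edge l y -> `|f x - f y| <= M * `|x - y|) ->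
  bmeas `[0, l] f.
Proof.
move=> l0 fM; pose cl x : R := Num.max 0 (Num.min x l).
have ecl x : in_edge l (cl x).
  by rewrite /in_edge /cl le_max lexx/= ge_max l0 ge_min lexx orbT.
have clx x : in_edge l x -> cl x = x.
  by move=> /andP[x0 xl]; rewrite /cl (min_idPl xl); exact/max_idPr.
have cllip x y : `|cl x - cl y| <= `|x - y|.
  have h1 := ler_norm (x - y); have h2 := ler_norm (- (x - y)); rewrite normrN in h2.
  have h3 := normr_ge0 (x - y).
  rewrite /cl !maxEle !minEle ler_norml.
  by do !case: ifPn; rewrite -?ltNge => *; apply/andP; split; lra.
have mcl : measurable_fun setT (f \o cl).
  apply: continuous_measurable_fun => x; apply/cvgrPdist_le => e e0.
  have e1 : 0 < e / (`|M| + 1) by rewrite divr_gt0// ltr_wpDl.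
  have nx : \forall y \near x, `|x - y| <= e / (`|M| + 1).
    by have /cvgrPdist_le := @cvg_id _ (nbhs x); apply.
  near=> y; apply: (le_trans (fM _ _ (ecl _) (ecl _))).
  apply: (@le_trans _ _ (`|M| * `|x - y|)).
    apply: (@le_trans _ _ (`|M| * `|cl x - cl y|)).
      by rewrite ler_wpM2r// ler_norm.
    by rewrite ler_wpM2l.
  have xy : `|x - y| <= e / (`|M| + 1).
    by near: y; exact: nx.
  apply: (@le_trans _ _ ((`|M| + 1) * (e / (`|M| + 1)))).
    by apply: ler_pM => //; rewrite lerDl.
  by rewrite mulrC divfK// gt_eqF// ltr_wpDl.
split.
  apply: (eq_measurable_fun (f \o cl)); last exact: measurable_funTS.
  by move=> x; rewrite inE/= in_itv/= => ex; rewrite clx.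
exists (`|f 0| + `|M| * l) => x; rewrite /= in_itv/= => ex.
have e0 : in_edge l 0 by rewrite /in_edge lexx l0.
have := fM x 0 ex e0; rewrite subr0 => h.
rewrite -(subrK (f 0) (f x)) addrC; apply: le_trans (ler_normD _ _) _.
rewrite lerD2l; apply: (le_trans h); move: ex => /andP[x0 xl].
by rewrite (ger0_norm x0); apply: (@le_trans _ _ (`|M| * x));
  [rewrite ler_wpM2r// ler_norm | rewrite ler_wpM2l].
Unshelve. all: by end_near. Qed.

Lemma prim_bmeas l f df : 0 <= l -> prim l f df -> bmeas `[0, l] f.
Proof. by move=> l0 /prim_lip[M _]; exact: lip_bmeas. Qed.

(** Cutting [0, l] into [n.+1] equal pieces bounds the total increment by [C l^2 / n.+1], which is
    arbitrarily small. *)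
Lemma quadratic_increment_cst l (D : R -> R) (C : R) : 0 <= l ->
  (forall x y, 0 <= x -> x <= y -> y <= l -> `|D y - D x| <= C * (y - x) ^+ 2) -> D l = D 0.
Proof.
move=> l0 hD; apply/eqP; rewrite -subr_eq0 -normr_eq0 eq_le normr_ge0 andbT.
apply/ler_addgt0Pl => e e0; rewrite addr0.
have [n ne] : exists n, `|C| * l ^+ 2 / e < n.+1%:R :> R.
  by exists (Num.truncn (`|C| * l ^+ 2 / e)); exact: truncnS_gt.
have n0 : (0 : R) < n.+1%:R by [].
pose h := l / n.+1%:R.
have h0 : 0 <= h by rewrite divr_ge0.
have key k : (k <= n.+1)%N -> `|D (h * k%:R) - D 0| <= k%:R * (C * h ^+ 2).
  elim: k => [_|k IH kn]; first by rewrite mulr0 subrr normr0 mul0r.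
  have -> : D (h * k.+1%:R) - D 0 =
      (D (h * k%:R) - D 0) + (D (h * (k%:R + 1)) - D (h * k%:R)).
    by rewrite natr1; ring.
  apply: le_trans (ler_normD _ _) _; rewrite -(natr1 k) mulrDl mul1r.
  apply: lerD; first by apply: IH; exact: ltnW.
  have := hD (h * k%:R) (h * (k%:R + 1)).
  rewrite mulrDr mulr1 addrAC subrr add0r; apply.
  - by rewrite mulr_ge0.
  - by rewrite lerDl.
  - rewrite -{2}[h]mulr1 -mulrDr natr1.
    apply: (@le_trans _ _ (h * n.+1%:R)); last by rewrite /h divfK// gt_eqF.
    by rewrite ler_wpM2l// ler_nat.
have := key _ (leqnn _); rewrite /h divfK ?gt_eqF// => H.
apply: (le_trans H).
have -> : n.+1%:R * (C * (l / n.+1%:R) ^+ 2) = C * l ^+ 2 / n.+1%:R.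
  by field; rewrite gt_eqF.
have {}ne : `|C| * l ^+ 2 <= e * n.+1%:R.
  by move: ne; rewrite ltr_pdivrMr// (mulrC e) => /ltW.
rewrite ler_pdivrMr//.
by apply: le_trans ne; rewrite ler_wpM2r ?sqr_ge0// ler_norm.
Qed.

(** The derivatives are merely bounded measurable, so [D], the difference of the product and the
    candidate primitive, is not differentiated. Instead its increments are shown to be quadratically
    small, which makes it constant. *)
Lemma edge_integration_by_parts l A B f df : 0 <= l -> prim l A B -> prim l f df ->
  Rintegral mu `[0, l] (fun x => A x * df x + B x * f x) = A l * f l - A 0 * f 0.
Proof.
move=> l0 pA pf; have [bB _] := pA; have [bdf _] := pf.
have bA := prim_bmeas _ _ _ l0 pA; have bf := prim_bmeas _ _ _ l0 pf.
have [_ [MB hB]] := bB; have [_ [Mdf hdf]] := bdf.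
have [LA LA0 lipA] := prim_lip _ _ _ pA; have [Lf Lf0 lipf] := prim_lip _ _ _ pf.
pose G x := A x * df x + B x * f x.
have bG : bmeas `[0, l] G by apply: bmeasD; exact: bmeasM.
pose D x := A x * f x - Rintegral mu `[0, x] G.
suff : D l = D 0.
  rewrite /D set_itv1 Rintegral_set1 subr0 => <-; ring.
apply: (quadratic_increment_cst _ _ (`|MB| * Lf + LA * `|Mdf|)) => // x y x0 xy yl.
have xl := le_trans xy yl.
(* The increment of the product over [x, y] is [f y] times that of [A] plus [A x] times that of [f].
   Comparing this with the integral of [G] leaves [g], and each of its terms has a Lipschitz factor
   of order [y - x]. *)
pose g z := B z * (f y - f z) + (A x - A z) * df z.
have bg : bmeas `[0, l] g.
  apply: bmeasD; apply: bmeasM => //; apply: bmeasB => //; exact: bmeas_cst.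
have -> : D y - D x = Rintegral mu `]x, y] g.
  have E1 := prim_sub _ _ _ x y pA x0 xy yl.
  have E2 := prim_sub _ _ _ x y pf x0 xy yl.
  have E3 := Rintegral_0x_sub l G x y x0 xy yl bG.
  have io (h : R -> R) : bmeas `[0, l] h -> bmeas `]x, y] h by move=> bh; exact: (bmeas_subitv l).
  have E4 : Rintegral mu `]x, y] g = f y * Rintegral mu `]x, y] B +
      (A x * Rintegral mu `]x, y] df - Rintegral mu `]x, y] G).
    have lty := lebesgue_itv_lty x y false false.
    have bAdf : bmeas `]x, y] (fun z => A x * df z + (-1) * G z).
      by apply: bmeasD; apply: bmeasZ; exact: io.
    transitivity (Rintegral mu `]x, y] (fun z => f y * B z + (A x * df z + (-1) * G z))).
      by apply: eq_Rintegral => z _; rewrite /g /G; ring.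
    rewrite Rintegral_linear//; last exact: io.
    rewrite Rintegral_linear//; [|exact: io|by apply: bmeasZ; exact: io].
    congr (_ + (_ + _)); rewrite RintegralZl//; first by rewrite mulN1r.
    by apply: bmeas_integrable => //; exact: io.
  by rewrite E4 -E1 -E2 -E3 /D; ring.
have -> : (`|MB| * Lf + LA * `|Mdf|) * (y - x) ^+ 2 =
    (`|MB| * Lf + LA * `|Mdf|) * (y - x) * (y - x) by ring.
apply: (Rintegral_oc_norm_le l) => // z xz zy.
have ez : in_edge l z by rewrite /in_edge (le_trans x0 (ltW xz)) (le_trans zy yl).
have ex : in_edge l x by rewrite /in_edge x0 xl.
have ey : in_edge l y by rewrite /in_edge (le_trans x0 xy) yl.
have yx : 0 <= y - x by rewrite subr_ge0.
apply: le_trans (ler_normD _ _) _; rewrite !normrM mulrDl; apply: lerD.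
  rewrite -mulrA; apply: ler_pM => //.
    by apply: le_trans (ler_norm _); apply: hB; rewrite /= in_itv.
  apply: (le_trans (lipf _ _ ey ez)); apply: ler_wpM2l => //.
  by rewrite ger0_norm ?subr_ge0// lerB// ltW.
rewrite mulrAC; apply: ler_pM => //.
  apply: (le_trans (lipA _ _ ex ez)); apply: ler_wpM2l => //.
  by rewrite distrC ger0_norm ?subr_ge0 ?(ltW xz)// lerB.
by apply: le_trans (ler_norm _); apply: hdf; rewrite /= in_itv.
Qed.

Lemma Rintegral_oc_cauchy_schwarz l f x y : 0 <= x -> x <= y -> y <= l -> bmeas `[0, l] f ->
  (Rintegral mu `]x, y] f) ^+ 2 <= (y - x) * Rintegral mu `[0, l] (fun z => f z ^+ 2).
Proof.
move=> x0 xy yl bf; set J := Rintegral mu _ f.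
have bo (h : R -> R) : bmeas `[0, l] h -> bmeas `]x, y] h by move=> bh; exact: (bmeas_subitv l).
have lty := lebesgue_itv_lty x y false false.
have muE : fine (mu `]x, y]) = y - x by exact: lebesgue_itv_oc.
have b2 : bmeas `[0, l] (fun z => f z ^+ 2) by exact: bmeasX.
apply: (@le_trans _ _ ((y - x) * Rintegral mu `]x, y] (fun z => f z ^+ 2))).
  rewrite mulrC mulrC; apply: cauchy_schwarz_discriminant => t.
  have -> : (y - x) * t ^+ 2 + 2 * J * t + Rintegral mu `]x, y] (fun z => f z ^+ 2) =
      Rintegral mu `]x, y] (fun z => (t + f z) ^+ 2).
    transitivity (Rintegral mu `]x, y] (fun z => (2 * t) * f z + (1 * f z ^+ 2 + t ^+ 2))).
      rewrite Rintegral_linear//; last 2 first.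
      - exact: bo.
      - by apply: bmeasD; [apply: bmeasZ; exact: bo | exact: bmeas_cst].
      rewrite Rintegral_linear//; [|exact: bo|exact: bmeas_cst].
      by rewrite Rintegral_cst// muE -/J; ring.
    by apply: eq_Rintegral => z _; ring.
  by apply: Rintegral_ge0 => z _; exact: sqr_ge0.
rewrite ler_wpM2l ?subr_ge0//.
have i1 : mu.-integrable `]x, y] (EFin \o (fun z => f z ^+ 2)) by exact: (edge_integrable l).
have i2 : mu.-integrable `[0, l] (EFin \o (fun z => f z ^+ 2)) by exact: (edge_integrable l).
rewrite /Rintegral fine_le//; [exact: integrable_fin_num|exact: integrable_fin_num|].
apply: ge0_subset_integral => //.
- by case: b2 => m2 _; apply/measurable_EFinP.
- by move=> z _; rewrite lee_fin sqr_ge0.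
- move=> z /=; rewrite !in_itv/= => /andP[h1 h2].
  by rewrite (le_trans x0 (ltW h1)) (le_trans h2 yl).
Qed.

Lemma holder_ae_eq0 l g C : 0 < l ->
  (forall x y, in_edge l x -> in_edge l y -> (g x - g y) ^+ 2 <= C * `|x - y|) ->
  {ae mu, forall x, in_edge l x -> g x = 0} -> forall x, in_edge l x -> g x = 0.
Proof.
move=> l0 gC [N [mN N0 subN]] x ex; apply/eqP/negP => /negP gx0.
(* A zero of [g] closer to [x] than [dl] would violate the Hoelder bound. So the part of this window
   inside the edge, which has positive length because [0 < l], would lie in a null set. *)
pose dl := g x ^+ 2 / (`|C| + 1).
have C1 : 0 < `|C| + 1 by rewrite ltr_wpDl.
have dl0 : 0 < dl by rewrite divr_gt0// exprn_even_gt0.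
pose al := Num.max 0 (x - dl / 2); pose be := Num.min l (x + dl / 2).
have /andP[x0 xl] := ex.
have ab : al < be.
  by rewrite /al /be gt_max !lt_min; apply/andP; split; apply/andP; split; lra.
have sub : `[al, be] `<=` N.
  move=> y /=; rewrite in_itv/= /al /be ge_max le_min.
  move=> /andP[/andP[y0 y1] /andP[y2 y3]]; apply: subN => /=.
  move=> h; have ey : in_edge l y by rewrite /in_edge y0 y2.
  have := gC x y ex ey; rewrite (h ey) subr0; apply/negP; rewrite -ltNge.
  have xy : `|x - y| < dl by rewrite ltr_norml; apply/andP; split; lra.
  apply: (@le_lt_trans _ _ (`|C| * `|x - y|)); first by rewrite ler_wpM2r// ler_norm.
  apply: (@le_lt_trans _ _ (`|C| * dl)); first by rewrite ler_wpM2l// ltW.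
  by rewrite /dl mulrA ltr_pdivrMr// mulrC ltr_pM2l ?exprn_even_gt0// ltrDl.
have : (mu `[al, be] <= mu N)%E by apply: le_measure; rewrite ?inE.
by rewrite N0 lebesgue_measure_itv/= lte_fin ab -EFinB lee_fin subr_le0 leNgt ab.
Qed.

End edge_calculus.

Lemma limr_le_cvg {R : realType} (u : nat -> R) (l M : R) :
  u n @[n --> \oo] --> l -> (\forall n \near \oo, u n <= M) -> l <= M.
Proof. by move=> ul uM; rewrite -(cvg_lim _ ul)//; apply: limr_le => //; apply/cvg_ex; exists l. Qed.

Lemma cvg_sum_fin {R : realType} (K : Type) (r : seq K) (u : nat -> K -> R) (l : K -> R) :
  (forall k, true -> u n k @[n --> \oo] --> l k) ->
  \sum_(k <- r) u n k @[n --> \oo] --> \sum_(k <- r) l k.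
Proof.
move=> ul; elim: r => [|k r IH].
  by rewrite big_nil; under eq_fun do rewrite big_nil; exact: cvg_cst.
by rewrite big_cons; under eq_fun do rewrite big_cons; apply: cvgD => //; exact: ul.
Qed.

(** * The energy form on edgewise functions *)

Section energy_space.
Context {R : realType} {E : finType}.
Variables (len : E -> R) (a q : E -> R -> R) (a0 q0 : R).
Hypothesis len_pos : forall e, 0 < len e.
Hypothesis ba : forall e, bmeas `[0, len e] (a e).
Hypothesis bq : forall e, bmeas `[0, len e] (q e).
Hypothesis a0_pos : 0 < a0.
Hypothesis q0_pos : 0 < q0.
Hypothesis a_lb : forall e x, in_edge (len e) x -> a0 <= a e x.
Hypothesis q_lb : forall e x, in_edge (len e) x -> q0 <= q e x.
Local Notation mu := (@lebesgue_measure R).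

(* Elements are pairs (function, edgewise derivative), both edge-indexed. *)
Definition fpair : Type := ((E -> R -> R) * (E -> R -> R))%type.
Implicit Types F G : fpair.

Definition wspace F := forall e, prim (len e) (F.1 e) (F.2 e).

Definition wlin (t : R) F G : fpair :=
  (fun e x => t * F.1 e x + G.1 e x, fun e x => t * F.2 e x + G.2 e x).

Definition wsum (I : Type) (s : seq I) (c : I -> R) (Phi : I -> fpair) : fpair :=
  (fun e x => \sum_(i <- s) c i * (Phi i).1 e x,
   fun e x => \sum_(i <- s) c i * (Phi i).2 e x).

Arguments wsum {I}.

Let len0 e : 0 <= len e. Proof. exact: ltW. Qed.

Lemma wspace_bmeas F e : wspace F -> bmeas `[0, len e] (F.1 e) /\ bmeas `[0, len e] (F.2 e).
Proof. by move=> HF; split; [exact: prim_bmeas (HF e) | case: (HF e)]. Qed.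

Lemma wspace_lin t F G : wspace F -> wspace G -> wspace (wlin t F G).
Proof.
move=> HF HG e; have [b1 f1] := HF e; have [b2 f2] := HG e; split.
  by apply: bmeasD => //; exact: bmeasZ.
move=> x ex; rewrite /= (f1 x ex) (f2 x ex).
have /andP[x0 xl] := ex.
rewrite integrable_Rintegral_linear//; first by ring.
  exact: (edge_integrable (len e)).
exact: (edge_integrable (len e)).
Qed.

Lemma wspace0 : wspace (fun _ _ => 0, fun _ _ => 0).
Proof.
move=> e; split; first exact: bmeas_cst.
by move=> x _; rewrite /= Rintegral_cst// mul0r addr0.
Qed.

Lemma wsum_cons (I : Type) (i : I) (s : seq I) c Phi :
  wsum (i :: s) c Phi = wlin (c i) (Phi i) (wsum s c Phi).
Proof.
by rewrite /wsum /wlin /=; congr (_, _); apply/funext => e; apply/funext => x;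
  rewrite big_cons.
Qed.

Lemma wsum_nil (I : Type) c (Phi : I -> fpair) :
  wsum [::] c Phi = (fun _ _ => 0, fun _ _ => 0).
Proof.
by rewrite /wsum; congr (_, _); apply/funext => e; apply/funext => x; rewrite big_nil.
Qed.

Lemma wspace_sum (I : Type) (s : seq I) c (Phi : I -> fpair) :
  (forall i, wspace (Phi i)) -> wspace (wsum s c Phi).
Proof.
move=> HPhi; elim: s => [|i s IH]; first by rewrite wsum_nil; exact: wspace0.
by rewrite wsum_cons; exact: wspace_lin.
Qed.

Definition energy F G : R := \sum_e Rintegral mu `[0, len e]
  (fun x => a e x * F.2 e x * G.2 e x + q e x * F.1 e x * G.1 e x).

Let bE F G e : wspace F -> wspace G -> bmeas `[0, len e]
  (fun x => a e x * F.2 e x * G.2 e x + q e x * F.1 e x * G.1 e x).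
Proof.
move=> HF HG; have [f1 f2] := wspace_bmeas F e HF; have [g1 g2] := wspace_bmeas G e HG.
by apply: bmeasD; apply: bmeasM => //; exact: bmeasM.
Qed.

Lemma energyC F G : energy F G = energy G F.
Proof. by apply: eq_bigr => e _; apply: eq_Rintegral => x _; ring. Qed.

Lemma energy_linear t F F' G : wspace F -> wspace F' -> wspace G ->
  energy (wlin t F F') G = t * energy F G + energy F' G.
Proof.
move=> HF HF' HG; rewrite /energy mulr_sumr -big_split/=; apply: eq_bigr => e _.
rewrite -integrable_Rintegral_linear//.
- by apply: eq_Rintegral => x _; ring.
- by apply: (edge_integrable (len e)) => //; exact: bE.
- by apply: (edge_integrable (len e)) => //; exact: bE.
Qed.

Lemma energy0 G : energy (fun _ _ => 0, fun _ _ => 0) G = 0.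
Proof.
apply: big1 => e _; transitivity (Rintegral mu `[0, len e] (fun=> 0)).
  by apply: eq_Rintegral => x _ /=; ring.
by rewrite Rintegral_cst// mul0r.
Qed.

Lemma energy_sum (I : Type) (s : seq I) c (Phi : I -> fpair) G :
  (forall i, wspace (Phi i)) -> wspace G ->
  energy (wsum s c Phi) G = \sum_(i <- s) c i * energy (Phi i) G.
Proof.
move=> HPhi HG; elim: s => [|i s IH]; first by rewrite wsum_nil big_nil energy0.
by rewrite wsum_cons energy_linear ?big_cons ?IH//; exact: wspace_sum.
Qed.

Lemma energy_ge0 F : wspace F -> 0 <= energy F F.
Proof.
move=> HF; apply: sumr_ge0 => e _; apply: Rintegral_ge0 => x /=; rewrite in_itv/= => ex.
have h1 := le_trans (ltW a0_pos) (a_lb e x ex).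
have h2 := le_trans (ltW q0_pos) (q_lb e x ex).
rewrite -!mulrA -!expr2; apply: addr_ge0; apply: mulr_ge0 => //; exact: sqr_ge0.
Qed.

Lemma energy_wlin_sqr t F G : wspace F -> wspace G ->
  energy (wlin t F G) (wlin t F G) = t ^+ 2 * energy F F + 2 * t * energy F G + energy G G.
Proof.
move=> HF HG; have HH : wspace (wlin t F G) by exact: wspace_lin.
have e1 : energy F (wlin t F G) = t * energy F F + energy F G.
  by rewrite energyC energy_linear// (energyC G).
have e2 : energy G (wlin t F G) = t * energy F G + energy G G.
  by rewrite energyC energy_linear.
by rewrite (energy_linear t F G (wlin t F G))// e1 e2; ring.
Qed.

Lemma derivative_energy_le F e : wspace F ->
  Rintegral mu `[0, len e] (fun x => F.2 e x ^+ 2) <= energy F F / a0.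
Proof.
move=> HF; have [f1 f2] := wspace_bmeas F e HF.
rewrite ler_pdivlMr// mulrC -RintegralZl//; last first.
  by apply: (edge_integrable (len e)) => //; exact: bmeasX.
apply: (@le_trans _ _ (Rintegral mu `[0, len e]
    (fun x => a e x * F.2 e x * F.2 e x + q e x * F.1 e x * F.1 e x))).
  apply: le_Rintegral => //.
  - by apply: (edge_integrable (len e)) => //; apply: bmeasZ; exact: bmeasX.
  - by apply: (edge_integrable (len e)) => //; exact: bE.
  move=> x; rewrite /= in_itv/= => ex.
  have h1 := a_lb e x ex; have h2 := le_trans (ltW q0_pos) (q_lb e x ex).
  rewrite -!mulrA -!expr2 -[leLHS]addr0; apply: lerD.
    by rewrite ler_wpM2r ?sqr_ge0.
  by rewrite mulr_ge0// sqr_ge0.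
rewrite /energy (bigD1 e)//= lerDl; apply: sumr_ge0 => e' _.
apply: Rintegral_ge0 => x /=; rewrite in_itv/= => ex.
have h1 := le_trans (ltW a0_pos) (a_lb e' x ex).
have h2 := le_trans (ltW q0_pos) (q_lb e' x ex).
rewrite -!mulrA -!expr2; apply: addr_ge0; apply: mulr_ge0 => //; exact: sqr_ge0.
Qed.

(** The one-dimensional Sobolev embedding. It is needed uniformly along truncated expansions, whose
    energies are bounded by Bessel's inequality. *)
Lemma energy_holder F e x y : wspace F -> in_edge (len e) x -> in_edge (len e) y ->
  (F.1 e x - F.1 e y) ^+ 2 <= energy F F / a0 * `|x - y|.
Proof.
move=> HF; wlog xy : x y / y <= x => [h ex ey|/andP[x0 xl] /andP[y0 yl]].
  case: (leP y x) => [|/ltW] xy; first exact: h.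
  by rewrite -sqrrN opprB distrC; exact: h.
have [f1 f2] := wspace_bmeas F e HF.
rewrite (prim_sub _ _ _ _ _ (HF e))// ger0_norm ?subr_ge0//.
apply: (le_trans (Rintegral_oc_cauchy_schwarz (len e) _ _ _ y0 xy xl f2)).
by rewrite mulrC ler_wpM2r ?subr_ge0// derivative_energy_le.
Qed.

Lemma graph_ip_linear t (f f' g : E -> R -> R) :
  (forall e, bmeas `[0, len e] (f e)) -> (forall e, bmeas `[0, len e] (f' e)) ->
  (forall e, bmeas `[0, len e] (g e)) ->
  graph_ip len (fun e x => t * f e x + f' e x) g = t * graph_ip len f g + graph_ip len f' g.
Proof.
move=> bf bf' bg; rewrite /graph_ip mulr_sumr -big_split/=; apply: eq_bigr => e _.
rewrite /edge_ip -integrable_Rintegral_linear//.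
- by apply: eq_Rintegral => x _; ring.
- by apply: (edge_integrable (len e)) => //; exact: bmeasM.
- by apply: (edge_integrable (len e)) => //; exact: bmeasM.
Qed.

Lemma graph_ipC (f g : E -> R -> R) : graph_ip len f g = graph_ip len g f.
Proof. by apply: eq_bigr => e _; apply: eq_Rintegral => x _; rewrite mulrC. Qed.

Lemma graph_ip_sum (I : Type) (s : seq I) c (Phi : I -> fpair) (g : E -> R -> R) :
  (forall i, wspace (Phi i)) -> (forall e, bmeas `[0, len e] (g e)) ->
  graph_ip len (wsum s c Phi).1 g = \sum_(i <- s) c i * graph_ip len (Phi i).1 g.
Proof.
move=> HPhi bg; elim: s => [|i s IH].
  rewrite wsum_nil big_nil /graph_ip big1// => e _; rewrite /edge_ip.
  under eq_Rintegral do rewrite /= mul0r.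
  by rewrite Rintegral_cst// mul0r.
rewrite wsum_cons big_cons -IH graph_ip_linear// => e.
- by case: (wspace_bmeas (Phi i) e (HPhi i)).
- by case: (wspace_bmeas (wsum s c Phi) e (wspace_sum I s c Phi HPhi)).
Qed.

Lemma energy_ge_ip F : wspace F -> q0 * graph_ip len F.1 F.1 <= energy F F.
Proof.
move=> HF; rewrite /graph_ip mulr_sumr; apply: ler_sum => e _.
have [f1 f2] := wspace_bmeas F e HF.
rewrite /edge_ip -RintegralZl//; last first.
  by apply: (edge_integrable (len e)) => //; exact: bmeasM.
apply: le_Rintegral => //.
- by apply: (edge_integrable (len e)) => //; apply: bmeasZ; exact: bmeasM.
- by apply: (edge_integrable (len e)) => //; exact: bE.
move=> x; rewrite /= in_itv/= => ex.
have h1 := le_trans (ltW a0_pos) (a_lb e x ex); have h2 := q_lb e x ex.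
rewrite -!mulrA -!expr2 -[leLHS]add0r; apply: lerD.
  by rewrite mulr_ge0// sqr_ge0.
by rewrite ler_wpM2r ?sqr_ge0.
Qed.

Definition pteval (L : seq (R * (E * R))) (f : E -> R -> R) : R :=
  \sum_(p <- L) p.1 * f p.2.1 p.2.2.

Definition pts_in_edges (L : seq (R * (E * R))) :=
  {in L, forall p, in_edge (len p.2.1) p.2.2}.

Lemma pteval_sum L (I : Type) (s : seq I) c (Phi : I -> fpair) :
  pteval L (wsum s c Phi).1 = \sum_(i <- s) c i * pteval L (Phi i).1.
Proof.
rewrite /pteval; under eq_bigr do rewrite mulr_sumr.
rewrite exchange_big/=; apply: eq_bigr => i _; rewrite mulr_sumr.
by apply: eq_bigr => p _; rewrite mulrCA.
Qed.

Lemma pteval_lin L t F G : pteval L (wlin t F G).1 = t * pteval L F.1 + pteval L G.1.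
Proof.
rewrite /pteval mulr_sumr -big_split/=; apply: eq_bigr => p _; ring.
Qed.

Lemma cvg_pteval L (f_ : nat -> E -> R -> R) f : pts_in_edges L ->
  (forall e x, in_edge (len e) x -> f_ n e x @[n --> \oo] --> f e x) ->
  pteval L (f_ n) @[n --> \oo] --> pteval L f.
Proof.
move=> + ff; elim: L => [_|p L IH pL].
  by rewrite /pteval big_nil; under eq_fun do rewrite big_nil; exact: cvg_cst.
rewrite /pteval big_cons; under eq_fun do rewrite big_cons.
apply: cvgD; first by apply: cvgMr; apply: ff; apply: pL; rewrite mem_head.
by apply: IH => p' p'L; apply: pL; rewrite inE p'L orbT.
Qed.

(** A common interface for the decoupled edges and the graph. [C] is the essential condition on test
    functions: none for Neumann edges, continuity at vertices for the graph. Conditions on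
    derivatives are natural ones and appear only through the weak identity [es_weak]. *)
Record eigensystem (C : fpair -> Prop) (I : choiceType) (s : nat -> seq I)
    (lam : I -> R) (Phi : I -> fpair) : Prop := {
  es_incr : forall n, exists t, s n.+1 = s n ++ t;
  es_uniq : forall n, uniq (s n);
  es_full : forall i, exists n, i \in s n;
  es_wspace : forall i, wspace (Phi i);
  es_C : forall i, C (Phi i);
  es_weak : forall i F, wspace F -> C F ->
    energy (Phi i) F = lam i * graph_ip len (Phi i).1 F.1;
  es_orth : forall i j, graph_ip len (Phi i).1 (Phi j).1 = (i == j)%:R;
  es_complete : forall f : E -> R -> R, (forall e, edge_L2 (len e) (f e)) ->
    (forall i, graph_ip len f (Phi i).1 = 0) ->
    forall e, {ae mu, forall x, in_edge (len e) x -> f e x = 0} }.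

Section eigensystem_theory.
Context {C : fpair -> Prop} {I : choiceType} {s : nat -> seq I} {lam : I -> R}
  {Phi : I -> fpair} (es : eigensystem C I s lam Phi).

Lemma eigenvalue_gt0 i : 0 < lam i.
Proof.
have H := es_wspace _ _ _ _ _ es i.
have := energy_ge_ip _ H; rewrite (es_weak _ _ _ _ _ es)//; last exact: (es_C _ _ _ _ _ es).
by rewrite (es_orth _ _ _ _ _ es) eqxx !mulr1; exact: lt_le_trans.
Qed.

Lemma energy_eigen i j : energy (Phi i) (Phi j) = lam i * (i == j)%:R.
Proof.
rewrite (es_weak _ _ _ _ _ es) ?(es_orth _ _ _ _ _ es)//.
- exact: (es_wspace _ _ _ _ _ es).
- exact: (es_C _ _ _ _ _ es).
Qed.

Let HPhi := es_wspace _ _ _ _ _ es.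

Lemma sum_delta (l : seq I) (c : I -> R) i : uniq l -> i \in l ->
  \sum_(j <- l) c j * (j == i)%:R = c i.
Proof.
move=> ul il; rewrite (bigD1_seq i)//= eqxx mulr1 big1 ?addr0// => j /negbTE ->.
by rewrite mulr0.
Qed.

Lemma energy_wsum_eigen n c :
  energy (wsum (s n) c Phi) (wsum (s n) c Phi) = psum s (fun i => lam i * c i ^+ 2) n.
Proof.
rewrite energy_sum//; last exact: wspace_sum.
rewrite /psum !big_seq; apply: eq_bigr => i is_.
rewrite energyC energy_sum//.
under eq_bigr do rewrite energy_eigen mulrA.
by rewrite (sum_delta _ (fun j => c j * lam j))//; [ring | exact: (es_uniq _ _ _ _ _ es)].
Qed.

Definition eigcoef F i : R := graph_ip len F.1 (Phi i).1.

(** The energy of [F - Fn] is nonnegative, and by the weak identity the cross term equals the energy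
    of the truncation [Fn]. *)
Lemma eigcoef_bessel F n : wspace F -> C F ->
  psum s (fun i => lam i * eigcoef F i ^+ 2) n <= energy F F.
Proof.
move=> HF CF; set Fn := wsum (s n) (eigcoef F) Phi.
have HFn : wspace Fn by exact: wspace_sum.
have := energy_ge0 _ (wspace_lin (-1) _ _ HFn HF).
rewrite energy_wlin_sqr// energy_wsum_eigen.
have -> : energy Fn F = psum s (fun i => lam i * eigcoef F i ^+ 2) n.
  rewrite energy_sum//; apply: eq_bigr => i _.
  by rewrite (es_weak _ _ _ _ _ es)// graph_ipC -/(eigcoef F i); ring.
by rewrite sqrrN expr1n => h; lra.
Qed.

Hypothesis summ : forall e x, in_edge (len e) x ->
  l2seq s (fun i => (Num.sqrt (lam i))^-1 * (Phi i).1 e x).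

Let sqrt_gt0 i : 0 < Num.sqrt (lam i).
Proof. by rewrite sqrtr_gt0; exact: eigenvalue_gt0. Qed.

Let sqr_sqrt i : Num.sqrt (lam i) ^+ 2 = lam i.
Proof. by rewrite sqr_sqrtr// ltW// eigenvalue_gt0. Qed.

(** Bessel's inequality and [summ] write the series at each point as an inner product of two
    square-summable families, so it converges to some [h]. Uniform Hoelder bounds pass to [h], its
    coefficients are those of [F], and completeness gives [h = F] almost everywhere; Hoelder
    continuity makes this hold at every point. *)
Lemma eigen_expansion F e x : wspace F -> C F -> in_edge (len e) x ->
  (wsum (s n) (eigcoef F) Phi).1 e x @[n --> \oo] --> F.1 e x.
Proof.
move=> HF CF; have incr := es_incr _ _ _ _ _ es.
pose c := eigcoef F; pose Fn n := wsum (s n) c Phi.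
have HFn n : wspace (Fn n) by exact: wspace_sum.
have lc : l2seq s (fun i => Num.sqrt (lam i) * c i).
  apply: (cvg_psum_bounded _ incr _ (energy F F)) => [i|n]; first exact: sqr_ge0.
  apply: le_trans (eigcoef_bessel F n HF CF).
  by apply: ler_sum => i _; rewrite exprMn sqr_sqrt.
pose h (e : E) (x : R) := l2ip s (fun i => Num.sqrt (lam i) * c i)
  (fun i => (Num.sqrt (lam i))^-1 * (Phi i).1 e x).
have ch e' y : in_edge (len e') y -> (Fn n).1 e' y @[n --> \oo] --> h e' y.
  move=> ey; have := cvg_l2ip _ incr _ _ lc (summ _ _ ey).
  apply: eq_cvgn => n; apply: eq_bigr => i _.
  by rewrite mulrACA mulfV ?mul1r// gt_eqF.
pose K := energy F F / a0.
have hold n e' y z : in_edge (len e') y -> in_edge (len e') z ->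
    ((Fn n).1 e' y - (Fn n).1 e' z) ^+ 2 <= K * `|y - z|.
  move=> ey ez; apply: (le_trans (energy_holder _ _ _ _ (HFn n) ey ez)).
  rewrite ler_wpM2r// ler_wpM2r ?invr_ge0 ?(ltW a0_pos)// energy_wsum_eigen.
  exact: eigcoef_bessel.
have hhold e' y z : in_edge (len e') y -> in_edge (len e') z ->
    (h e' y - h e' z) ^+ 2 <= K * `|y - z|.
  move=> ey ez.
  have cv : ((Fn n).1 e' y - (Fn n).1 e' z) ^+ 2 @[n --> \oo] --> (h e' y - h e' z) ^+ 2.
    by rewrite expr2; under eq_fun do rewrite expr2; apply: cvgM;
      apply: cvgB; exact: ch.
  by apply: (limr_le_cvg _ _ _ cv); apply: nearW => n; exact: hold.
have K0 : 0 <= K by rewrite divr_ge0 ?energy_ge0// ltW.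
have e0 e' : in_edge (len e') 0 by rewrite /in_edge lexx len0.
have bnd e' : exists M, forall n y, in_edge (len e') y -> `|(Fn n).1 e' y| <= M.
  have [M M0 hM] : exists2 M, 0 <= M & forall n, `|(Fn n).1 e' 0| <= M.
    have cb : cvgn (fun n => (Fn n).1 e' 0).
      by apply/cvg_ex; exists (h e' 0); exact: ch.
    have [M [_ hM]] := cvg_seq_bounded cb.
    exists (`|M| + 1); first by rewrite addr_ge0.
    move=> n; apply: hM => //; by rewrite (le_lt_trans (ler_norm M))// ltrDl.
  exists (M + (1 + K * len e')) => n y ey.
  rewrite -(subrK ((Fn n).1 e' 0) ((Fn n).1 e' y)) addrC.
  apply: le_trans (ler_normD _ _) _; apply: lerD => //.
  have := hold n e' y 0 ey (e0 e'); rewrite subr0 -(real_normK (num_real _)).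
  set w := `|_ - _|; have /andP[y0 yl] := ey; rewrite (ger0_norm y0).
  have : K * y <= K * len e' by rewrite ler_wpM2l.
  have := sqr_ge0 (w - 2^-1); lra.
have mh e' : measurable_fun `[0, len e'] (h e').
  apply: (measurable_fun_cvg (h := fun n => (Fn n).1 e')).
    by move=> n; case: (wspace_bmeas (Fn n) e' (HFn n)) => -[].
  by move=> y; rewrite /= in_itv/=; exact: ch.
have bh e' : bmeas `[0, len e'] (h e').
  split=> //; have [M hM] := bnd e'; exists M => y; rewrite /= in_itv/= => ey.
  have cn : `|(Fn n).1 e' y| @[n --> \oo] --> `|h e' y| by apply: cvg_norm; exact: ch.
  by apply: (limr_le_cvg _ _ _ cn); apply: nearW => n; exact: hM.
have bF1 e' : bmeas `[0, len e'] (F.1 e') by case: (wspace_bmeas F e' HF).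
(* The coefficients of the truncations converge to those of [h] by dominated convergence, and they
   equal [c i] as soon as [i] belongs to the list [s n]. *)
have ipk i : graph_ip len (fun e x => (-1) * F.1 e x + h e x) (Phi i).1 = 0.
  have bPhi e' : bmeas `[0, len e'] ((Phi i).1 e').
    by case: (wspace_bmeas (Phi i) e' (HPhi i)).
  rewrite graph_ip_linear//.
  suff -> : graph_ip len h (Phi i).1 = c i by rewrite mulN1r addNr.
  have c1 : graph_ip len (Fn n).1 (Phi i).1 @[n --> \oo] --> graph_ip len h (Phi i).1.
    rewrite /graph_ip; apply: cvg_sum_fin => e' _.
    have [M hM] := bnd e'; have [_ [M' hM']] := bPhi e'.
    apply: (Rintegral_dominated_cvg mu `[0, len e'] _ _ (fun=> M * `|M'|)) => //.
    - move=> n; apply: measurable_funM; last by case: (bPhi e').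
      by case: (wspace_bmeas (Fn n) e' (HFn n)) => -[].
    - by apply: (edge_integrable (len e')) => //; exact: bmeas_cst.
    - move=> y; rewrite /= in_itv/= => ey; apply: cvgMl; exact: ch.
    - move=> n y; rewrite /= => ey; rewrite normrM; apply: ler_pM => //.
        by apply: hM; move: ey; rewrite in_itv.
      by apply: le_trans (ler_norm _); exact: hM'.
  have c2 : graph_ip len (Fn n).1 (Phi i).1 @[n --> \oo] --> c i.
    have [N iN] := es_full _ _ _ _ _ es i.
    apply: cvg_near_cst; exists N => // n /= Nn.
    have iN' : i \in s n.
      elim: n Nn => [|n IH]; first by rewrite leqn0 => /eqP N0; rewrite N0 in iN.
      rewrite leq_eqVlt => /predU1P[NE|]; first by rewrite -NE.
      rewrite ltnS => /IH isn; have [t st] := incr n.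
      by rewrite st mem_cat isn.
    rewrite graph_ip_sum//; under eq_bigr do rewrite (es_orth _ _ _ _ _ es).
    by rewrite sum_delta//; exact: (es_uniq _ _ _ _ _ es).
  exact: cvg_unique c1 c2.
move=> ex.
have L2 e' : edge_L2 (len e') (fun x => (-1) * F.1 e' x + h e' x).
  have bg : bmeas `[0, len e'] (fun x => (-1) * F.1 e' x + h e' x).
    by apply: bmeasD => //; exact: bmeasZ.
  split; first by case: bg.
  by apply: (edge_integrable (len e') (fun x => ((-1) * F.1 e' x + h e' x) ^+ 2)) => //;
    exact: bmeasX.
have ae0 := es_complete _ _ _ _ _ es _ L2 ipk e.
have gh y z : in_edge (len e) y -> in_edge (len e) z ->
    ((-1 * F.1 e y + h e y) - (-1 * F.1 e z + h e z)) ^+ 2 <= 4 * K * `|y - z|.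
  move=> ey ez; have h1 := hhold e y z ey ez; have h2 := energy_holder F e y z HF ey ez.
  rewrite -/K in h2.
  have := sqr_ge0 ((h e y - h e z) + (F.1 e y - F.1 e z)); nra.
have := holder_ae_eq0 (len e) _ _ (len_pos e) gh ae0 x ex.
move=> /eqP; rewrite mulN1r addrC subr_eq0 => /eqP <-.
exact: ch.
Qed.

(** The upper bound for the dual norm: Cauchy-Schwarz on the truncated expansion, with weights
    [sqrt (lam i)] shifted from the functional to the coefficients of [F]. *)
Lemma pteval_sqr_le L F v : pts_in_edges L -> wspace F -> C F ->
  (forall n, psum s (fun i => (lam i)^-1 * pteval L (Phi i).1 ^+ 2) n <= v) ->
  pteval L F.1 ^+ 2 <= energy F F * v.
Proof.
move=> pL HF CF hv.
have c1 := cvg_pteval L (fun n => (wsum (s n) (eigcoef F) Phi).1) F.1 pL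
  (fun e x ex => eigen_expansion F e x HF CF ex).
have c2 : pteval L (wsum (s n) (eigcoef F) Phi).1 ^+ 2 @[n --> \oo] --> pteval L F.1 ^+ 2.
  by rewrite expr2; under eq_fun do rewrite expr2; exact: cvgM.
apply: (limr_le_cvg _ _ _ c2); apply: nearW => n.
have -> : pteval L (wsum (s n) (eigcoef F) Phi).1 =
    \sum_(i <- s n) (Num.sqrt (lam i) * eigcoef F i) *
      ((Num.sqrt (lam i))^-1 * pteval L (Phi i).1).
  rewrite pteval_sum; apply: eq_bigr => i _.
  by rewrite mulrACA mulfV ?mul1r// gt_eqF.
apply: (le_trans (sum_cauchy_schwarz _ _ _ _)); apply: ler_pM.
- by apply: sumr_ge0 => i _; exact: sqr_ge0.
- by apply: sumr_ge0 => i _; exact: sqr_ge0.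
- apply: le_trans (eigcoef_bessel F n HF CF).
  by apply: ler_sum => i _; rewrite exprMn sqr_sqrt.
- apply: le_trans (hv n).
  by apply: ler_sum => i _; rewrite exprMn exprVn sqr_sqrt.
Qed.

End eigensystem_theory.

(** * Endpoint corrections and the comparison of variances *)

Definition endval F (c : E * bool) : R := F.1 c.1 (endpos len c).

Definition vcont (V : finType) (src tgt : E -> V) F := forall c c' : E * bool,
  endv src tgt c = endv src tgt c' -> endval F c = endval F c'.

(** Indexed by edge ends and not by vertices: such a function adjusts the value at a single end
    without affecting any other, and so repairs jumps, self-loops included. *)
Definition hat (c : E * bool) : fpair :=
  (fun e x => if e == c.1 then (if c.2 then x / len e else 1 - x / len e) else 0,
   fun e x => if e == c.1 then (if c.2 then (len e)^-1 else - (len e)^-1) else 0).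

Lemma wspace_hat c : wspace (hat c).
Proof.
move=> e; split.
  by rewrite /hat /=; case: (e == c.1); case: c.2; exact: bmeas_cst.
move=> x /andP[x0 xl]; rewrite /hat /=.
have mx : fine (mu `[0, x]) = x.
  rewrite lebesgue_measure_itv/= lte_fin; case: ltP => h /=; first by rewrite subr0.
  by apply/eqP; rewrite eq_le x0 h.
by case: (e == c.1); case: c.2; rewrite Rintegral_cst//= ?mx; ring.
Qed.

Lemma endval_hat c c' : endval (hat c) c' = (c == c')%:R.
Proof.
case: c c' => [e b] [e' b']; rewrite /endval /hat /endpos /= xpair_eqE (eq_sym e' e).
case: eqP => [_|//] /=.
by case: b; case: b' => /=; rewrite ?mul0r ?divff ?subrr ?subr0// gt_eqF.
Qed.

Lemma endval_wsum (J : Type) (s : seq J) c (Phi : J -> fpair) b :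
  endval (wsum s c Phi) b = \sum_(i <- s) c i * endval (Phi i) b.
Proof. by []. Qed.

(** Truncation of the Riesz representer of [pteval L] for the energy form. Its energy and its value
    under [pteval L] are the same partial sum, so it attains the dual norm in the limit. *)
Definition testfun (I : Type) (s : nat -> seq I) (lam : I -> R) (Phi : I -> fpair) L n :=
  wsum (s n) (fun i => (lam i)^-1 * pteval L (Phi i).1) Phi.

Section testfun_theory.
Context {C : fpair -> Prop} {I : choiceType} {s : nat -> seq I} {lam : I -> R}
  {Phi : I -> fpair} (es : eigensystem C I s lam Phi).

Lemma pteval_testfun L n : pteval L (testfun I s lam Phi L n).1 =
  psum s (fun i => (lam i)^-1 * pteval L (Phi i).1 ^+ 2) n.
Proof. by rewrite pteval_sum; apply: eq_bigr => i _; ring. Qed.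

Lemma energy_testfun L n :
  energy (testfun I s lam Phi L n) (testfun I s lam Phi L n) =
  psum s (fun i => (lam i)^-1 * pteval L (Phi i).1 ^+ 2) n.
Proof.
rewrite (energy_wsum_eigen es); apply: eq_bigr => i _.
by field; rewrite gt_eqF// (eigenvalue_gt0 es).
Qed.

Lemma wspace_testfun L n : wspace (testfun I s lam Phi L n).
Proof. by apply: wspace_sum; exact: (es_wspace _ _ _ _ _ es). Qed.

Lemma psum_pteval_ge0 L i : 0 <= (lam i)^-1 * pteval L (Phi i).1 ^+ 2.
Proof. by rewrite mulr_ge0 ?sqr_ge0// invr_ge0 ltW// (eigenvalue_gt0 es). Qed.

Lemma psum_pteval_le L v n :
  psum s (fun i => (lam i)^-1 * pteval L (Phi i).1 ^+ 2) m @[m --> \oo] --> v ->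
  psum s (fun i => (lam i)^-1 * pteval L (Phi i).1 ^+ 2) n <= v.
Proof.
move=> cv; rewrite -(cvg_lim _ cv)//.
apply: (psum_le_lim _ (es_incr _ _ _ _ _ es)); first exact: psum_pteval_ge0.
by apply/cvg_ex; exists v.
Qed.

End testfun_theory.

Lemma vcont_sum (V : finType) (src tgt : E -> V) (J : Type) (s : seq J) c
    (Phi : J -> fpair) :
  (forall i, vcont V src tgt (Phi i)) -> vcont V src tgt (wsum s c Phi).
Proof.
move=> vPhi b b' bb'; rewrite !endval_wsum; apply: eq_bigr => i _.
by rewrite (vPhi i b b' bb').
Qed.

(* Both limits are the squared dual norm of the same functional for the energy norm. *)
Lemma pteval_variance_eq (V : finType) (src tgt : E -> V)
    (I1 I2 : choiceType) (s1 : nat -> seq I1) (s2 : nat -> seq I2)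
    (lam1 : I1 -> R) (lam2 : I2 -> R) (Phi1 : I1 -> fpair) (Phi2 : I2 -> fpair)
    (L1 L2 : seq (R * (E * R))) (v1 v2 : R) :
  eigensystem (fun=> True) I1 s1 lam1 Phi1 ->
  eigensystem (vcont V src tgt) I2 s2 lam2 Phi2 ->
  (forall e x, in_edge (len e) x ->
     l2seq s1 (fun i => (Num.sqrt (lam1 i))^-1 * (Phi1 i).1 e x)) ->
  (forall e x, in_edge (len e) x ->
     l2seq s2 (fun i => (Num.sqrt (lam2 i))^-1 * (Phi2 i).1 e x)) ->
  pts_in_edges L1 -> pts_in_edges L2 ->
  (forall F, wspace F -> vcont V src tgt F -> pteval L1 F.1 = pteval L2 F.1) ->
  (forall c c', endv src tgt c = endv src tgt c' ->
     psum s1 (fun i => (lam1 i)^-1 * pteval L1 (Phi1 i).1 *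
       (endval (Phi1 i) c - endval (Phi1 i) c')) n @[n --> \oo] --> (0 : R)) ->
  psum s1 (fun i => (lam1 i)^-1 * pteval L1 (Phi1 i).1 ^+ 2) n @[n --> \oo] --> v1 ->
  psum s2 (fun i => (lam2 i)^-1 * pteval L2 (Phi2 i).1 ^+ 2) n @[n --> \oo] --> v2 ->
  v1 = v2.
Proof.
move=> es1 es2 summ1 summ2 pL1 pL2 LE jump cv1 cv2.
have le1 n := psum_pteval_le es1 L1 v1 n cv1.
have le2 n := psum_pteval_le es2 L2 v2 n cv2.
have v1_ge0 : 0 <= v1.
  by apply: le_trans (le1 0%N); apply: psum_ge0; exact: (psum_pteval_ge0 es1).
have v2_ge0 : 0 <= v2.
  by apply: le_trans (le2 0%N); apply: psum_ge0; exact: (psum_pteval_ge0 es2).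
apply/eqP; rewrite eq_le; apply/andP; split; last first.
  (* Here [v2 <= v1]: the graph test function is continuous at vertices, so both functionals agree
     on it and it may be tested against the edge system. This gives [S^2 <= S v1] for its energy
     [S]. *)
  apply: (limr_le_cvg _ _ _ cv2); apply: nearW => n.
  pose F := testfun I2 s2 lam2 Phi2 L2 n.
  have HF : wspace F by exact: (wspace_testfun es2).
  have vF : vcont V src tgt F by apply: vcont_sum; exact: (es_C _ _ _ _ _ es2).
  have := pteval_sqr_le es1 summ1 L1 F v1 pL1 HF I le1.
  rewrite LE// pteval_testfun (energy_testfun es2).
  set S := psum _ _ _; have S0 : 0 <= S.
    by apply: psum_ge0; exact: (psum_pteval_ge0 es2).
  rewrite expr2; have [->//|Sn0] := eqVneq S 0.
  by rewrite ler_pM2l// lt_neqAle eq_sym Sn0.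
(* One end is selected at each vertex as a reference. Subtracting the jumps relative to it makes all
   ends at the vertex take the reference value. *)
pose rep (c : E * bool) := odflt c [pick c' | endv src tgt c' == endv src tgt c].
have repE c : endv src tgt (rep c) = endv src tgt c.
  by rewrite /rep; case: pickP => [c' /eqP//|].
have rep_eq c c' : endv src tgt c = endv src tgt c' -> rep c = rep c'.
  move=> cc'; rewrite /rep cc'; case: pickP => [//|/(_ c')]; by rewrite eqxx.
pose f n := testfun I1 s1 lam1 Phi1 L1 n.
have Hf n : wspace (f n) by exact: (wspace_testfun es1).
pose j n c := endval (f n) c - endval (f n) (rep c).
have cj c : j n c @[n --> \oo] --> (0 : R).
  have := jump c (rep c) (esym (repE c)); apply: eq_cvgn => n.
  rewrite /j !endval_wsum -sumrB; apply: eq_bigr => i _; ring.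
pose g n := wsum (index_enum _) (j n) hat.
have Hg n : wspace (g n) by apply: wspace_sum => c; exact: wspace_hat.
have gE n c : endval (g n) c = j n c.
  rewrite endval_wsum (bigD1 c)// endval_hat eqxx mulr1 big1 => [|c' cc'].
    exact: addr0.
  by rewrite endval_hat (negbTE cc') mulr0.
pose h n := wlin (-1) (g n) (f n).
have Hh n : wspace (h n) by exact: wspace_lin.
have hv n : vcont V src tgt (h n).
  have hE c : endval (h n) c = endval (f n) (rep c).
    have -> : endval (h n) c = -1 * endval (g n) c + endval (f n) c by [].
    by rewrite gE /j; ring.
  by move=> c c' cc'; rewrite !hE (rep_eq c c').
have cj0 (w : nat -> E * bool -> R) (w0 : E * bool -> R) :
    (forall c, w n c @[n --> \oo] --> w0 c) -> \sum_c j n c * w n c @[n --> \oo] --> (0 : R).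
  move=> cw; have c0 : \sum_c j n c * w n c @[n --> \oo] --> \sum_c 0 * w0 c.
    by apply: cvg_sum_fin => c _; exact: cvgM.
  by rewrite [X in _ --> X]big1 in c0 => // c _; rewrite mul0r.
have cLg : pteval L1 (g n).1 @[n --> \oo] --> (0 : R).
  apply: eq_cvgn (cj0 (fun _ c => pteval L1 (hat c).1) (fun c => pteval L1 (hat c).1) _) => [n|c].
    by rewrite pteval_sum.
  exact: cvg_cst.
have ceg : energy (g n) (g n) @[n --> \oo] --> (0 : R).
  apply: eq_cvgn (cj0 (fun n c => \sum_c' j n c' * energy (hat c') (hat c)) (fun=> 0) _) => [n|c].
    rewrite energy_sum//; last by move=> c; exact: wspace_hat.
    apply: eq_bigr => c _; congr (_ * _); rewrite energyC energy_sum//.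
      by move=> c'; exact: wspace_hat.
    exact: wspace_hat.
  apply: (cj0 (fun _ c' => energy (hat c') (hat c)) (fun c' => energy (hat c') (hat c))) => c'.
  exact: cvg_cst.
have cLh : pteval L2 (h n).1 ^+ 2 @[n --> \oo] --> v1 ^+ 2.
  have c1 : pteval L2 (h n).1 @[n --> \oo] --> v1.
    have c0 : psum s1 (fun i => (lam1 i)^-1 * pteval L1 (Phi1 i).1 ^+ 2) n -
        pteval L1 (g n).1 @[n --> \oo] --> v1 - 0 by exact: cvgB.
    rewrite subr0 in c0; apply: eq_cvgn c0 => n.
    rewrite -LE// pteval_lin pteval_testfun; ring.
  by rewrite expr2; under eq_fun do rewrite expr2; exact: cvgM.
(* Young's inequality bounds the energy of [f - g] by [(1 + dl)] times that of [f] plus [(1 + 1/dl)]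
   times that of [g]. The latter tends to 0, so no limit of the cross term is needed. *)
have key dl : 0 < dl -> v1 ^+ 2 <= (1 + dl) * v1 * v2.
  move=> dl0.
  have cB : ((1 + dl) * psum s1 (fun i => (lam1 i)^-1 * pteval L1 (Phi1 i).1 ^+ 2) n +
      (1 + dl^-1) * energy (g n) (g n)) * v2 - pteval L2 (h n).1 ^+ 2 @[n --> \oo] -->
      ((1 + dl) * v1 + (1 + dl^-1) * 0) * v2 - v1 ^+ 2.
    apply: cvgB => //; apply: cvgMl; apply: cvgD; exact: cvgMr.
  rewrite mulr0 addr0 in cB; rewrite -subr_ge0.
  suff : \forall n \near \oo, 0 <= ((1 + dl) * psum s1 (fun i => (lam1 i)^-1 *
      pteval L1 (Phi1 i).1 ^+ 2) n + (1 + dl^-1) * energy (g n) (g n)) * v2 -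
      pteval L2 (h n).1 ^+ 2.
    by move=> hn; rewrite -(cvg_lim _ cB)//; apply: limr_ge => //; apply/cvg_ex; eexists; exact: cB.
  apply: nearW => n; rewrite subr_ge0.
  apply: (le_trans (pteval_sqr_le es2 summ2 L2 (h n) v2 pL2 (Hh n) (hv n) le2)).
  rewrite ler_wpM2r// energy_wlin_sqr// -(energy_testfun es1) -/(f n).
  have := energy_ge0 _ (wspace_lin dl^-1 _ _ (Hg n) (Hf n)).
  rewrite energy_wlin_sqr//; set A := energy (g n) (g n); set B := energy (g n) (f n).
  set D := energy (f n) (f n) => h0.
  have : 0 <= dl * (dl^-1 ^+ 2 * A + 2 * dl^-1 * B + D) by rewrite mulr_ge0// ltW.
  have -> : dl * (dl^-1 ^+ 2 * A + 2 * dl^-1 * B + D) = dl^-1 * A + 2 * B + dl * D.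
    by field; rewrite gt_eqF.
  by rewrite sqrrN expr1n; lra.
have [->//|v1n0] := eqVneq v1 0.
have v1_gt0 : 0 < v1 by rewrite lt_neqAle eq_sym v1n0.
apply/ler_addgt0Pr => eps eps0.
(* After cancelling one factor [v1], the excess over [v2] is [dl v2], which this choice of [dl]
   keeps below [eps], also when [v2] is 0. *)
have d0 : 0 < eps / (v2 + 1) by rewrite divr_gt0// ltr_wpDl.
have := key _ d0; rewrite expr2 mulrAC [leRHS]mulrC ler_pM2l// => hk.
apply: (le_trans hk); rewrite mulrDl mul1r lerD2l.
rewrite mulrAC ler_pdivrMr ?ltr_wpDl// ler_pM2l// lerDl//.
Qed.

End energy_space.

(** * Eigenbases as eigensystems of the energy form *)

Section edge_operator.
Context {R : realType}.
Local Notation mu := (@lebesgue_measure R).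

(** The flux [a f'] is a constant plus the integral of an integrable function, hence bounded;
    dividing by [a >= a0] bounds [f'], and so [f]. Only then may [k^2] be exchanged for the bounded
    [q], equal to it almost everywhere, with a bounded derivative of the flux as a result. *)
Lemma edge_L_prim (l : R) (k a q f df : R -> R) (lam a0 : R) : 0 <= l -> 0 < a0 ->
  (forall x, in_edge l x -> a0 <= a x) -> bmeas `[0, l] a -> bmeas `[0, l] q ->
  {ae mu, forall x, in_edge l x -> q x = k x ^+ 2} ->
  edge_L l k a f (fun x => lam * f x) df ->
  prim l f df /\ prim l (fun x => a x * df x) (fun x => q x * f x - lam * f x).
Proof.
move=> l0 a0_gt0 a_lb ba bq qk [_ [_ [idf [iB [fE aE]]]]].
pose B x := k x ^+ 2 * f x - lam * f x.
pose J := Rintegral mu `[0, l] (fun x => `|B x|).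
have mdf : measurable_fun `[0, l] df by apply/measurable_EFinP; exact: measurable_int idf.
have mB : measurable_fun `[0, l] B by apply/measurable_EFinP; exact: measurable_int iB.
have sub x : in_edge l x -> `[0, x] `<=` `[0, l].
  move=> /andP[x0 xl] y /=; rewrite !in_itv/= => /andP[-> yx]; exact: le_trans yx xl.
have bdf : bmeas `[0, l] df.
  split=> //; exists ((`|a 0 * df 0| + J) / a0) => x; rewrite /= in_itv/= => ex.
  have ax := a_lb x ex; have ax0 := lt_le_trans a0_gt0 ax.
  rewrite ler_pdivlMr//; apply: (@le_trans _ _ `|a x * df x|).
    by rewrite normrM mulrC (ger0_norm (ltW ax0)) ler_wpM2r.
  rewrite (aE x ex); apply: le_trans (ler_normD _ _) _; rewrite lerD2l.
  have iBx : mu.-integrable `[0, x] (EFin \o B) by apply: integrableS iB => //; exact: sub.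
  apply: (le_trans (le_normr_Rintegral _ iBx)) => //.
  have inB := integrable_norm iB; have inBx := integrable_norm iBx.
  rewrite /J /Rintegral fine_le//; [exact: integrable_fin_num|exact: integrable_fin_num|].
  apply: ge0_subset_integral => //; last exact: sub.
  by apply/measurable_EFinP; exact: measurableT_comp.
have pf : prim l f df by split.
split=> //; have bf := prim_bmeas _ _ _ l0 pf.
have bB : bmeas `[0, l] (fun x => q x * f x - lam * f x).
  by apply: bmeasB; [exact: bmeasM | exact: bmeasZ].
split=> // x ex; rewrite (aE x ex); congr (_ + fine _).
have m1 : measurable_fun `[0, x] (EFin \o B).
  by apply/measurable_EFinP; apply: measurable_funS mB => //; exact: sub.
have m2 : measurable_fun `[0, x] (EFin \o (fun x => q x * f x - lam * f x)).
  by apply/measurable_EFinP; case: bB => mB' _; apply: measurable_funS mB' => //; exact: sub.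
apply: ae_eq_integral => //.
apply: (@filterS _ _ (ae_filter_ringOfSetsType mu)) qk => y qky yx; rewrite /= /B qky//.
by have := sub x ex y yx; rewrite /= in_itv.
Qed.

Lemma edge_weak_form (l : R) (a q f df F dF : R -> R) (lam : R) : 0 <= l ->
  bmeas `[0, l] a -> bmeas `[0, l] q ->
  prim l f df -> prim l (fun x => a x * df x) (fun x => q x * f x - lam * f x) ->
  prim l F dF ->
  Rintegral mu `[0, l] (fun x => a x * df x * dF x + q x * f x * F x) =
  lam * edge_ip l f F + (a l * df l * F l - a 0 * df 0 * F 0).
Proof.
move=> l0 ba bq pf pA pF; have bf := prim_bmeas _ _ _ l0 pf.
have bF := prim_bmeas _ _ _ l0 pF; have [bdf _] := pf; have [bdF _] := pF.
rewrite -(edge_integration_by_parts _ _ _ _ _ l0 pA pF) /edge_ip.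
rewrite -integrable_Rintegral_linear//.
- by apply: eq_Rintegral => x _; ring.
- by apply: (edge_integrable l) => //; exact: bmeasM.
- apply: (edge_integrable l (fun x => a x * df x * dF x + (q x * f x - lam * f x) * F x)) => //.
  apply: bmeasD; apply: bmeasM => //; first exact: bmeasM.
  by apply: bmeasB; [exact: bmeasM | exact: bmeasZ].
Qed.

Lemma clamped_bmeas (l : R) (k : R -> R) (k0 kM : R) : measurable_fun `[0, l] k ->
  bmeas `[0, l] (fun x => Num.max k0 (Num.min (k x) kM) ^+ 2).
Proof.
move=> mk; apply: bmeasX; split.
  by apply: measurable_maxr => //; exact: measurable_minr.
exists (`|k0| + `|kM|) => x _.
have h1 := ler_norm k0; have h2 := ler_norm (- k0); have h3 := ler_norm kM.
have h4 := ler_norm (- kM); rewrite !normrN in h2 h4.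
have h5 := normr_ge0 k0; have h6 := normr_ge0 kM.
rewrite maxEle minEle ler_norml.
by do !case: ifPn; rewrite -?ltNge => *; apply/andP; split; lra.
Qed.

Lemma clamped_ge (k0 kM z : R) : 0 < k0 -> k0 ^+ 2 <= Num.max k0 (Num.min z kM) ^+ 2.
Proof.
move=> k0_gt0; rewrite ler_sqr ?nnegrE ?le_max ?lexx ?(ltW k0_gt0)//.
Qed.

Lemma clamped_ae (l : R) (k : R -> R) (k0 kM : R) :
  {ae mu, forall x, in_edge l x -> `|k x| <= kM} ->
  {ae mu, forall x, in_edge l x -> k0 <= k x} ->
  {ae mu, forall x, in_edge l x -> Num.max k0 (Num.min (k x) kM) ^+ 2 = k x ^+ 2}.
Proof.
move=> h1 h2; apply: (@filterS2 _ _ (ae_filter_ringOfSetsType mu)) h1 h2 => x h1 h2 ex; congr (_ ^+ 2).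
rewrite (min_idPl (le_trans (ler_norm _) (h1 ex))); apply/max_idPr; exact: h2.
Qed.

End edge_operator.

(** * The graph and the decoupled edges as eigensystems *)

Section graph_eigensystems.
Context {R : realType} {V E : finType}.
Variables (src tgt : E -> V) (len : E -> R) (k a q : E -> R -> R) (a0 : R).
Hypothesis len_pos : forall e, 0 < len e.
Hypothesis ba : forall e, bmeas `[0, len e] (a e).
Hypothesis bq : forall e, bmeas `[0, len e] (q e).
Hypothesis a0_pos : 0 < a0.
Hypothesis a_lb : forall e x, in_edge (len e) x -> a0 <= a e x.
Hypothesis qk : forall e, {ae @lebesgue_measure R, forall x, in_edge (len e) x ->
  q e x = k e x ^+ 2}.
Local Notation mu := (@lebesgue_measure R).

Let len0 e : 0 <= len e. Proof. exact: ltW. Qed.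

Hypothesis a_cont : forall c c' : E * bool, endv src tgt c = endv src tgt c' ->
  a c.1 (endpos len c) = a c'.1 (endpos len c').

(** The boundary terms are regrouped by vertex, each being minus [a F] times the derivative pointing
    into the edge. At a vertex [a] and [F] have a single value, which factors out of the Kirchhoff
    sum. *)
Lemma kirchhoff_boundary_eq0 (df F : E -> R -> R) :
  (forall c c', endv src tgt c = endv src tgt c' ->
     F c.1 (endpos len c) = F c'.1 (endpos len c')) ->
  (forall v : V, \sum_(c : E * bool | endv src tgt c == v)
           (if c.2 then - df c.1 (len c.1) else df c.1 0) = 0) ->
  \sum_e (a e (len e) * df e (len e) * F e (len e) - a e 0 * df e 0 * F e 0) = 0.
Proof.
move=> Fc kir.
pose inw (c : E * bool) := if c.2 then - df c.1 (len c.1) else df c.1 0.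
pose aF (c : E * bool) := a c.1 (endpos len c) * F c.1 (endpos len c).
transitivity (- \sum_(c : E * bool) aF c * inw c).
  rewrite -(pair_bigA _ (fun e b => aF (e, b) * inw (e, b)))/= -sumrN.
  by apply: eq_bigr => e _; rewrite big_bool /aF /inw /endpos /=; ring.
rewrite (partition_big (endv src tgt) xpredT)//= big1 ?oppr0// => v _.
case: (pickP (fun c => endv src tgt c == v)) => [c0 /eqP c0v|none]; last first.
  by apply: big1 => c; rewrite none.
rewrite (eq_bigr (fun c => aF c0 * inw c)); last first.
  move=> c /eqP cv; congr (_ * _).
  by rewrite /aF (a_cont c c0) ?(Fc c c0)// cv c0v.
by rewrite -mulr_sumr kir mulr0.
Qed.

Lemma eigensystem_of_graph (lam : nat -> R) (phi : nat -> E -> R -> R) :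
  graph_eigenbasis src tgt len k a lam phi ->
  exists dphi : nat -> E -> R -> R,
  eigensystem len a q (vcont len V src tgt) nat (iota 0) lam (fun n => (phi n, dphi n)).
Proof.
move=> [gL [orth compl]].
have [dphi hd] := choice gL.
have P1 n e := edge_L_prim _ _ _ _ _ _ _ _ (len0 e) a0_pos (a_lb e) (ba e) (bq e) (qk e)
  ((hd n).1 e).
exists dphi; split.
- by move=> n; exists [:: n]; rewrite -addn1 iotaD add0n.
- by move=> n; exact: iota_uniq.
- by move=> i; exists i.+1; rewrite mem_iota add0n leq0n ltnSn.
- by move=> n e; exact: (P1 n e).1.
- by move=> n c c' cc'; exact: (hd n).2.1.
- move=> n F HF vF; rewrite /energy.
  under eq_bigr => e _ do rewrite (edge_weak_form _ _ _ _ _ _ _ _ (len0 e) (ba e) (bq e)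
    (P1 n e).1 (P1 n e).2 (HF e)).
  rewrite big_split/= -mulr_sumr kirchhoff_boundary_eq0 ?addr0//; exact: (hd n).2.2.
- exact: orth.
- exact: compl.
Qed.

(** The mode number varies in the outer loop, so each list is a prefix of the next and adds one new
    mode on every edge. *)
Definition edge_seq (n : nat) : seq (E * nat) := [seq (e, j) | j <- iota 0 n, e <- enum E].

Lemma big_edge_seq (G : E * nat -> R) n :
  \sum_(p <- edge_seq n) G p = \sum_(j < n) \sum_e G (e, (j : nat)).
Proof.
rewrite /edge_seq big_allpairs_dep /=.
rewrite -(big_mkord xpredT (fun j => \sum_e G (e, j))) /index_iota subn0.
by apply: eq_bigr => j _; rewrite big_enum.
Qed.

Lemma edge_seq_uniq n : uniq (edge_seq n).
Proof.
apply: allpairs_uniq; [exact: iota_uniq | exact: enum_uniq |].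
by move=> [j e] [j' e'] _ _ /= [-> ->].
Qed.

Lemma edge_seq_incr n : exists t, edge_seq n.+1 = edge_seq n ++ t.
Proof.
exists [seq (e, n) | e <- enum E].
by rewrite /edge_seq -addn1 iotaD add0n allpairs_cat /= cats0.
Qed.

Definition edge_extend (phi : E -> nat -> R -> R) (p : E * nat) : E -> R -> R :=
  fun e x => if e == p.1 then phi p.1 p.2 x else 0.

Lemma sum_edge_extend (phi : E -> nat -> R -> R) (p : E * nat) (G : E -> R -> R -> R)
    (D : E -> (R -> R) -> R) :
  (forall e, D e (fun=> 0) = 0) ->
  \sum_e D e (edge_extend phi p e) = D p.1 (phi p.1 p.2).
Proof.
move=> D0; rewrite (bigD1 p.1)//= big1 ?addr0; last first.
  by move=> e /negbTE ep; rewrite -[RHS](D0 e); congr (D e _); apply/funext => x;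
    rewrite /edge_extend ep.
by congr (D _ _); apply/funext => x; rewrite /edge_extend eqxx.
Qed.

(** Eigenfunctions extended by zero from their edge form a basis of the disjoint union. Neumann
    conditions kill the boundary terms edge by edge, so test functions are subject to no vertex
    condition. *)
Lemma eigensystem_of_edges (lamE : E -> nat -> R) (phiE : E -> nat -> R -> R) :
  (forall e, edge_eigenbasis (len e) (k e) (a e) (lamE e) (phiE e)) ->
  exists dphi : E * nat -> E -> R -> R,
  eigensystem len a q (fun=> True) (E * nat)%type edge_seq
    (fun p => lamE p.1 p.2) (fun p => (edge_extend phiE p, dphi p)).
Proof.
move=> eig.
pose P (p : E * nat) (df : R -> R) := edge_L (len p.1) (k p.1) (a p.1) (phiE p.1 p.2)
  (fun t => lamE p.1 p.2 * phiE p.1 p.2 t) df /\ df 0 = 0 /\ df (len p.1) = 0.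
have ex p : exists df, P p df by exact: (eig p.1).1.
have [dphi0 hd] := choice ex.
pose dphi p := edge_extend (fun e n => dphi0 (e, n)) p.
have P1 p := edge_L_prim _ _ _ _ _ _ _ _ (len0 p.1) a0_pos (a_lb p.1) (ba p.1) (bq p.1)
  (qk p.1) (hd p).1.
exists dphi; split.
- exact: edge_seq_incr.
- exact: edge_seq_uniq.
- move=> [e j]; exists j.+1; apply/allpairsP; exists (j, e).
  by split; [rewrite mem_iota add0n leq0n ltnSn | rewrite mem_enum |].
- move=> p e; rewrite /= /dphi /edge_extend -surjective_pairing.
  have [->|ep] := eqVneq e p.1; first exact: (P1 p).1.
  split; first exact: bmeas_cst.
  by move=> x _; rewrite Rintegral_cst// mul0r addr0.
- by [].
- move=> p F HF _; rewrite /energy /graph_ip.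
  have -> : \sum_e edge_ip (len e) (edge_extend phiE p e) (F.1 e) =
      edge_ip (len p.1) (phiE p.1 p.2) (F.1 p.1).
    apply: (sum_edge_extend phiE p (fun _ _ => 0) (fun e f => edge_ip (len e) f (F.1 e))) => e.
    rewrite /edge_ip; under eq_Rintegral do rewrite mul0r.
    by rewrite Rintegral_cst// mul0r.
  rewrite (bigD1 p.1)//= big1 ?addr0; last first.
    move=> e /negbTE ep; transitivity (Rintegral mu `[0, len e] (fun=> 0)).
      by apply: eq_Rintegral => x _; rewrite /dphi /edge_extend ep; ring.
    by rewrite Rintegral_cst// mul0r.
  have [_ [d0 dl]] := hd p.
  transitivity (Rintegral mu `[0, len p.1] (fun x => a p.1 x * dphi0 p x * F.2 p.1 x +
      q p.1 x * phiE p.1 p.2 x * F.1 p.1 x)).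
    by apply: eq_Rintegral => x _; rewrite /dphi /edge_extend eqxx -surjective_pairing.
  rewrite (edge_weak_form _ _ _ _ _ _ _ _ (len0 p.1) (ba p.1) (bq p.1) (P1 p).1 (P1 p).2 (HF p.1)).
  by rewrite d0 dl; ring.
- move=> [e j] [e' j']; rewrite /= /graph_ip.
  have -> : \sum_e0 edge_ip (len e0) (edge_extend phiE (e, j) e0)
      (edge_extend phiE (e', j') e0) = edge_ip (len e) (phiE e j) (edge_extend phiE (e', j') e).
    apply: (sum_edge_extend phiE (e, j) (fun _ _ => 0)
      (fun e0 f => edge_ip (len e0) f (edge_extend phiE (e', j') e0))) => e0.
    rewrite /edge_ip; under eq_Rintegral do rewrite mul0r.
    by rewrite Rintegral_cst// mul0r.
  rewrite xpair_eqE /edge_extend /=; have [<-|ee'] := eqVneq e e'.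
    by rewrite (eig e).2.1.
  rewrite /edge_ip; under eq_Rintegral do rewrite mulr0.
  by rewrite Rintegral_cst// mul0r.
- move=> f L2 ip0 e; apply: (eig e).2.2 => // n.
  rewrite -[RHS](ip0 (e, n)) /graph_ip /=.
  under [RHS]eq_bigr do rewrite /edge_ip.
  have := sum_edge_extend phiE (e, n) (fun _ _ => 0) (fun e0 g => edge_ip (len e0) (f e0) g).
  rewrite /= => <- // e0; rewrite /edge_ip; under eq_Rintegral do rewrite mulr0.
  by rewrite Rintegral_cst// mul0r.
Qed.

End graph_eigensystems.

(** * The conditioned field *)

(** A linear form that vanishes on the kernel of a matrix is a combination of its rows; the columns
    of the cokernel matrix serve as test vectors. Applied to the jump between two ends at one
    vertex, it makes every jump a function of the conditioning variables. *)
Lemma row_span_of_kernel {R : realType} {C : finType} (m : nat) (K : 'I_m -> C -> R)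
    (dl : C -> R) :
  (forall x : C -> R, (forall i, \sum_c K i c * x c = 0) -> \sum_c dl c * x c = 0) ->
  exists b : 'I_m -> R, forall c, dl c = \sum_i b i * K i c.
Proof.
move=> ker; pose KM := \matrix_(i < m, j < #|C|) K i (enum_val j).
pose dv := \row_(j < #|C|) dl (enum_val j).
have : (dv <= KM)%MS.
  rewrite submxE; have := mulmx_coker KM; move: (cokermx KM) => W KW.
  apply/eqP/rowP => k; rewrite !mxE; pose x c := W (enum_rank c) k.
  have reidx (g : C -> R) : \sum_c g c * x c = \sum_(j < #|C|) g (enum_val j) * W j k.
    rewrite (reindex (@enum_val C predT)) /=; last exact: onW_bij (@enum_val_bij C).
    by apply: eq_bigr => j _; rewrite /x enum_valK.
  have kx i : \sum_c K i c * x c = 0.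
    rewrite reidx; have /matrixP/(_ i k) := KW; rewrite !mxE => h; rewrite -[RHS]h.
    by apply: eq_bigr => j _; rewrite !mxE.
  by rewrite -[RHS](ker x kx) reidx; apply: eq_bigr => j _; rewrite !mxE.
move=> /submxP[D DE]; exists (D ord0) => c.
have /rowP/(_ (enum_rank c)) := DE; rewrite !mxE enum_rankK => ->.
by apply: eq_bigr => i _; rewrite !mxE enum_rankK.
Qed.

Lemma ae_finite_forall {d} {T : measurableType d} {R : realType}
    (P : {measure set T -> \bar R}) {J : finType} (A : J -> T -> Prop) :
  (forall j, {ae P, forall x, A j x}) -> {ae P, forall x, forall j, A j x}.
Proof.
move=> hA.
have H (s : seq J) : {ae P, forall x, forall j, j \in s -> A j x}.
  elim: s => [|j s IH]; first by apply: aeW => x j; rewrite in_nil.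
  apply: filterS2 (hA j) IH => x h1 h2 i; rewrite inE => /predU1P[->//|]; exact: h2.
by apply: filterS (H (enum J)) => x h j; apply: h; rewrite mem_enum.
Qed.

Lemma ae_iff_measure_eq {d} {T : measurableType d} {R : realType}
    (P : {measure set T -> \bar R}) (A B : set T) : measurable A -> measurable B ->
  {ae P, forall x, A x <-> B x} -> P A = P B.
Proof.
move=> mA mB [N [mN N0 sN]].
have le (A' B' : set T) : measurable A' -> measurable B' -> A' `<=` B' `|` N ->
    (P A' <= P B')%E.
  move=> mA' mB' sub; apply: (@le_trans _ _ (P (B' `|` N))).
    by apply: le_measure; rewrite ?inE//; exact: measurableU.
  by apply: (le_trans (measureU2 P mB' mN)); rewrite [X in (_ + X)%E]N0 adde0.
apply/eqP; rewrite eq_le; apply/andP; split; apply: le => // x Ax.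
  have [[AB _]|nAB] := pselect (A x <-> B x); first by left; exact: AB.
  by right; exact: sN.
have [[_ BA]|nAB] := pselect (A x <-> B x); first by left; exact: BA.
by right; exact: sN.
Qed.

Lemma l2ip_sqr {R : realType} {I : eqType} (s : nat -> seq I)
    (s_incr : forall n, exists t, s n.+1 = s n ++ t) (t : R) (c e : I -> R) :
  l2seq s c -> l2seq s e ->
  l2ip s (fun i => t * c i + e i) (fun i => t * c i + e i) =
  t ^+ 2 * l2ip s c c + 2 * t * l2ip s c e + l2ip s e e.
Proof.
move=> lc le; have lz := l2seq_linear s s_incr t c e lc le.
have cz : l2ip s c (fun i => t * c i + e i) = t * l2ip s c c + l2ip s c e.
  by rewrite l2ipC (l2ip_linear _ s_incr)// (l2ipC _ e).
have ez : l2ip s e (fun i => t * c i + e i) = t * l2ip s c e + l2ip s e e.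
  by rewrite l2ipC (l2ip_linear _ s_incr).
rewrite (l2ip_linear s s_incr t c e (fun i => t * c i + e i))// cz ez; ring.
Qed.

Theorem mainTheorem15
  (R : realType)
  (* compact connected metric graph Gamma *)
  (V E : finType) (src tgt : E -> V) (len : E -> R)
  (len_pos : forall e, 0 < len e)
  (Gconn : forall v w : V, connect (gadj src tgt) v w)
  (* Assumption A1 *)
  (kappa a : E -> R -> R) (kappa0 kappaM a0 Lip : R)
  (kappa_meas : forall e, measurable_fun `[0, len e] (kappa e))
  (kappa_bnd : forall e, {ae lebesgue_measure, forall t,
                  in_edge (len e) t -> `|kappa e t| <= kappaM})
  (kappa0_pos : 0 < kappa0)
  (kappa_lb : forall e, {ae lebesgue_measure, forall t,
                  in_edge (len e) t -> kappa0 <= kappa e t})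
  (a_lip : forall e s t, in_edge (len e) s -> in_edge (len e) t ->
                  `|a e s - a e t| <= Lip * `|s - t|)
  (a_cont : forall c c' : E * bool, endv src tgt c = endv src tgt c' ->
                  a c.1 (endpos len c) = a c'.1 (endpos len c'))
  (a0_pos : 0 < a0)
  (a_lb : forall e t, in_edge (len e) t -> a0 <= a e t)
  (tau : R) (tau_pos : 0 < tau)
  (* independent single-edge Whittle-Matern fields (alpha = 1, Neumann) *)
  (d : measure_display) (Omega : measurableType d) (P : probability Omega R)
  (xi : E -> nat -> Omega -> R)
  (xi_iid : iid_std_normal P (fun p : E * nat => xi p.1 p.2))
  (lamE : E -> nat -> R) (phiE : E -> nat -> R -> R)
  (eigE : forall e, edge_eigenbasis (len e) (kappa e) (a e) (lamE e) (phiE e))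
  (ut : E -> R -> Omega -> R)
  (ut_WM : forall e, is_KL_field P tau (len e) (lamE e) (phiE e) (xi e) (ut e))
  (* the matrix K with 2|E| columns, indexed by edge ends *)
  (m : nat) (K : 'I_m -> E * bool -> R)
  (K_ker : forall x : E * bool -> R,
     (forall i, \sum_(c : E * bool) K i c * x c = 0) <->
     (forall c c', endv src tgt c = endv src tgt c' -> x c = x c'))
  (* versions of E[ ut_e(t) | sigma(K Bhat ut) ] *)
  (Z : E -> R -> Omega -> R)
  (Z_ce : forall e t, in_edge (len e) t ->
     is_condexp P
       (<<s [set A | exists (i : 'I_m) (B : set R), measurable B /\
              A = (fun x => \sum_(c : E * bool) K i c * ut c.1 (endpos len c) x)
                    @^-1` B] >>)
       (ut e t) (Z e t)) :
  let u := fun e t x => ut e t x - Z e t x in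
  (* u is well defined at the vertices (almost surely) *)
  (forall c c' : E * bool, endv src tgt c = endv src tgt c' ->
     {ae P, forall x, u c.1 (endpos len c) x = u c'.1 (endpos len c') x}) /\
  (* u has the law of the Whittle-Matern field on Gamma (alpha = 1, Kirchhoff) *)
  (forall (d' : measure_display) (Omega' : measurableType d')
          (Q : probability Omega' R) (zeta : nat -> Omega' -> R)
          (lam : nat -> R) (phi : nat -> E -> R -> R) (w : E -> R -> Omega' -> R),
     iid_std_normal Q zeta ->
     graph_eigenbasis src tgt len kappa a lam phi ->
     (forall e, is_KL_field Q tau (len e) lam (fun j => phi j e) zeta (w e)) ->
     same_fdd len P u Q w).
Proof.
pose q e t := Num.max kappa0 (Num.min (kappa e t) kappaM) ^+ 2.
have len0 e : 0 <= len e by exact: ltW.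
have ba e : bmeas `[0, len e] (a e).
  by apply: (lip_bmeas (len e) (a e) Lip) => // x y; exact: a_lip.
have bq e : bmeas `[0, len e] (q e) by exact: clamped_bmeas.
have q0_pos : 0 < kappa0 ^+ 2 by rewrite exprn_gt0.
have q_lb e x : in_edge (len e) x -> kappa0 ^+ 2 <= q e x by move=> _; exact: clamped_ge.
have qk e : {ae @lebesgue_measure R, forall x, in_edge (len e) x -> q e x = kappa e x ^+ 2}.
  exact: clamped_ae.
have [dphi1 es1] := eigensystem_of_edges len kappa a q a0 len_pos ba bq a0_pos a_lb qk
  lamE phiE eigE.
have tau0 : tau != 0 by rewrite gt_eqF.
pose s1 := @edge_seq E.
have s1i : forall n, exists t, s1 n.+1 = s1 n ++ t := edge_seq_incr.
have s1u : forall n, uniq (s1 n) := edge_seq_uniq.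
pose X1 (p : E * nat) : Omega -> R := xi p.1 p.2.
(* Coefficients of the edge field within the joint family of normals of all edges; they vanish for
   modes of other edges. All variables below thus become series over one index set. *)
pose cU e t (p : E * nat) : R :=
  tau^-1 * ((Num.sqrt (lamE p.1 p.2))^-1 * edge_extend phiE p e t).
have gU e t : in_edge (len e) t -> gauss_series P (E * nat)%type X1 s1 (cU e t) (ut e t).
  move=> et; have [mu_ cu] := ut_WM e t et; split=> //.
  have SE n x : \sum_(p <- s1 n) cU e t p * X1 p x =
      kl_partial tau (lamE e) (xi e) (fun j => phiE e j t) n x.
    rewrite (big_edge_seq (fun p => cU e t p * X1 p x)); apply: eq_bigr => j _.
    rewrite (bigD1 e)//= big1 ?addr0; last first.
      move=> e' /negbTE e'e; rewrite /cU /edge_extend /= (eq_sym e) e'e; ring.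
    by rewrite /cU /edge_extend /= eqxx /X1 /=; ring.
  by under eq_fun do under eq_integral do rewrite SE.
have lU e t : in_edge (len e) t -> l2seq s1 (cU e t).
  by move=> et; exact: (gauss_series_l2seq P _ X1 xi_iid s1 s1i s1u _ _ (gU e t et)).
have ec c : in_edge (len c.1) (endpos len c).
  by rewrite /in_edge /endpos; case: c.2; rewrite ?lexx ?len0.
pose y (k : 'I_m) x : R := \sum_(c : E * bool) K k c * ut c.1 (endpos len c) x.
pose cy (k : 'I_m) p : R := \sum_(c : E * bool) K k c * cU c.1 (endpos len c) p.
have gy k : gauss_series P (E * nat)%type X1 s1 (cy k) (y k).
  exact: (gauss_series_sum P _ X1 xi_iid s1 (E * bool)%type (index_enum _) (K k)
    (fun c => cU c.1 (endpos len c)) (fun c => ut c.1 (endpos len c))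
    (fun c => gU _ _ (ec c))).
have ly k : l2seq s1 (cy k).
  exact: (gauss_series_l2seq P _ X1 xi_iid s1 s1i s1u _ _ (gy k)).
have my k : measurable_fun setT (y k) by case: (gy k).
have iy k : P.-integrable setT (EFin \o y k).
  exact: (gauss_series_integrable P _ X1 xi_iid s1 _ _ (gy k)).
(* Projection coefficients of each point value onto the conditioning variables, chosen for all
   points at once; positions outside the edges receive the default 0. *)
have [b hb] : {b : E * R -> 'I_m -> R & forall p, in_edge (len p.1) p.2 -> forall k,
    l2ip s1 (fun i => cU p.1 p.2 i - \sum_j b p j * cy j i) (cy k) = 0}.
  apply: (@choice _ _ (fun (p : E * R) (b : 'I_m -> R) => in_edge (len p.1) p.2 -> forall k,
    l2ip s1 (fun i => cU p.1 p.2 i - \sum_j b j * cy j i) (cy k) = 0)) => p.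
  have [pe|npe] := pselect (in_edge (len p.1) p.2); last by exists (fun=> 0).
  have [b0 hb] := l2_projection s1 s1i _ (index_enum 'I_m) cy (index_enum_uniq _) ly _ (lU _ _ pe).
  by exists b0 => _ k; apply: hb; exact: mem_index_enum.
pose r e t x := ut e t x - \sum_j b (e, t) j * y j x.
pose cr e t i := cU e t i - \sum_j b (e, t) j * cy j i.
have gr e t : in_edge (len e) t -> gauss_series P (E * nat)%type X1 s1 (cr e t) (r e t).
  move=> et.
  have gs := gauss_series_sum P _ X1 xi_iid s1 _ (index_enum 'I_m) (b (e, t)) cy y gy.
  have := gauss_series_linear P _ X1 xi_iid s1 (-1) _ _ _ _ gs (gU e t et).
  have -> : (fun i => -1 * (\sum_j b (e, t) j * cy j i) + cU e t i) = cr e t.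
    by apply/funext => i; rewrite mulN1r addrC.
  have -> : (fun x => -1 * (\sum_j b (e, t) j * y j x) + ut e t x) = r e t.
    by apply/funext => x; rewrite mulN1r addrC.
  by [].
have lr e t : in_edge (len e) t -> l2seq s1 (cr e t).
  by move=> et; exact: (gauss_series_l2seq P _ X1 xi_iid s1 s1i s1u _ _ (gr e t et)).
have cr_perp e t : in_edge (len e) t -> forall k, l2ip s1 (cr e t) (cy k) = 0.
  by move=> et; exact: (hb (e, t)).
(* Orthogonality of the residual to all [cy k] makes the variance of [s r + sum_k c_k y_k] even in
   [s], which is the symmetry that [condexp_lincomb] requires. *)
have Z_ae e t : in_edge (len e) t -> {ae P, forall x, Z e t x = \sum_j b (e, t) j * y j x}.
  move=> et; apply: (condexp_lincomb P y my (ut e t) (Z e t) (b (e, t)) (Z_ce e t et)).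
  - by case: (gU e t et).
  - exact: (gauss_series_integrable P _ X1 xi_iid s1 _ _ (gU e t et)).
  - exact: iy.
  - move=> s c th.
    have gs := gauss_series_sum P _ X1 xi_iid s1 _ (index_enum 'I_m) c cy y gy.
    have lc := gauss_series_l2seq P _ X1 xi_iid s1 s1i s1u _ _ gs.
    have g1 := gauss_series_linear P _ X1 xi_iid s1 s _ _ _ _ (gr e t et) gs.
    have g2 := gauss_series_linear P _ X1 xi_iid s1 (- s) _ _ _ _ (gr e t et) gs.
    rewrite (gauss_series_cos P _ X1 xi_iid s1 s1i s1u _ _ th g1).
    rewrite (gauss_series_cos P _ X1 xi_iid s1 s1i s1u _ _ th g2).
    have perp : l2ip s1 (cr e t) (fun i => \sum_k c k * cy k i) = 0.
      rewrite l2ipC (l2ip_sum _ s1i)//; last exact: lr.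
      by apply: big1 => k _; rewrite l2ipC cr_perp// mulr0.
    have sq z := l2ip_sqr s1 s1i z (cr e t) (fun i => \sum_k c k * cy k i) (lr e t et) lc.
    by rewrite (sq s) (sq (- s)) perp !mulr0 sqrrN.
(* By [K_ker] the form [x c - x c'] vanishes on the kernel of [K], hence lies in its row space. The
   identity is kept for arbitrary [z], since it serves both for the fields and for their
   coefficients. *)
have span c c' : endv src tgt c = endv src tgt c' -> exists w : 'I_m -> R,
    forall z : E * bool -> R, z c - z c' = \sum_k w k * \sum_d K k d * z d.
  move=> cc'.
  have sumdl (z : E * bool -> R) :
      \sum_c0 ((c0 == c)%:R - (c0 == c')%:R) * z c0 = z c - z c'.
    have one (c1 : E * bool) : \sum_c0 (c0 == c1)%:R * z c0 = z c1.
      rewrite (bigD1 c1)//= eqxx mul1r big1 ?addr0// => c0 /negbTE ->; exact: mul0r.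
    by under eq_bigr do rewrite mulrBl; rewrite sumrB !one.
  have [w hw] : exists w : 'I_m -> R,
      forall c0, (c0 == c)%:R - (c0 == c')%:R = \sum_i w i * K i c0.
    apply: row_span_of_kernel => x Kx.
    by rewrite sumdl ((K_ker x).1 Kx c c' cc') subrr.
  exists w => z; rewrite -sumdl.
  under eq_bigr do rewrite hw mulr_suml.
  rewrite exchange_big/=; apply: eq_bigr => k _; rewrite mulr_sumr.
  by apply: eq_bigr => c0 _; rewrite mulrA.
split.
  move=> c c' cc'; have [w hw] := span c c' cc'.
  apply: (condexp_diff_lincomb P y my _ _ _ _ w (Z_ce _ _ (ec c)) (Z_ce _ _ (ec c'))).
  - exact: (gauss_series_integrable P _ X1 xi_iid s1 _ _ (gU _ _ (ec c))).
  - exact: (gauss_series_integrable P _ X1 xi_iid s1 _ _ (gU _ _ (ec c'))).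
  - by move=> x; exact: (hw (fun d => ut d.1 (endpos len d) x)).
move=> d' Omega' Q zeta lam phi w zeta_iid eigG w_WM n pts B ptsE mB.
have [dphi2 es2] := eigensystem_of_graph src tgt len kappa a q a0 len_pos ba bq a0_pos a_lb qk
  a_cont lam phi eigG.
pose cW e t (j : nat) : R := tau^-1 * ((Num.sqrt (lam j))^-1 * phi j e t).
have s2i := es_incr _ _ _ _ _ _ _ _ es2.
have s2u := es_uniq _ _ _ _ _ _ _ _ es2.
have gW e t : in_edge (len e) t -> gauss_series Q nat zeta (iota 0) (cW e t) (w e t).
  move=> et; have [mw cw] := w_WM e t et; split=> //.
  have SE k x : \sum_(j <- iota 0 k) cW e t j * zeta j x =
      kl_partial tau lam zeta (fun j => phi j e t) k x.
    rewrite /kl_partial -(big_mkord xpredT (fun j => tau^-1 * (Num.sqrt (lam j))^-1 * zeta j x * phi j e t)).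
    rewrite /index_iota subn0; apply: eq_bigr => j _; rewrite /cW; ring.
  by under eq_fun do under eq_integral do rewrite SE.
have lW e t : in_edge (len e) t -> l2seq (iota 0) (cW e t).
  by move=> et; exact: (gauss_series_l2seq Q _ zeta zeta_iid (iota 0) s2i s2u _ _ (gW e t et)).
pose ru (i : 'I_n) := r (pts i).1 (pts i).2.
have mu_u (i : 'I_n) : measurable_fun setT (fun x => ut (pts i).1 (pts i).2 x - Z (pts i).1 (pts i).2 x).
  apply: measurable_funB; first by case: (gU _ _ (ptsE i)).
  have [GZ _] := Z_ce _ _ (ptsE i).
  exact: (sigma_gen_preimage_measurable y my _ GZ).
have mru i : measurable_fun setT (ru i) by case: (gr _ _ (ptsE i)).
have mpre (U : Omega -> R) (C : set R) : measurable_fun setT U -> measurable C ->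
    measurable (U @^-1` C).
  by move=> mU mC; rewrite -[X in measurable X]setTI; exact: mU.
(* Only finitely many points occur, so outside one null set the conditional expectations are the
   explicit combinations, and [u] may be replaced by [r]. *)
transitivity (P (\bigcap_i (ru i @^-1` B i))).
  apply: ae_iff_measure_eq.
  - by apply: finite_bigcap_measurable => i; exact: mpre.
  - by apply: finite_bigcap_measurable => i; exact: mpre.
  have := ae_finite_forall P (fun (i : 'I_n) x => Z (pts i).1 (pts i).2 x =
    \sum_j b (pts i) j * y j x).
  move=> /(_ (fun i => ltac:(have := Z_ae _ _ (ptsE i); by rewrite -surjective_pairing))).
  apply: filterS => x hx; split=> h i _; have := h i I; rewrite /= /ru /r -surjective_pairing hx//.
apply: law_eq_of_cosines => //; first by move=> i; case: (gW _ _ (ptsE i)).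
move=> t th.
pose c1 p : R := \sum_(i <- index_enum 'I_n) t i * cr (pts i).1 (pts i).2 p.
pose c2 j : R := \sum_(i <- index_enum 'I_n) t i * cW (pts i).1 (pts i).2 j.
have g1 := gauss_series_sum P _ X1 xi_iid s1 _ (index_enum 'I_n) t
  (fun i => cr (pts i).1 (pts i).2) (fun i => ru i) (fun i => gr _ _ (ptsE i)).
have g2 := gauss_series_sum Q _ zeta zeta_iid (iota 0) _ (index_enum 'I_n) t
  (fun i => cW (pts i).1 (pts i).2) (fun i => w (pts i).1 (pts i).2) (fun i => gW _ _ (ptsE i)).
rewrite (gauss_series_cos P _ X1 xi_iid s1 s1i s1u _ _ th g1).
rewrite (gauss_series_cos Q _ zeta zeta_iid (iota 0) s2i s2u _ _ th g2).
rewrite -/c1 -/c2.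
have lc1 : l2seq s1 c1 := gauss_series_l2seq P _ X1 xi_iid s1 s1i s1u _ _ g1.
have lc2 : l2seq (iota 0) c2 := gauss_series_l2seq Q _ zeta zeta_iid (iota 0) s2i s2u _ _ g2.
suff Etau : tau ^+ 2 * l2ip s1 c1 c1 = tau ^+ 2 * l2ip (iota 0) c2 c2.
  by have := mulfI (expf_neq0 2 tau0) Etau => ->.
(* The total weight that the projections place on the end [c]. The functional [L1] is [L2] minus
   these endpoint evaluations, so that the coefficients of the conditioned field are those of
   [L1]. *)
pose beta (c : E * bool) : R := \sum_i t i * \sum_k b (pts i) k * K k c.
pose L2 : seq (R * (E * R)) := [seq (t i, pts i) | i <- index_enum 'I_n].
pose L1 : seq (R * (E * R)) := L2 ++ [seq (- beta c, (c.1, endpos len c)) | c <- index_enum (E * bool)%type].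
pose Phi1 p : fpair := (edge_extend phiE p, dphi1 p).
pose Phi2 j : fpair := (phi j, dphi2 j).
have L1E (f : E -> R -> R) : pteval L1 f = \sum_i t i * (f (pts i).1 (pts i).2 -
    \sum_k b (pts i) k * \sum_c K k c * f c.1 (endpos len c)).
  rewrite /pteval /L1 big_cat /L2 !big_map /=.
  under [RHS]eq_bigr do rewrite mulrBr.
  rewrite sumrB; congr (_ + _).
  under eq_bigr do rewrite mulNr; rewrite sumrN; congr (- _).
  under eq_bigr do rewrite /beta mulr_suml.
  rewrite exchange_big/=; apply: eq_bigr => i _.
  under eq_bigr do rewrite -mulrA; rewrite -mulr_sumr; congr (_ * _).
  transitivity (\sum_c \sum_k b (pts i) k * K k c * f c.1 (endpos len c)).
    by apply: eq_bigr => c _; rewrite mulr_suml.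
  rewrite exchange_big/=; apply: eq_bigr => k _; rewrite mulr_sumr.
  by apply: eq_bigr => c _; rewrite mulrA.
have c1E p : c1 p = tau^-1 * (Num.sqrt (lamE p.1 p.2))^-1 * pteval L1 (Phi1 p).1.
  rewrite L1E mulr_sumr /c1; apply: eq_bigr => i _.
  rewrite [RHS]mulrCA; congr (_ * _); rewrite /cr -surjective_pairing mulrBr; congr (_ - _).
    by rewrite /cU mulrA.
  rewrite mulr_sumr; apply: eq_bigr => k _; rewrite [RHS]mulrCA; congr (_ * _).
  rewrite mulr_sumr; apply: eq_bigr => c _; rewrite [RHS]mulrCA; congr (_ * _).
  by rewrite /cU mulrA.
have c2E j : c2 j = tau^-1 * (Num.sqrt (lam j))^-1 * pteval L2 (Phi2 j).1.
  rewrite /pteval /L2 big_map mulr_sumr /c2; apply: eq_bigr => i _.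
  by rewrite [RHS]mulrCA; congr (_ * _); rewrite /cW mulrA.
have lam1_gt0 p : 0 < lamE p.1 p.2.
  exact: (eigenvalue_gt0 len a q a0 _ len_pos ba bq a0_pos q0_pos a_lb q_lb es1 p).
have lam2_gt0 j : 0 < lam j.
  exact: (eigenvalue_gt0 len a q a0 _ len_pos ba bq a0_pos q0_pos a_lb q_lb es2 j).
have sqE (z : R) : 0 < z -> tau ^+ 2 * (tau^-1 * (Num.sqrt z)^-1) ^+ 2 = z^-1.
  move=> z0; rewrite exprMn !exprVn sqr_sqrtr ?ltW// mulrA divff ?mul1r//.
  exact: expf_neq0.
have psE1 k : tau ^+ 2 * psum s1 (fun p => c1 p * c1 p) k =
    psum s1 (fun p => (lamE p.1 p.2)^-1 * pteval L1 (Phi1 p).1 ^+ 2) k.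
  rewrite mulr_sumr; apply: eq_bigr => p _.
  by rewrite -expr2 c1E exprMn mulrA sqE.
have psE2 k : tau ^+ 2 * psum (iota 0) (fun j => c2 j * c2 j) k =
    psum (iota 0) (fun j => (lam j)^-1 * pteval L2 (Phi2 j).1 ^+ 2) k.
  rewrite mulr_sumr; apply: eq_bigr => j _.
  by rewrite -expr2 c2E exprMn mulrA sqE.
have scale (I : eqType) (s : nat -> seq I) (si : forall n, exists t, s n.+1 = s n ++ t)
    (g h : I -> R) : l2seq s g -> (forall i, g i = tau^-1 * h i) -> l2seq s h.
  move=> lg gh; have := l2seq_linear s si tau g (fun=> 0) lg (l2seq0 s si).
  by congr l2seq; apply/funext => i; rewrite addr0 gh mulrA divff// mul1r.
apply: (pteval_variance_eq len a q a0 _ len_pos ba bq a0_pos q0_pos a_lb q_lb V src tgt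
  _ _ s1 (iota 0) _ lam Phi1 Phi2 L1 L2 _ _ es1 es2).
- by move=> e x ex; apply: (scale _ _ s1i _ _ (lU e x ex)) => p.
- by move=> e x ex; apply: (scale _ _ s2i _ _ (lW e x ex)) => p.
- move=> p; rewrite /L1 mem_cat => /orP[/mapP[i _ ->]|/mapP[c _ ->]]; first exact: ptsE.
  exact: ec.
- by move=> p /mapP[i _ ->]; exact: ptsE.
(* The endpoint values of a function continuous at the vertices lie in the kernel of [K], so the
   correction terms of [L1] vanish on it. *)
- move=> F HF vF; rewrite L1E /pteval /L2 big_map; apply: eq_bigr => i _.
  rewrite big1 ?subr0// => k _; have := (K_ker (fun c => F.1 c.1 (endpos len c))).2 vF k => ->.
  by rewrite mulr0.
- move=> c c' cc'; have [v hv] := span c c' cc'.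
  have cE : (fun p => cU c.1 (endpos len c) p - cU c'.1 (endpos len c') p) =
      fun p => \sum_k v k * cy k p.
    by apply/funext => p; exact: (hv (fun d => cU d.1 (endpos len d) p)).
  pose dc p := cU c.1 (endpos len c) p - cU c'.1 (endpos len c') p.
  (* The jump of the representer is, up to [tau^2], the inner product of [c1] with [dc]. As [dc] is
     a combination of the [cy k], to which all residuals are orthogonal, this jump is 0. *)
  have ip0 : l2ip s1 c1 dc = 0.
    rewrite (_ : dc = fun p => \sum_k v k * cy k p)//.
    rewrite l2ipC (l2ip_sum _ s1i)//; apply: big1 => k _.
    rewrite l2ipC (l2ip_sum _ s1i)//; last by move=> i; exact: lr.
    by rewrite big1 ?mulr0// => i _; rewrite cr_perp ?mulr0.
  have ldc : l2seq s1 dc.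
    rewrite (_ : dc = fun p => \sum_k v k * cy k p)//; exact: l2seq_sum.
  have cv := cvg_l2ip s1 s1i c1 dc lc1 ldc.
  rewrite ip0 in cv.
  have cv' : tau ^+ 2 * psum s1 (fun p => c1 p * dc p) k @[k --> \oo] --> tau ^+ 2 * 0.
    exact: cvgMr.
  rewrite mulr0 in cv'; apply: eq_cvgn cv' => k.
  rewrite mulr_sumr; apply: eq_bigr => p _; rewrite c1E -(sqE _ (lam1_gt0 p)) /dc /cU /endval /=.
  ring.
- have cv : tau ^+ 2 * psum s1 (fun p => c1 p * c1 p) k @[k --> \oo] -->
      tau ^+ 2 * l2ip s1 c1 c1 by apply: cvgMr; exact: cvg_l2ip.
  by apply: eq_cvgn cv => k; exact: psE1.
- have cv : tau ^+ 2 * psum (iota 0) (fun p => c2 p * c2 p) k @[k --> \oo] -->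
      tau ^+ 2 * l2ip (iota 0) c2 c2 by apply: cvgMr; exact: cvg_l2ip.
  by apply: eq_cvgn cv => k; exact: psE2.
Qed.
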